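(* Let $G$ be a group, $H\leqslant G$ a subgroup and $X\subseteq G$ a subset such that $X\cup H$ generates $G$ and the Cayley graph $\mathrm{Cay}(G,X\sqcup H)$ is a hyperbolic metric space. Let $\widehat{\mathrm d}$ be the relative metric on $H$ associated with $X$. Then there exists a constant $\overline D>0$ (depending only on $G,H,X$) such that the following holds for every normal subgroup $N\lhd H$: if (i) $\overline G:=G/\langle\langle N\rangle\rangle$ has no elements of order $2$, (ii) the image of $H$ in $\overline G$ is malnormal in $\overline G$, and (iii) $\widehat{\mathrm d}(1,n)>63\overline D$ for all $n\in N\smallsetminus\{1\}$, then there exists a set-theoretic section $\varsigma\colon\overline G\to G$ of the quotient map $G\to\overline G$ such that for all $\bar f,\bar g\in\overline G$ there exist $g_1,\dots,g_9\in G$ and $n_1,\dots,n_9\in N$ with $$\varsigma(\bar f)\varsigma(\bar g)\varsigma(\bar f\bar g)^{-1}=\prod_{i=1}^9 g_in_ig_i^{-1}.$$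
   Context: $\langle\langle N\rangle\rangle$ denotes the normal closure of $N$ in $G$. The alphabet $\mathsf A=X\sqcup H$ is the disjoint union of $X$ and $H$ (as abstract sets) and $\mathrm{Cay}(G,\mathsf A)$ has an edge labelled $a$ from $g$ to $ga$ for each $g\in G$, $a\in\mathsf A$; $\mathrm{Cay}(H,H)$ is viewed as the subgraph with vertex set $H$ and edges labelled by letters of $H$. The relative metric: for $g,h\in H$, $\widehat{\mathrm d}(g,h)$ is the length of a shortest path in $\mathrm{Cay}(G,\mathsf A)$ from $g$ to $h$ containing no edge of $\mathrm{Cay}(H,H)$ ($\infty$ if no such path exists). A subgroup $K\le \overline G$ is malnormal if $tKt^{-1}\cap K=\{1\}$ for all $t\in\overline G\smallsetminus K$. *)

(* Defs.v *)
From Stdlib Require Import Reals List.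
Import ListNotations.
Open Scope R_scope.

Record Group := {
  carrier :> Type;
  gmul : carrier -> carrier -> carrier;
  gone : carrier;
  ginv : carrier -> carrier;
  gmulA : forall x y z, gmul x (gmul y z) = gmul (gmul x y) z;
  gmul1l : forall x, gmul gone x = x;
  gmul1r : forall x, gmul x gone = x;
  gmulVl : forall x, gmul (ginv x) x = gone;
  gmulVr : forall x, gmul x (ginv x) = gone
}.

Arguments gmul {g}.
Arguments gone {g}.
Arguments ginv {g}.

Section GroupDefs.
Variable G : Group.

Definition is_subgroup (H : G -> Prop) : Prop :=
  H gone /\ (forall x y, H x -> H y -> H (gmul x y)) /\ (forall x, H x -> H (ginv x)).

Definition is_normal_subgroup_of (N H : G -> Prop) : Prop :=
  is_subgroup N /\ (forall x, N x -> H x) /\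
  (forall h n, H h -> N n -> N (gmul (gmul h n) (ginv h))).

Inductive gen_by (S : G -> Prop) : G -> Prop :=
| gen_one : gen_by S gone
| gen_elt : forall s, S s -> gen_by S s
| gen_mul : forall x y, gen_by S x -> gen_by S y -> gen_by S (gmul x y)
| gen_inv : forall x, gen_by S x -> gen_by S (ginv x).

Definition generates (S : G -> Prop) : Prop := forall g, gen_by S g.

Inductive ncl (N : G -> Prop) : G -> Prop :=
| ncl_one : ncl N gone
| ncl_conj : forall n g, N n -> ncl N (gmul (gmul g n) (ginv g))
| ncl_mul : forall x y, ncl N x -> ncl N y -> ncl N (gmul x y)
| ncl_inv : forall x, ncl N x -> ncl N (ginv x).

(* Congruence modulo <<N>>: x and y have the same image in G/<<N>> *)
Definition qeq (N : G -> Prop) (x y : G) : Prop := ncl N (gmul (ginv x) y).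

Definition letter (X H : G -> Prop) : Type := ({x : G | X x} + {h : G | H h})%type.

Definition letter_val {X H : G -> Prop} (a : letter X H) : G :=
  match a with inl x => proj1_sig x | inr h => proj1_sig h end.

(* A step along an (undirected) edge of Cay(G,A): a letter together with
   a direction (true = forward along the edge g -> g a, false = backward). *)
Definition step (X H : G -> Prop) : Type := (letter X H * bool)%type.

Definition step_val {X H : G -> Prop} (s : step X H) : G :=
  if snd s then letter_val (fst s) else ginv (letter_val (fst s)).

Fixpoint path_end {X H : G -> Prop} (g : G) (w : list (step X H)) : G :=
  match w with
  | [] => g
  | s :: w' => path_end (gmul g (step_val s)) w'
  end.

(* the path starting at g following w uses no edge of Cay(H,H):
   an edge of Cay(H,H) is an edge v -> v h labelled by a letter of H with v in H
   (traversed in either direction; since h in H, v in H iff v h in H). *)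
Fixpoint avoids_HH {X H : G -> Prop} (g : G) (w : list (step X H)) : Prop :=
  match w with
  | [] => True
  | s :: w' =>
      (match fst s with inl _ => True | inr _ => ~ H g end) /\
      avoids_HH (gmul g (step_val s)) w'
  end.

Definition cay_dist (X H : G -> Prop) (g h : G) (n : nat) : Prop :=
  (exists w : list (step X H), length w = n /\ path_end g w = h) /\
  (forall w : list (step X H), path_end g w = h -> (n <= length w)%nat).

(* Gromov hyperbolicity of Cay(G, X ⊔ H) (four-point condition on vertices,
   Gromov products computed with the graph metric). *)
Definition cay_hyperbolic (X H : G -> Prop) : Prop :=
  exists delta : R, 0 <= delta /\
  forall x y z p (dxy dxz dyz dxp dyp dzp : nat),
    cay_dist X H x y dxy -> cay_dist X H x z dxz -> cay_dist X H y z dyz ->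
    cay_dist X H x p dxp -> cay_dist X H y p dyp -> cay_dist X H z p dzp ->
    (INR dxp + INR dyp - INR dxy) / 2 >=
      Rmin ((INR dxp + INR dzp - INR dxz) / 2) ((INR dyp + INR dzp - INR dyz) / 2)
      - delta.

(* \hat d(g,h) > r : every path from g to h in Cay(G,A) avoiding the edges of
   Cay(H,H) has length > r (vacuous when \hat d(g,h) = infinity). *)
Definition rel_dist_gt (X H : G -> Prop) (g h : G) (r : R) : Prop :=
  forall w : list (step X H), path_end g w = h -> avoids_HH g w -> INR (length w) > r.

Fixpoint prod_conj (c m : nat -> G) (k : nat) : G :=
  match k with
  | O => gone
  | S k' => gmul (prod_conj c m k') (gmul (gmul (c k') (m k')) (ginv (c k')))
  end.

End GroupDefs.

Arguments is_subgroup {G}.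
Arguments is_normal_subgroup_of {G}.
Arguments generates {G}.
Arguments qeq {G}.
Arguments cay_hyperbolic {G}.
Arguments rel_dist_gt {G}.
Arguments prod_conj {G}.

(* Main.v *)
(** Write [K] for the normal closure of [N] and [Q = G/K].

    Geometry. In a geodesic polygon of [Cay(G, X + H)] a component that is connected to no other
    component has bounded relative length, linearly in the number of sides. Hence every coset of
    [H] carries coarse projections, measured by the relative metric, which satisfy Behrstock's
    inequality.

    Shortening. [K] is the increasing union of the subgroups generated by the conjugates
    [v N v^-1] with [v] in a ball about 1. By induction on the radius, each [k <> 1] in [K] moves 1
    very far as seen from some coset [v], and multiplying [k] by a suitable element of
    [v N v^-1] makes it simpler. So a polygon of [Q] with boundedly many sides lifts to a path in
    [G] which can be closed up by rotating its tail about cosets it passes through. In particular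
    [Q] is hyperbolic with the same constant as [G], and its cosets carry the same projections.

    Paths of cosets. Replacing each projection by its union over an equivalence class of cosets
    that look alike makes Behrstock's inequality exact (in the manner of Bestvina, Bromberg,
    Fujiwara and Sisto). The cosets that see [a] and [b] far apart then form a path from [a] to
    [b], and in a triangle each side has at most two cosets outside the other two sides.

    The section. Consecutive cosets of such a path are joined by geodesics without long letters,
    which are lifted to [G] equivariantly and compatibly with reversal; malnormality and the
    absence of involutions make this possible. The section reads these lifts along the path of
    cosets from 1 to the given point. In a triangle the common parts of the sides cancel; what
    remains is a polygon of at most nine cosets (three corners and two on each side), which lifts
    up to one element of [N] per coset. *)

Require Import Defs.
From Stdlib Require Import Reals List Lia Lra Arith Classical ClassicalEpsilon FunctionalExtensionality PropExtensionality ProofIrrelevance.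
Import ListNotations.
Open Scope nat_scope.

(* The constant must be fixed before [N], while a path of cosets can be arbitrarily long, so no
   estimate may be summed along a whole path. The lifts are therefore chosen so coherently that the
   common parts of two sides cancel as elements of [G], and only a word of at most eighteen factors,
   at most nine of them letters of [H], has to be closed up. Closing up changes each letter of [H]
   by an element of [N] and leaves every other factor as it is; hence the number of conjugates is
   the number of letters of [H]. This coherence is what demands exact projections: a path must be
   subdivided again and again without loss in the threshold that decides which cosets lie on it. It
   also demands that nothing nontrivial preserves a pair of distinct cosets, since such an element
   would obstruct an equivariant choice. *)
Declare Scope grp_scope.
Notation "x ** y" := (gmul x y) (at level 40, left associativity) : grp_scope.
Notation "x ^-1" := (ginv x) (at level 29, left associativity, format "x ^-1") : grp_scope.
Open Scope grp_scope.

(** * Group calculus *)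

Lemma gmul_cancel_l (G : Group) (x y z : G) : x ** y = x ** z -> y = z.
Proof.
  intro e. rewrite <- (gmul1l G y), <- (gmul1l G z), <- (gmulVl G x).
  rewrite <- !gmulA. now rewrite e.
Qed.

Lemma gmulK (G : Group) (x y : G) : x^-1 ** (x ** y) = y.
Proof. now rewrite gmulA, gmulVl, gmul1l. Qed.

Lemma gmulVK (G : Group) (x y : G) : x ** (x^-1 ** y) = y.
Proof. now rewrite gmulA, gmulVr, gmul1l. Qed.

Lemma ginv_unique (G : Group) (x y : G) : x ** y = gone -> y = x^-1.
Proof. intro e. apply (gmul_cancel_l G x). now rewrite e, gmulVr. Qed.

Lemma ginv_mul (G : Group) (x y : G) : (x ** y)^-1 = y^-1 ** x^-1.
Proof.
  symmetry. apply ginv_unique.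
  now rewrite <- gmulA, (gmulA _ y), gmulVr, gmul1l, gmulVr.
Qed.

Lemma ginv_inv (G : Group) (x : G) : x^-1^-1 = x.
Proof. symmetry. apply ginv_unique. apply gmulVl. Qed.

Lemma ginv_one (G : Group) : (gone : G)^-1 = gone.
Proof. symmetry. apply ginv_unique. apply gmul1l. Qed.

Lemma gmulAr (G : Group) (x y z : G) : (x ** y) ** z = x ** (y ** z).
Proof. symmetry; apply gmulA. Qed.

Create HintDb grp.
#[global] Hint Rewrite gmulAr gmul1l gmul1r gmulVl gmulVr gmulK gmulVK ginv_mul ginv_inv ginv_one : grp.
Ltac gs := autorewrite with grp.
Ltac gsin H := autorewrite with grp in H.
Ltac grp := gs; reflexivity.

(** * Walks of given length *)

Inductive walk {A : Type} (R : A -> A -> Prop) : nat -> A -> A -> Prop :=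
| walk_nil : forall x, walk R 0 x x
| walk_cons : forall n x y z, R x y -> walk R n y z -> walk R (S n) x z.

Section Walks.
Context {A : Type}.
Implicit Types R : A -> A -> Prop.

Lemma walk_one R x y : R x y -> walk R 1 x y.
Proof. intro r. eapply walk_cons; [exact r | constructor]. Qed.

Lemma walk_app R n m x y z : walk R n x y -> walk R m y z -> walk R (n + m) x z.
Proof.
  induction 1; intros; simpl; auto. eapply walk_cons; eauto.
Qed.

Lemma walk_map {B : Type} (f : A -> B) R (R' : B -> B -> Prop) n x y :
  (forall u v, R u v -> R' (f u) (f v)) -> walk R n x y -> walk R' n (f x) (f y).
Proof. intros h; induction 1; econstructor; eauto. Qed.

Lemma walk_mono R (R' : A -> A -> Prop) n x y :
  (forall u v, R u v -> R' u v) -> walk R n x y -> walk R' n x y.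
Proof. intros h; induction 1; econstructor; eauto. Qed.

Lemma walk_rev R n x y :
  (forall u v, R u v -> R v u) -> walk R n x y -> walk R n y x.
Proof.
  intros h; induction 1. constructor.
  replace (S n) with (n + 1) by lia. eapply walk_app; eauto. apply walk_one; auto.
Qed.

Lemma walk_split R i j x y :
  walk R (i + j) x y -> exists z, walk R i x z /\ walk R j z y.
Proof.
  revert x; induction i; simpl; intros x w.
  - exists x; split; [constructor | auto].
  - inversion w; subst. destruct (IHi _ H1) as (z & ? & ?).
    exists z; split; auto. econstructor; eauto.
Qed.

Lemma walk_0 R x y : walk R 0 x y -> x = y.
Proof. intro w; inversion w; auto. Qed.

Lemma walk_edges R (R' : A -> A -> Prop) n x y :
  walk R n x y ->
  (forall c d i j, walk R i x c -> R c d -> walk R j d y -> i + 1 + j = n -> R' c d) ->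
  walk R' n x y.
Proof.
  induction 1; intros h; [constructor|].
  apply walk_cons with (y := y).
  - apply (h x y 0 n); auto. constructor.
  - apply IHwalk. intros c d i j w1 r w2 e.
    apply (h c d (S i) j); auto. econstructor; eauto. lia.
Qed.

Definition above (f : A -> nat) R (m : nat) (x y : A) := R x y /\ m <= f x /\ m <= f y.

Lemma above_sym f R m :
  (forall u v, R u v -> R v u) -> forall u v, above f R m u v -> above f R m v u.
Proof. intros h u v (a & b & c). exact (conj (h _ _ a) (conj c b)). Qed.

Lemma walk_end (P : A -> Prop) R n x y : (forall u v, R u v -> P v) -> walk R n x y -> P x -> P y.
Proof. intros h w. induction w; eauto. Qed.

Lemma walk_above_start f R n x y : walk (above f R (f y)) n x y -> f y <= f x.
Proof. intros w. inversion w as [|? ? ? ? (_ & ? & _)]; auto. Qed.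

Lemma walk_min (f : A -> nat) R n x y :
  walk R n x y -> exists z i j, i + j = n /\
    walk (above f R (f z)) i x z /\ walk (above f R (f z)) j z y.
Proof.
  induction 1 as [x | n x y z r w (m & i & j & e & w1 & w2)].
  - exists x, 0, 0; repeat split; constructor.
  - destruct (Nat.lt_ge_cases (f x) (f m)) as [l | l].
    + exists x, 0, (S n); repeat split; [constructor|].
      assert (k : walk (above f R (f m)) n y z) by (rewrite <- e; eapply walk_app; eauto).
      apply walk_cons with y.
      * repeat split; auto. apply walk_above_start in w1; lia.
      * eapply walk_mono; [|exact k]. intros u v (? & ? & ?); repeat split; auto; lia.
    + exists m, (S i), j; repeat split; [lia | | auto].
      apply walk_cons with y; auto. repeat split; auto.
      apply walk_above_start in w1; lia.
Qed.

End Walks.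

Lemma least_nat (P : nat -> Prop) : (exists n, P n) -> exists n, P n /\ forall m, P m -> n <= m.
Proof.
  intros [n Pn]. revert Pn. induction n as [n IH] using (well_founded_induction lt_wf). intro Pn.
  destruct (classic (exists m, m < n /\ P m)) as [(m & l & Pm) | h].
  - exact (IH m l Pm).
  - exists n; split; auto. intros m Pm. apply Nat.nlt_ge. intro; apply h; eauto.
Qed.

(* Only the [m] factors in [H] are ambiguous modulo [N]; each of them will cost one conjugate. *)
Inductive coset_word {G : Group} (H S : G -> Prop) : nat -> nat -> G -> Prop :=
| pw_short : forall t, S t -> coset_word H S 0 1 t
| pw_H : forall h, H h -> coset_word H S 1 1 h
| pw_mul : forall m s g m' s' g', coset_word H S m s g -> coset_word H S m' s' g' -> coset_word H S (m + m') (s + s') (g ** g').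

(** * Products of conjugates *)

Section Conjugates.
Variables (G : Group) (N : G -> Prop).
Hypothesis Nsub : is_subgroup N.

Inductive conj_prod : nat -> G -> Prop :=
| conj_prod_zero : conj_prod 0 gone
| conj_prod_succ : forall m k n c, conj_prod m k -> N n -> conj_prod (S m) (k ** (c ** n ** c^-1)).

Lemma conj_prod_one n c : N n -> conj_prod 1 (c ** n ** c^-1).
Proof. intro h. rewrite <- (gmul1l G (c ** n ** c^-1)). apply conj_prod_succ; auto. apply conj_prod_zero. Qed.

Lemma conj_prod_mul m m' k k' : conj_prod m k -> conj_prod m' k' -> conj_prod (m + m') (k ** k').
Proof.
  intros h h'. induction h' as [| m' k' n c _ IH hn].
  - rewrite Nat.add_0_r, gmul1r. auto.
  - rewrite Nat.add_succ_r, gmulA. apply conj_prod_succ; auto.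
Qed.

Lemma conj_prod_conj m k g : conj_prod m k -> conj_prod m (g ** k ** g^-1).
Proof.
  induction 1 as [| m k n c _ IH hn].
  - gs. apply conj_prod_zero.
  - replace (g ** (k ** (c ** n ** c^-1)) ** g^-1)
      with (g ** k ** g^-1 ** ((g ** c) ** n ** (g ** c)^-1)) by grp.
    apply conj_prod_succ; auto.
Qed.

Lemma conj_prod_inv m k : conj_prod m k -> conj_prod m (k^-1).
Proof.
  induction 1 as [| m k n c _ IH hn].
  - rewrite ginv_one. apply conj_prod_zero.
  - replace ((k ** (c ** n ** c^-1))^-1) with ((c ** n^-1 ** c^-1) ** k^-1) by grp.
    apply (conj_prod_mul 1 m); auto. apply conj_prod_one. apply Nsub; auto.
Qed.

Lemma conj_prod_mono m m' k : m <= m' -> conj_prod m k -> conj_prod m' k.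
Proof.
  induction 1 as [| m' _ IH]; auto. intro h. rewrite <- (gmul1r G k).
  replace (gone : G) with (gone ** gone ** gone^-1 : G) by grp.
  apply conj_prod_succ; auto. apply Nsub.
Qed.

Lemma conj_prod_prod_conj m k : conj_prod m k ->
  exists c n : nat -> G, (forall i, i < m -> N (n i)) /\ k = prod_conj c n m.
Proof.
  assert (ext : forall (c c' n n' : nat -> G) m, (forall i, i < m -> c i = c' i /\ n i = n' i) ->
    prod_conj c n m = prod_conj c' n' m).
  { intros c c' n n'. induction m0 as [|j IH]; intro e; simpl; auto.
    rewrite IH by auto. destruct (e j ltac:(lia)) as [-> ->]. auto. }
  induction 1 as [| m k n c _ (c' & n' & h & ->) hn].
  - exists (fun _ => gone), (fun _ => gone). split; auto. intros; lia.
  - exists (fun i => if i =? m then c else c' i), (fun i => if i =? m then n else n' i). split.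
    + intros i l. destruct (Nat.eqb_spec i m); auto. apply h; lia.
    + simpl. rewrite Nat.eqb_refl. f_equal. apply ext. intros i l.
      destruct (Nat.eqb_spec i m); [lia | auto].
Qed.

End Conjugates.
Arguments conj_prod {G} N.

(** * Relative metrics and projections *)

Section Geometry.
Variables (V : Group) (H X : V -> Prop).

Definition Xadj (x y : V) := X (x^-1 ** y) \/ X (y^-1 ** x).
(* Throughout, the coset [v H] is represented by any of its points [v]; equality of cosets is [Hadj]. *)
Definition Hadj (x y : V) := H (x^-1 ** y).
Definition adj (x y : V) := Xadj x y \/ Hadj x y.
(* Edges of the Cayley graph other than the H-edges of the coset [v H]. *)
Definition adj_off (v x y : V) := Xadj x y \/ (Hadj x y /\ ~ Hadj v x).

Definition dist (x y : V) : nat :=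
  epsilon (inhabits 0) (fun n => walk adj n x y /\ forall m, walk adj m x y -> n <= m).

(* Some geodesic from [x] to [y] avoids the H-edges of [v H]. *)
Definition clean (v x y : V) := walk (adj_off v) (dist x y) x y.
(* The relative metric of [v H] between [x] and [y] is at most [r]. *)
Definition rdist_le (v : V) (r : nat) (x y : V) := exists n, n <= r /\ walk (adj_off v) n x y.
(* The coarse projection of [x] to [v H]. *)
Definition entry (v x p : V) := Hadj v p /\ clean v x p.
(** All entry points are compared, so no choice of a projection is involved; transitivity relies on
    [entry_exists]. *)
Definition near_pt (v x y : V) (r : nat) := forall p q, entry v x p -> entry v y q -> rdist_le v r p q.

Hypothesis Hsub : is_subgroup H.
Hypothesis Hgen : generates (fun g => X g \/ H g).

Lemma Hadj_refl x : Hadj x x.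
Proof. unfold Hadj. rewrite gmulVl. apply Hsub. Qed.

Lemma Hadj_sym x y : Hadj x y -> Hadj y x.
Proof.
  unfold Hadj; intro h. apply Hsub in h. gsin h. auto.
Qed.

Lemma Hadj_trans x y z : Hadj x y -> Hadj y z -> Hadj x z.
Proof.
  unfold Hadj; intros h k.
  destruct Hsub as (_ & m & _). specialize (m _ _ h k). gsin m. auto.
Qed.

Lemma Hadj_mul g x y : Hadj x y -> Hadj (g ** x) (g ** y).
Proof. unfold Hadj. gs. auto. Qed.

Lemma Hadj_mul_inv g x y : Hadj (g ** x) (g ** y) -> Hadj x y.
Proof. unfold Hadj. gs. auto. Qed.

Lemma Xadj_sym x y : Xadj x y -> Xadj y x.
Proof. unfold Xadj; tauto. Qed.

Lemma Xadj_mul g x y : Xadj x y -> Xadj (g ** x) (g ** y).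
Proof. unfold Xadj. gs. auto. Qed.

Lemma adj_sym x y : adj x y -> adj y x.
Proof. intros [a|a]; [left; apply Xadj_sym | right; apply Hadj_sym]; auto. Qed.

Lemma adj_mul g x y : adj x y -> adj (g ** x) (g ** y).
Proof. intros [a|a]; [left; apply Xadj_mul | right; apply Hadj_mul]; auto. Qed.

Lemma adj_off_sym v x y : adj_off v x y -> adj_off v y x.
Proof.
  intros [a|[a b]]; [left; apply Xadj_sym; auto | right; split; [apply Hadj_sym; auto|]].
  intro c; apply b. eapply Hadj_trans; [exact c | apply Hadj_sym; auto].
Qed.

Lemma adj_off_adj v x y : adj_off v x y -> adj x y.
Proof. intros [a|[a b]]; [left | right]; auto. Qed.

Lemma adj_off_mul g v x y : adj_off v x y -> adj_off (g ** v) (g ** x) (g ** y).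
Proof.
  intros [a|[a b]]; [left; apply Xadj_mul; auto | right; split; [apply Hadj_mul; auto|]].
  intro c; apply b. eapply Hadj_mul_inv; eauto.
Qed.

Lemma adj_off_coset v v' x y : Hadj v v' -> adj_off v x y -> adj_off v' x y.
Proof.
  intros h [a|[a b]]; [left; auto | right; split; auto].
  intro c; apply b; eapply Hadj_trans; eauto.
Qed.

Lemma walk_exists x y : exists n, walk adj n x y.
Proof.
  assert (h : forall g, gen_by V (fun g => X g \/ H g) g -> forall x, exists n, walk adj n x (x ** g)).
  { clear x y. induction 1; intros z.
    - exists 0. rewrite gmul1r. constructor.
    - exists 1. apply walk_one. destruct H0 as [h|h].
      + left; left; gs; auto.
      + right; unfold Hadj; gs; auto.
    - destruct (IHgen_by1 z) as [n w1]. destruct (IHgen_by2 (z ** x)) as [m w2].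
      exists (n + m). rewrite gmulA. eapply walk_app; eauto.
    - destruct (IHgen_by (z ** x^-1)) as [n w]. exists n.
      gsin w. apply walk_rev; auto. apply adj_sym. }
  destruct (h (x^-1 ** y) (Hgen _) x) as [n w]. gsin w. eauto.
Qed.

Lemma dist_spec x y : walk adj (dist x y) x y /\ forall m, walk adj m x y -> dist x y <= m.
Proof.
  unfold dist. apply epsilon_spec. apply least_nat, walk_exists.
Qed.

Lemma dist_walk x y : walk adj (dist x y) x y.
Proof. apply dist_spec. Qed.

Lemma dist_le n x y : walk adj n x y -> dist x y <= n.
Proof. apply dist_spec. Qed.

Lemma dist_le_off v n x y : walk (adj_off v) n x y -> dist x y <= n.
Proof. intro w. apply dist_le. eapply walk_mono; [|exact w]. apply adj_off_adj. Qed.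

Lemma dist_xx x : dist x x = 0.
Proof. assert (dist x x <= 0) by (apply dist_le; constructor). lia. Qed.

Lemma dist_0 x y : dist x y = 0 -> x = y.
Proof. intro h. apply (walk_0 adj). rewrite <- h. apply dist_walk. Qed.

Lemma dist_sym x y : dist x y = dist y x.
Proof.
  apply Nat.le_antisymm; apply dist_le; apply walk_rev; try apply dist_walk; apply adj_sym.
Qed.

Lemma dist_tri x y z : dist x z <= dist x y + dist y z.
Proof. apply dist_le. eapply walk_app; apply dist_walk. Qed.

Lemma dist_mul g x y : dist (g ** x) (g ** y) = dist x y.
Proof.
  assert (h : forall g x y, dist (g ** x) (g ** y) <= dist x y).
  { intros. apply dist_le. apply (walk_map (fun z => g0 ** z) adj).
    - intros; apply adj_mul; auto.
    - apply dist_walk. }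
  apply Nat.le_antisymm; auto.
  specialize (h (g^-1) (g ** x) (g ** y)). gsin h. auto.
Qed.

Lemma dist_Hadj x y : Hadj x y -> dist x y <= 1.
Proof. intro h. apply dist_le, walk_one. right; auto. Qed.

Lemma rdist_le_refl v r x : rdist_le v r x x.
Proof. exists 0; split; [lia | constructor]. Qed.

Lemma rdist_le_sym v r x y : rdist_le v r x y -> rdist_le v r y x.
Proof. intros (n & l & w); exists n; split; auto. apply walk_rev; auto. apply adj_off_sym. Qed.

Lemma rdist_le_trans v r s x y z : rdist_le v r x y -> rdist_le v s y z -> rdist_le v (r + s) x z.
Proof.
  intros (n & l & w) (m & k & u). exists (n + m); split; [lia|]. eapply walk_app; eauto.
Qed.

Lemma rdist_le_mono v r s x y : r <= s -> rdist_le v r x y -> rdist_le v s x y.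
Proof. intros l (n & k & w); exists n; split; auto; lia. Qed.

Lemma rdist_le_mul g v r x y : rdist_le v r x y -> rdist_le (g ** v) r (g ** x) (g ** y).
Proof.
  intros (n & l & w); exists n; split; auto.
  apply (walk_map (fun z => g ** z) (adj_off v)); auto. intros; apply adj_off_mul; auto.
Qed.

Lemma rdist_le_coset v v' r x y : Hadj v v' -> rdist_le v r x y -> rdist_le v' r x y.
Proof.
  intros h (n & l & w); exists n; split; auto.
  eapply walk_mono; [|exact w]. intros; eapply adj_off_coset; eauto.
Qed.

Lemma clean_sym v x y : clean v x y -> clean v y x.
Proof. unfold clean. rewrite (dist_sym y x). apply walk_rev. apply adj_off_sym. Qed.

Lemma clean_refl v x : clean v x x.
Proof. unfold clean. rewrite dist_xx. constructor. Qed.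

Lemma clean_mul g v x y : clean v x y -> clean (g ** v) (g ** x) (g ** y).
Proof.
  unfold clean. rewrite dist_mul. apply (walk_map (fun z => g ** z)).
  intros; apply adj_off_mul; auto.
Qed.

Lemma clean_coset v v' x y : Hadj v v' -> clean v x y -> clean v' x y.
Proof.
  intros h w. eapply walk_mono; [|exact w]. intros; eapply adj_off_coset; eauto.
Qed.

Lemma clean_intro v n x y : walk (adj_off v) n x y -> n <= dist x y -> clean v x y.
Proof.
  intros w l. unfold clean. assert (dist x y <= n) by (eapply dist_le_off; eauto).
  now replace (dist x y) with n by lia.
Qed.

Lemma clean_Xadj v x y : Xadj x y -> clean v x y.
Proof.
  intro h. destruct (dist x y) eqn:e.
  - apply dist_0 in e; subst. apply clean_refl.
  - apply (clean_intro v 1); [|lia]. apply walk_one. left; auto.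
Qed.

Lemma clean_Hadj v x y : Hadj x y -> ~ Hadj v x -> clean v x y.
Proof.
  intros h k. destruct (dist x y) eqn:e.
  - apply dist_0 in e; subst. apply clean_refl.
  - apply (clean_intro v 1); [|lia]. apply walk_one. right; auto.
Qed.

Lemma clean_in_coset v x y : Hadj v x -> Hadj v y -> clean v x y -> rdist_le v 1 x y.
Proof.
  intros h k c. exists (dist x y); split; auto. apply dist_Hadj.
  eapply Hadj_trans; [apply Hadj_sym|]; eauto.
Qed.

(** The relation [R] carries a further property of the edges, such as avoiding a second coset or
    having short letters, through the cut. *)
Lemma geodesic_split (R : V -> V -> Prop) v x y :
  (forall a b, R a b -> adj a b) -> walk R (dist x y) x y ->
  walk (fun a b => R a b /\ adj_off v a b) (dist x y) x y \/
  exists c d, walk R (dist x c) x c /\ R c d /\ walk R (dist d y) d y /\ ~ adj_off v c d /\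
    Hadj v c /\ Hadj v d /\ dist x y = dist x c + 1 + dist d y.
Proof.
  intros Ra w.
  destruct (classic (exists c d i j, walk R i x c /\ R c d /\ walk R j d y /\ i + 1 + j = dist x y
     /\ ~ adj_off v c d)) as [(c & d & i & j & w1 & r & w2 & e & na) | h].
  - right. exists c, d.
    assert (dist x c <= i) by (apply dist_le; eapply walk_mono; eauto).
    assert (dist d y <= j) by (apply dist_le; eapply walk_mono; eauto).
    assert (dist c d <= 1) by (apply dist_le, walk_one; auto).
    pose proof (dist_tri x c y). pose proof (dist_tri c d y).
    replace (dist x c) with i by lia. replace (dist d y) with j by lia.
    destruct (Ra _ _ r) as [a|a].
    { exfalso; apply na; left; auto. }
    assert (Hadj v c) by (apply NNPP; intro; apply na; right; auto).
    repeat split; auto. eapply Hadj_trans; eauto.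
  - left. eapply walk_edges; [exact w|]. intros c d i j w1 r w2 e.
    split; auto. apply NNPP; intro na. apply h. exists c, d, i, j; auto.
Qed.

(* Two points of a coset are at distance at most 1, so a geodesic uses at most one edge of it. *)
Lemma clean_on_geodesic v x y c d :
  Hadj v c -> Hadj v d -> dist x y = dist x c + 1 + dist d y -> clean v x c.
Proof.
  intros hc hd e.
  destruct (geodesic_split adj v x c (fun a b h => h) (dist_walk x c)) as [w | (c' & d' & _ & _ & _ & _ & h1 & h2 & e')].
  - eapply walk_mono; [|exact w]. intros ? ? [_ ?]; auto.
  - exfalso. pose proof (dist_tri x c' y). pose proof (dist_tri c' d y).
    assert (dist c' d <= 1) by (apply dist_Hadj; eapply Hadj_trans; [apply Hadj_sym|]; eauto).
    lia.
Qed.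

Lemma clean_or_split v x y :
  clean v x y \/
  exists c d, Hadj v c /\ Hadj v d /\ dist x y = dist x c + 1 + dist d y /\
    clean v x c /\ clean v d y.
Proof.
  destruct (geodesic_split adj v x y (fun a b h => h) (dist_walk x y)) as [w | (c & d & _ & _ & _ & _ & h1 & h2 & e)].
  - left. eapply walk_mono; [|exact w]. intros ? ? [_ ?]; auto.
  - right. exists c, d. repeat split; auto.
    + eapply clean_on_geodesic with (d := d); eauto.
    + apply clean_sym. apply clean_on_geodesic with (y := x) (d := c); auto.
      rewrite (dist_sym y x), (dist_sym y d), (dist_sym c x). lia.
Qed.

Lemma entry_exists v x : exists p, entry v x p.
Proof.
  destruct (clean_or_split v x v) as [c | (c & d & h1 & _ & _ & h2 & _)].
  - exists v; split; auto. apply Hadj_refl.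
  - exists c; split; auto.
Qed.

Lemma entry_mul g v x p : entry v x p -> entry (g ** v) (g ** x) (g ** p).
Proof. intros [h c]; split; [apply Hadj_mul | apply clean_mul]; auto. Qed.

Lemma entry_coset v v' x p : Hadj v v' -> entry v x p -> entry v' x p.
Proof.
  intros h [k c]; split; [eapply Hadj_trans; [apply Hadj_sym|]; eauto | eapply clean_coset; eauto].
Qed.

Lemma near_pt_sym v x y r : near_pt v x y r -> near_pt v y x r.
Proof. intros h p q a b. apply rdist_le_sym; auto. Qed.

Lemma near_pt_mono v x y r s : r <= s -> near_pt v x y r -> near_pt v x y s.
Proof. intros l h p q a b. eapply rdist_le_mono; eauto. Qed.

Lemma near_pt_trans v x y z r s : near_pt v x y r -> near_pt v y z s -> near_pt v x z (r + s).
Proof.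
  intros h k p q a b. destruct (entry_exists v y) as [m c]. eapply rdist_le_trans; eauto.
Qed.

Lemma near_pt_mul g v x y r : near_pt v x y r -> near_pt (g ** v) (g ** x) (g ** y) r.
Proof.
  intros h p q a b.
  apply (entry_mul (g^-1)) in a. apply (entry_mul (g^-1)) in b. rewrite !gmulK in a, b.
  specialize (h _ _ a b). apply (rdist_le_mul g) in h. now rewrite !gmulVK in h.
Qed.

Lemma near_pt_mul_inv g v x y r : near_pt (g ** v) (g ** x) (g ** y) r -> near_pt v x y r.
Proof. intro h. apply (near_pt_mul (g^-1)) in h. now rewrite !gmulK in h. Qed.

Lemma near_pt_coset v v' x y r : Hadj v v' -> near_pt v x y r -> near_pt v' x y r.
Proof.
  intros h k p q a b. apply Hadj_sym in h as h'.
  apply rdist_le_coset with (v := v); auto. apply k; eapply entry_coset; eauto.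
Qed.

(** * Polygons in the hyperbolic Cayley graph *)

Section Hyperbolic.
Variable del : nat.
Hypothesis hyp : forall x y z t,
  dist x z + dist y t <= Nat.max (dist x y + dist z t) (dist x t + dist y z) + del.

(** The estimates of [triangle_bound] reach at most [16 * del + 25]. Stating that bound with
    [polyD - 1] leaves one unit per triangle, which in [near_pt_walk] pays for the last edge inside
    the coset. *)
Definition polyD := 16 * del + 30.

Ltac hyps x y z t := pose proof (hyp x y z t).

Section Triangle.
Variables (v a d y y' : V).
Hypotheses (ha : Hadj v a) (hd : Hadj v d).

Lemma dist_same_coset : dist a d <= 1.
Proof. apply dist_Hadj. eapply Hadj_trans; [apply Hadj_sym|]; eauto. Qed.

(** The last hypothesis bounds [dist m y] by the Gromov product of [a] and [y'] at [y]: on the side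
    from [y] to [a], the point [m] comes before the branching point of the triangle. Beyond that
    point [insize_near] applies. *)
Lemma insize_far (m q : V) :
  dist a m + dist m y = dist a y -> dist y q + dist q y' = dist y y' -> dist y q = dist m y ->
  2 * dist m y + dist a y' <= dist a y + dist y y' ->
  dist m q <= 2 * del.
Proof.
  intros.
  pose proof (dist_sym m y). pose proof (dist_sym m a). pose proof (dist_sym y' q).
  pose proof (dist_sym y q). pose proof (dist_sym y y'). pose proof (dist_sym m y').
  hyps m a y' y. hyps m y q y'. lia.
Qed.

Lemma insize_near (m q : V) :
  dist a m + dist m y = dist a y -> dist d q + dist q y' = dist d y' ->
  dist d q = Nat.min (dist a m) (dist d y') ->
  dist a y + dist y y' <= 2 * dist m y + dist a y' ->
  dist m q <= 2 * del + 2.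
Proof.
  intros. pose proof dist_same_coset.
  pose proof (dist_sym m y). pose proof (dist_sym m a). pose proof (dist_sym y' q).
  pose proof (dist_sym d q). pose proof (dist_sym y y'). pose proof (dist_sym m y').
  pose proof (dist_sym a d). pose proof (dist_sym m d).
  pose proof (dist_tri a d y'). pose proof (dist_tri d a y'). pose proof (dist_tri d a m).
  pose proof (dist_tri m q y').
  hyps m a y' y. hyps m d q y'. lia.
Qed.

(** All points of the coset are within 1 of [a], so a geodesic of length at most [r] starting at [m]
    cannot reach it. *)
Lemma far_clean m q r : r + 1 < dist a m -> dist m q <= r -> clean v m q.
Proof.
  intros l k. destruct (clean_or_split v m q) as [c | (c & f & h1 & h2 & e & _)]; auto.
  exfalso. pose proof (dist_tri a c m).
  assert (dist a c <= 1) by (apply dist_Hadj; eapply Hadj_trans; [apply Hadj_sym|]; eauto).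
  pose proof (dist_sym c m). lia.
Qed.

End Triangle.

Lemma clean_point v x y t :
  clean v x y -> t <= dist x y ->
  exists m, dist x m = t /\ dist m y = dist x y - t /\
    walk (adj_off v) t x m /\ walk (adj_off v) (dist x y - t) m y.
Proof.
  intros c l. unfold clean in c. replace (dist x y) with (t + (dist x y - t)) in c by lia.
  destruct (walk_split _ _ _ _ _ c) as (m & w1 & w2).
  exists m. pose proof (dist_le_off _ _ _ _ w1). pose proof (dist_le_off _ _ _ _ w2).
  pose proof (dist_tri x m y). repeat split; auto; lia.
Qed.

(** Following the side from [a] for [2 * del + 6] steps leads so far from the coset that the jump to
    another side, of length at most [2 * del + 2], avoids its edges. The jump lands on the side of
    [d], which closes a loop, or at the matching distance on the side from [y] to [y']. *)
Lemma triangle_leg v a d y y' :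
  Hadj v a -> Hadj v d -> clean v a y -> clean v d y' ->
  rdist_le v (2 * (2 * del + 6) + 2 * del + 2) a d \/
  (dist a y - (2 * del + 6) <= dist y y' /\
   forall q, dist y q = dist a y - (2 * del + 6) -> dist y q + dist q y' = dist y y' ->
     rdist_le v (4 * del + 6) a q).
Proof.
  intros ha hd ca cd. pose proof (dist_same_coset v a d ha hd) as ad.
  destruct (clean_point v a y (Nat.min (2 * del + 6) (dist a y)) ca ltac:(lia)) as (m & e1 & e2 & w1 & w2).
  pose proof (dist_tri a d y'). pose proof (dist_tri d a y'). pose proof (dist_sym a d).
  pose proof (dist_tri a y' y). pose proof (dist_sym y' y).
  destruct (Nat.le_gt_cases (2 * dist m y + dist a y') (dist a y + dist y y')) as [l | l].
  - right. split; [lia|]. intros q e3 e4.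
    assert (h : dist m q <= 2 * del).
    { apply (insize_far a y y'); try lia. }
    destruct (Nat.le_gt_cases (dist a y) (2 * del + 6)).
    + assert (z1 : dist y q = 0) by lia. assert (z2 : dist m y = 0) by lia.
      apply dist_0 in z1, z2. subst q. subst m. eexists; split; [|exact w1]. lia.
    + assert (c : clean v m q) by (apply (far_clean v a ha m q (2 * del)); lia).
      exists (dist a m + dist m q). split; [lia|]. eapply walk_app; [|exact c]. rewrite e1; auto.
  - left.
    assert (2 * del + 6 < dist a y).
    { destruct (Nat.le_gt_cases (dist a y) (2 * del + 6)); [|auto].
      pose proof (dist_tri a y y'). lia. }
    destruct (clean_point v d y' (Nat.min (dist a m) (dist d y')) cd ltac:(lia)) as (q & f1 & f2 & u1 & u2).
    assert (h : dist m q <= 2 * del + 2).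
    { apply (insize_near v a d y y' ha hd); lia. }
    assert (c : clean v m q) by (apply (far_clean v a ha m q (2 * del + 2)); lia).
    exists (dist a m + (dist m q + dist d q)). split; [lia|].
    eapply walk_app; [rewrite e1; exact w1|]. eapply walk_app; [exact c|].
    rewrite f1. apply walk_rev; auto. apply adj_off_sym.
Qed.

Lemma triangle_bound v a d y y' :
  Hadj v a -> Hadj v d -> clean v a y -> clean v y y' -> clean v d y' -> rdist_le v (polyD - 1) a d.
Proof.
  intros ha hd ca cy cd. unfold polyD.
  destruct (triangle_leg v a d y y' ha hd ca cd) as [h | [l1 h1]].
  { eapply rdist_le_mono; [|exact h]. lia. }
  destruct (triangle_leg v d a y' y hd ha cd ca) as [h | [l2 h2]].
  { apply rdist_le_sym. eapply rdist_le_mono; [|exact h]. lia. }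
  rewrite (dist_sym y' y) in *.
  set (s1 := dist a y - (2 * del + 6)) in *. set (s2 := dist d y' - (2 * del + 6)) in *.
  pose proof (dist_same_coset v a d ha hd) as ad.
  (* Both landing points are taken on the same clean geodesic from [y] to [y']; this is possible
     because [triangle_leg] speaks of every [q] at the right distances. They are at most
     [(4 * del + 6) + 1 + (4 * del + 6)] apart. *)
  assert (key : forall q1 q2 n, dist y q1 = s1 -> dist y q1 + dist q1 y' = dist y y' ->
     dist y' q2 = s2 -> dist y' q2 + dist q2 y = dist y y' -> dist q1 q2 = n ->
     walk (adj_off v) n q1 q2 -> rdist_le v (16 * del + 30 - 1) a d).
  { intros q1 q2 n e1 e2 e3 e4 e5 w.
    specialize (h1 q1 e1 e2). specialize (h2 q2 e3 e4).
    assert (k : dist q1 q2 <= 8 * del + 13).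
    { destruct h1 as (n1 & k1 & w1). destruct h2 as (n2 & k2 & w2).
      apply dist_le_off in w1, w2.
      pose proof (dist_tri q1 a q2). pose proof (dist_tri a d q2). pose proof (dist_sym q1 a). lia. }
    apply rdist_le_mono with (4 * del + 6 + (8 * del + 13 + (4 * del + 6))); [lia|].
    eapply rdist_le_trans; [exact h1|]. eapply rdist_le_trans; [|apply rdist_le_sym; exact h2].
    exists n; split; [lia | auto]. }
  destruct (Nat.le_gt_cases s1 (dist y y' - s2)) as [l | l].
  - destruct (clean_point v y y' s1 cy l1) as (q1 & e1 & e2 & w1 & w2).
    assert (c1 : clean v q1 y') by (eapply clean_intro; [exact w2 | lia]).
    destruct (clean_point v q1 y' (dist y y' - s2 - s1) c1 ltac:(lia)) as (q2 & e3 & e4 & w3 & w4).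
    pose proof (dist_tri y q1 q2). pose proof (dist_tri y q2 y').
    pose proof (dist_sym y' q2). pose proof (dist_sym q2 y).
    apply (key q1 q2 (dist y y' - s2 - s1)); auto; lia.
  - destruct (clean_point v y y' (dist y y' - s2) cy ltac:(lia)) as (q2 & e1 & e2 & w1 & w2).
    assert (c1 : clean v q2 y') by (eapply clean_intro; [exact w2 | lia]).
    destruct (clean_point v q2 y' (s1 - (dist y y' - s2)) c1 ltac:(lia)) as (q1 & e3 & e4 & w3 & w4).
    pose proof (dist_tri y q2 q1). pose proof (dist_tri y q1 y').
    pose proof (dist_sym y' q2). pose proof (dist_sym q2 y). pose proof (dist_sym q1 q2).
    apply (key q1 q2 (s1 - (dist y y' - s2))); auto; try lia.
    apply walk_rev; auto. apply adj_off_sym.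
Qed.

(** The polygon is cut into a fan: each vertex is joined to an entry point in the coset, and each
    side costs one triangle. *)
Lemma polygon_bound v n a y :
  Hadj v a -> walk (clean v) n a y ->
  exists d, Hadj v d /\ clean v d y /\ rdist_le v (n * (polyD - 1)) a d.
Proof.
  intros ha w. enough (h : forall z d0, Hadj v d0 -> clean v d0 z -> walk (clean v) n z y ->
    exists d, Hadj v d /\ clean v d y /\ rdist_le v (n * (polyD - 1)) d0 d).
  { apply (h a a); auto. apply clean_refl. }
  clear a ha w. induction n; intros z d0 h0 c0 w.
  - apply walk_0 in w; subst. exists d0; repeat split; auto. apply rdist_le_refl.
  - inversion w as [|? ? u ? c1 w']; subst.
    assert (k : exists e, Hadj v e /\ clean v e u /\ rdist_le v (polyD - 1) d0 e).
    { destruct (entry_exists v u) as (e & he & ce). apply clean_sym in ce.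
      exists e; repeat split; auto. eapply triangle_bound; eauto. }
    destruct k as (e & he & ce & de).
    destruct (IHn u e he ce w') as (d & hd & cd & dd).
    exists d; repeat split; auto. simpl. eapply rdist_le_trans; eauto.
Qed.

Lemma near_pt_walk v n x y : walk (clean v) n x y -> near_pt v x y ((n + 2) * polyD).
Proof.
  intros w p q [hp cp] [hq cq].
  assert (w' : walk (clean v) (n + 2) p q).
  { replace (n + 2) with (1 + (n + 1)) by lia.
    eapply walk_app; [apply walk_one, clean_sym; exact cp|].
    eapply walk_app; [exact w | apply walk_one; exact cq]. }
  destruct (polygon_bound v _ p q hp w') as (d & hd & cd & dd).
  assert (k := clean_in_coset v d q hd hq cd).
  apply rdist_le_mono with ((n + 2) * (polyD - 1) + 1); [unfold polyD; nia|].
  eapply rdist_le_trans; eauto.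
Qed.

Lemma near_pt_refl v x : near_pt v x x (2 * polyD).
Proof. apply (near_pt_walk v 0). constructor. Qed.

Lemma near_pt_clean v x y : clean v x y -> near_pt v x y (3 * polyD).
Proof. intro c. apply (near_pt_walk v 1). apply walk_one; auto. Qed.

(** Consider a geodesic from [t] to the coset of [w] without edges of that coset. If it misses the
    coset of [v], then [v] sees [t] and [w] together; if it crosses it, its last part shows that [w]
    sees [t] and [v] together. *)
Lemma behrstock_point v w t : ~ Hadj v w ->
  (forall y x, Hadj w y -> clean v t x -> near_pt v x y (6 * polyD)) \/
  (forall y x, Hadj v y -> clean w t x -> near_pt w x y (6 * polyD)).
Proof.
  intro vw. destruct (entry_exists w t) as [p [wp ctp]].
  destruct (geodesic_split (adj_off w) v t p (adj_off_adj w) ctp) as [g | (c & d & _ & _ & w2 & _ & h1 & h2 & _)].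
  - left. intros y x wy cx. eapply near_pt_mono; [|apply (near_pt_walk v 3)].
    { unfold polyD; lia. }
    apply walk_cons with t. { apply clean_sym; auto. }
    apply walk_cons with p. { eapply walk_mono; [|exact g]. intros ? ? [_ ?]; auto. }
    apply walk_one. apply clean_Hadj.
    + eapply Hadj_trans; [apply Hadj_sym|]; eauto.
    + intro h; apply vw. eapply Hadj_trans; [exact h | apply Hadj_sym; auto].
  - right. intros y x vy cx. eapply near_pt_mono; [|apply (near_pt_walk w 4)].
    { unfold polyD; lia. }
    apply walk_cons with t. { apply clean_sym; auto. }
    apply walk_cons with p. { auto. }
    apply walk_cons with d. { apply clean_sym. exact w2. }
    apply walk_one. apply clean_Hadj.
    + eapply Hadj_trans; [apply Hadj_sym; exact h2 | auto].
    + intro h; apply vw. eapply Hadj_trans; [exact h2 | apply Hadj_sym; auto].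
Qed.

(** * Shortening elements of the normal closure *)

Section Spinning.
Variables (N : V -> Prop) (Lam : nat).
Hypothesis Nnorm : is_normal_subgroup_of N H.
Hypothesis HLam : 25 * polyD <= Lam.
Hypothesis deep : forall n, N n -> n <> gone -> ~ rdist_le gone (Lam + 29 * polyD) gone n.

(* [n] lies in the conjugate of [N] that fixes the coset [v H]; it depends only on that coset. *)
Definition rotation (v n : V) := N (v^-1 ** n ** v).

Lemma rotation_inv v n : rotation v n -> rotation v (n^-1).
Proof.
  unfold rotation. intro h. destruct Nnorm as ((_ & _ & iN) & _). apply iN in h. gsin h. gs. auto.
Qed.

Lemma rotation_mul v n m : rotation v n -> rotation v m -> rotation v (n ** m).
Proof.
  unfold rotation. intros h k. destruct Nnorm as ((_ & mN & _) & _).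
  specialize (mN _ _ h k). gsin mN. gs. auto.
Qed.

Lemma rotation_conj g v n : rotation v n -> rotation (g ** v) (g ** n ** g^-1).
Proof. unfold rotation. gs. auto. Qed.

Lemma rotation_coset v v' n : Hadj v v' -> rotation v n -> rotation v' n.
Proof.
  unfold rotation, Hadj. intros h k. destruct Nnorm as (_ & _ & c).
  destruct Hsub as (_ & _ & iH). apply iH in h. specialize (c _ _ h k). gsin c. gs. auto.
Qed.

Lemma rotation_Hadj v n y : rotation v n -> Hadj v y -> Hadj v (n ** y).
Proof.
  unfold rotation, Hadj. intros h k. destruct Nnorm as (_ & i & _). apply i in h.
  destruct Hsub as (_ & m & _). specialize (m _ _ h k). gsin m. auto.
Qed.

Lemma rotation_ncl v n : rotation v n -> ncl V N n.
Proof.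
  intro h. replace n with (v ** (v^-1 ** n ** v) ** v^-1) by grp. apply ncl_conj; auto.
Qed.

(** Otherwise an entry point [q] of [y] and its image under [n] would be relatively close, and
    translating by the inverse of [q] would contradict [deep]. *)
Lemma spin_far v x y n r s :
  rotation v n -> n <> gone -> near_pt v x y r -> near_pt v x (n ** y) s -> Lam + 29 * polyD < r + s.
Proof.
  intros hn n1 h k. apply Nat.nle_gt. intro l.
  destruct (entry_exists v x) as [p ep]. destruct (entry_exists v y) as [q eq].
  specialize (h p q ep eq).
  assert (eq' : entry v (n ** y) (n ** q)).
  { apply (entry_mul n) in eq. eapply entry_coset; [|exact eq].
    apply Hadj_sym. apply rotation_Hadj; auto. apply Hadj_refl. }
  specialize (k p _ ep eq').
  assert (d : rdist_le v (r + s) q (n ** q)) by (eapply rdist_le_trans; [apply rdist_le_sym; exact h | exact k]).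
  apply (rdist_le_mul (q^-1)) in d. apply rdist_le_coset with (v' := gone) in d.
  - apply (deep (q^-1 ** n ** q)).
    + destruct eq as [hq _]. apply (rotation_coset _ _ _ hq hn).
    + intro e. apply n1. replace n with (q ** (q^-1 ** n ** q) ** q^-1) by grp.
      rewrite e. grp.
    + gsin d. gs. eapply rdist_le_mono; eauto.
  - destruct eq as [hq _]. apply (Hadj_mul (q^-1)) in hq. gsin hq. auto.
Qed.

Definition rotgroup (r : nat) : V -> Prop := gen_by V (fun n => exists v, rotation v n /\ dist gone v < r).
(** The cosets that meet a translate of the open ball of radius [r] under [rotgroup r]. All
    rotations about them already belong to [rotgroup r]. *)
Definition windmill (r : nat) (v : V) := exists k, rotgroup r k /\ exists p, Hadj (k ** v) p /\ dist gone p < r.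

(* The derivation provides the measure of complexity for inductions on elements of the normal closure. *)
Inductive reducible (r : nat) : V -> Prop :=
| reducible_one : reducible r gone
| reducible_spin : forall k v n, windmill r v -> rotation v n -> ~ near_pt v gone k Lam -> reducible r (n ** k) -> reducible r k.

Lemma rotgroup_zero k : rotgroup 0 k -> k = gone.
Proof.
  induction 1 as [| n (v & _ & l) | x y _ -> _ -> | x _ ->]; auto; [lia | grp | grp].
Qed.

Lemma rotgroup_rotation r v n : windmill r v -> rotation v n -> rotgroup r n.
Proof.
  intros (k & Kk & p & kp & l) hn.
  replace n with (k^-1 ** (k ** n ** k^-1) ** k) by grp.
  apply gen_mul; [apply gen_mul; [apply gen_inv; auto|]|auto].
  apply gen_elt. exists p; split; auto.
  eapply rotation_coset; [exact kp | apply rotation_conj; auto].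
Qed.

Lemma windmill_mul r k v : rotgroup r k -> windmill r v -> windmill r (k ** v).
Proof.
  intros Kk (g & Kg & p & h & l). exists (g ** k^-1); split.
  - apply gen_mul; auto. apply gen_inv; auto.
  - exists p; split; auto. gs. gsin h. auto.
Qed.

Lemma windmill_mul_inv r k v : rotgroup r k -> windmill r (k ** v) -> windmill r v.
Proof. intros Kk w. apply (windmill_mul r (k^-1)) in w; [|apply gen_inv; auto]. gsin w. auto. Qed.

Lemma windmill_coset r v v' : Hadj v v' -> windmill r v -> windmill r v'.
Proof.
  intros h (k & Kk & p & kp & l). exists k; split; auto. exists p; split; auto.
  eapply Hadj_trans; [apply Hadj_sym, Hadj_mul, h | auto].
Qed.

Lemma windmill_ball r v p : Hadj v p -> dist gone p < r -> windmill r v.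
Proof. intros h l. exists gone; split; [apply gen_one|]. exists p; rewrite gmul1l; auto. Qed.

Lemma rotgroup_mono r s k : r <= s -> rotgroup r k -> rotgroup s k.
Proof.
  intros l. induction 1; [apply gen_one | | apply gen_mul; auto | apply gen_inv; auto].
  apply gen_elt. destruct H0 as (v & h & d). exists v; split; auto; lia.
Qed.

Lemma windmill_mono r s v : r <= s -> windmill r v -> windmill s v.
Proof.
  intros l (k & Kk & p & kp & d). exists k; split; [eapply rotgroup_mono; eauto|].
  exists p; split; auto; lia.
Qed.

Lemma reducible_mono r s k : r <= s -> reducible r k -> reducible s k.
Proof.
  intros l; induction 1; [apply reducible_one|]. eapply reducible_spin; eauto. eapply windmill_mono; eauto.
Qed.

Lemma clean_ball r v x : dist gone x <= r -> ~ windmill r v -> clean v gone x.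
Proof.
  intros l w. destruct (clean_or_split v gone x) as [c | (c & d & h1 & _ & e & _)]; auto.
  exfalso; apply w. apply (windmill_ball r v c); auto. lia.
Qed.

(* The ball of radius [r], thickened by H-edges; unlike the ball, it contains every coset that meets it. *)
Definition thick_ball (r : nat) (x : V) := exists x0, dist gone x0 < r /\ Hadj x x0.

(** Since [u] sees [x] far from 1, a geodesic from 1 to the ball point [x0] uses an edge of the
    coset of [u]. The rotation moves the end of this edge within the coset, where points are at
    distance at most 1, so the distance from 1 does not grow. *)
Lemma thick_ball_spin r u n x :
  thick_ball r x -> rotation u n -> ~ near_pt u gone x (10 * polyD) -> thick_ball r (n ** x).
Proof.
  intros (x0 & l & h) hn far.
  destruct (classic (Hadj u x)) as [ux | ux].
  - exists x0; split; auto. eapply Hadj_trans; [|exact h].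
    eapply Hadj_trans; [apply Hadj_sym, rotation_Hadj; eauto | auto].
  - exists (n ** x0); split; [|apply Hadj_mul; auto].
    destruct (clean_or_split u gone x0) as [c | (c & d & h1 & h2 & e & _)].
    + exfalso; apply far. apply near_pt_mono with (3 * polyD + 3 * polyD); [lia|].
      eapply near_pt_trans; [apply near_pt_clean; exact c|].
      apply near_pt_sym, near_pt_clean, clean_Hadj; auto.
    + assert (dist c (n ** d) <= 1).
      { apply dist_Hadj. eapply Hadj_trans; [apply Hadj_sym; exact h1|]. apply rotation_Hadj; auto. }
      pose proof (dist_tri gone c (n ** x0)). pose proof (dist_tri c (n ** d) (n ** x0)).
      rewrite dist_mul in *. lia.
Qed.

(* If [u] is the coset that reduces [k], then [u] must be passed on the way from [1] to [x] or to
   [y]; rotating that end about [u] keeps it in the thick ball. *)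
Lemma reducible_shallow r k : reducible r k -> forall x y v, thick_ball r x -> thick_ball r y -> ~ windmill r v ->
  (forall w, windmill r w -> near_pt w x (k ** y) (5 * polyD)) -> near_pt v x (k ** y) (6 * polyD).
Proof.
  induction 1 as [| k u n Wu hn far _ IH]; intros x y v (x0 & lx & hx) (y0 & ly & hy) nw near.
  - rewrite gmul1l. apply (near_pt_walk v 4).
    assert (TBW : forall z z0, dist gone z0 < r -> Hadj z z0 -> ~ Hadj v z).
    { intros z z0 l h vz. apply nw, (windmill_ball r v z0); auto. eapply Hadj_trans; eauto. }
    apply walk_cons with x0. { apply clean_Hadj; eauto. }
    apply walk_cons with gone. { apply clean_sym, (clean_ball r); auto; lia. }
    apply walk_cons with y0. { apply (clean_ball r); auto; lia. }
    apply walk_one, clean_sym, clean_Hadj; eauto.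
  - destruct (classic (near_pt u gone x (10 * polyD))) as [nx | fx].
    + destruct (classic (near_pt u k (k ** y) (10 * polyD))) as [ny | fy].
      * exfalso; apply far. apply near_pt_mono with (10 * polyD + 5 * polyD + 10 * polyD); [lia|].
        eapply near_pt_trans; [eapply near_pt_trans; [exact nx | apply near; auto]|].
        apply near_pt_sym; auto.
      * set (m := k^-1 ** n^-1 ** k).
        assert (e : k ** y = n ** k ** (m ** y)) by (unfold m; grp).
        rewrite e. apply IH; auto.
        -- exists x0; auto.
        -- apply thick_ball_spin with (u := k^-1 ** u).
           ++ exists y0; auto.
           ++ unfold m. replace (k^-1 ** n^-1 ** k) with (k^-1 ** n^-1 ** k^-1^-1) by grp.
              apply rotation_conj, rotation_inv; auto.
           ++ intro h; apply fy. apply (near_pt_mul k) in h. gsin h. auto.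
        -- rewrite <- e; auto.
    + apply (near_pt_mul_inv n). rewrite gmulA. apply IH.
      * apply thick_ball_spin with (u := u); auto. exists x0; auto.
      * exists y0; auto.
      * intro w; apply nw. apply (windmill_mul_inv r n); auto. apply (rotgroup_rotation r u); auto.
      * intros w Ww. rewrite <- gmulA.
        replace w with (n ** (n^-1 ** w)) by grp. apply near_pt_mul, near.
        apply (windmill_mul_inv r n); [apply (rotgroup_rotation r u); auto|]. gs; auto.
Qed.

Lemma windmill_hull r w d : windmill r w -> Hadj w d -> exists k, rotgroup r k /\ thick_ball r (k ** d).
Proof.
  intros (k & Kk & p & kp & l) h. exists k; split; auto. exists p; split; auto.
  eapply Hadj_trans; [apply Hadj_mul, Hadj_sym; exact h | auto].
Qed.

(* Cutting the geodesic at the cosets of the windmill that it crosses before and after [v] loses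
   no constant, because the crossing edge of [v] stays the same. *)
Lemma crossing_shallow r : (forall k, rotgroup r k -> reducible r k) ->
  forall m x y v p q, dist x y <= m -> (exists k, rotgroup r k /\ thick_ball r (k ** x)) ->
  (exists k, rotgroup r k /\ thick_ball r (k ** y)) ->
  ~ windmill r v -> Hadj v p -> Hadj v q -> dist x y = dist x p + 1 + dist q y ->
  rdist_le v (6 * polyD) p q.
Proof.
  intro allred. induction m as [|m IH]; intros x y v p q l hx hy nw vp vq e; [lia|].
  destruct (classic (exists w, windmill r w /\ ~ clean w x p)) as [(w & Ww & nc) | cx].
  { destruct (clean_or_split w x p) as [? | (c & d & wc & wd & e' & _)]; [tauto|].
    assert (e2 : dist d y = dist d p + 1 + dist q y).
    { pose proof (dist_tri x c y). pose proof (dist_tri c d y). pose proof (dist_tri d p y).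
      pose proof (dist_tri p q y).
      assert (dist c d <= 1) by (apply dist_Hadj; eapply Hadj_trans; [apply Hadj_sym|]; eauto).
      assert (dist p q <= 1) by (apply dist_Hadj; eapply Hadj_trans; [apply Hadj_sym|]; eauto).
      lia. }
    apply (IH d y v p q); auto; [lia|]. apply (windmill_hull r w); auto. }
  destruct (classic (exists w, windmill r w /\ ~ clean w q y)) as [(w & Ww & nc) | cy].
  { destruct (clean_or_split w q y) as [? | (c & d & wc & wd & e' & _)]; [tauto|].
    assert (e2 : dist x c = dist x p + 1 + dist q c).
    { pose proof (dist_tri x c y). pose proof (dist_tri c d y). pose proof (dist_tri x p c).
      pose proof (dist_tri p q c).
      assert (dist c d <= 1) by (apply dist_Hadj; eapply Hadj_trans; [apply Hadj_sym|]; eauto).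
      assert (dist p q <= 1) by (apply dist_Hadj; eapply Hadj_trans; [apply Hadj_sym|]; eauto).
      lia. }
    apply (IH x c v p q); auto; [lia|]. apply (windmill_hull r w); auto. }
  assert (near : forall w, windmill r w -> near_pt w x y (5 * polyD)).
  { intros w Ww. apply (near_pt_walk w 3).
    apply walk_cons with p. { apply NNPP; intro; apply cx; eauto. }
    apply walk_cons with q.
    { apply clean_Hadj. eapply Hadj_trans; [apply Hadj_sym|]; eauto.
      intro h; apply nw. apply (windmill_coset r w); auto.
      eapply Hadj_trans; [exact h | apply Hadj_sym; auto]. }
    apply walk_one. apply NNPP; intro; apply cy; eauto. }
  assert (n : near_pt v x y (6 * polyD)).
  { destruct hx as (k1 & K1 & T1). destruct hy as (k2 & K2 & T2).
    apply (near_pt_mul_inv k1). replace (k1 ** y) with ((k1 ** k2^-1) ** (k2 ** y)) by grp.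
    apply (reducible_shallow r); auto.
    - apply allred. apply gen_mul; auto. apply gen_inv; auto.
    - intro w; apply nw, (windmill_mul_inv r k1); auto.
    - intros w Ww. apply (near_pt_mul_inv (k1^-1)). gs. apply near.
      apply windmill_mul; auto. apply gen_inv; auto. }
  apply n; split; auto.
  - eapply clean_on_geodesic; [auto | exact vq | exact e].
  - apply (clean_on_geodesic v y x q p); auto.
    rewrite (dist_sym y x), (dist_sym y q), (dist_sym p x). lia.
Qed.

(** If a geodesic from 1 to [k] crosses the coset, [crossing_shallow] bounds the crossing by
    [6 * polyD], and comparing its ends with other entry points costs [2 * polyD] on each side.
    Radius 0 is separate because not even 1 lies in the thick ball then. *)
Lemma orbit_shallow r : (forall k, rotgroup r k -> reducible r k) ->
  forall v k, ~ windmill r v -> rotgroup r k -> near_pt v gone k (10 * polyD).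
Proof.
  intros allred v k nw Kk. destruct r as [|r].
  - rewrite (rotgroup_zero k Kk). eapply near_pt_mono; [|apply near_pt_refl]. lia.
  - destruct (clean_or_split v gone k) as [c | (p & q & vp & vq & e & c1 & c2)].
    { eapply near_pt_mono; [|apply near_pt_clean; auto]. lia. }
    assert (d : rdist_le v (6 * polyD) p q).
    { assert (T1 : thick_ball (S r) gone).
      { exists gone; split; [rewrite dist_xx; lia | apply Hadj_refl]. }
      apply (crossing_shallow (S r) allred (dist gone k) gone k); auto.
      - exists gone; split; [apply gen_one | rewrite gmul1l; auto].
      - exists (k^-1); split; [apply gen_inv; auto | rewrite gmulVl; auto]. }
    intros p' q' e1 e2. apply rdist_le_mono with (2 * polyD + (6 * polyD + 2 * polyD)); [lia|].
    eapply rdist_le_trans; [apply (near_pt_refl v gone)|eapply rdist_le_trans; [exact d | apply (near_pt_refl v k)]]; auto.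
    + split; auto.
    + split; auto. apply clean_sym; auto.
Qed.

(** * Normal forms over the group of smaller radius *)

Section Step.
Variable r : nat.
Hypothesis allred : forall k, rotgroup r k -> reducible r k.

Definition frontier (v : V) := dist gone v = r /\ ~ windmill r v.

(* Words [n1 a1 n2 a2 ...] with rotations [ni] about cosets [vi] on the sphere and [ai] in the previous
   group, in which no two consecutive rotations have the same center. *)
Inductive reduced_word : V -> V -> Prop :=
| reduced_word_last : forall v n a, frontier v -> rotation v n -> n <> gone -> rotgroup r a -> reduced_word v (n ** a)
| reduced_word_next : forall v n a v' t, frontier v -> rotation v n -> n <> gone -> rotgroup r a -> reduced_word v' t ->
    ~ Hadj v (a ** v') -> reduced_word v (n ** (a ** t)).

(** The first syllable displaces what follows, provided [v] sees [a ** t] near 1. By Behrstock's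
    inequality for [v0] and [v'], a failure would make [v'] see [t] near [v0], hence near 1, against
    the induction hypothesis. The bound [19 * polyD] is 10 for the orbit, 3 for a clean geodesic and
    6 for Behrstock; together with [Lam + 10 * polyD] it gives the 29 in [deep]. *)
Lemma reduced_word_far v t : reduced_word v t -> ~ near_pt v gone t (Lam + 10 * polyD).
Proof.
  induction 1 as [v n a sv hn n1 Ka | v n a v' t sv hn n1 Ka w IH nv]; intro near.
  - assert (h := orbit_shallow r allred v a (proj2 sv) Ka).
    pose proof (spin_far v gone a n _ _ hn n1 h near). unfold polyD in *; lia.
  - destruct sv as [dv Wv].
    assert (sv' : frontier v') by (destruct w; auto). destruct sv' as [dv' Wv'].
    set (v0 := a^-1 ** v).
    assert (Ki : rotgroup r (a^-1)) by (apply gen_inv; auto).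
    assert (W0 : ~ windmill r v0).
    { intro h; apply Wv. apply (windmill_mul_inv r (a^-1)); auto. }
    assert (n0 : near_pt v0 (a^-1) gone (10 * polyD)) by (apply near_pt_sym, (orbit_shallow r); auto).
    assert (n1' : near_pt v0 gone v' (3 * polyD)).
    { apply near_pt_clean. apply (clean_ball r); auto. lia. }
    assert (v0v' : ~ Hadj v0 v').
    { intro h; apply nv. apply (Hadj_mul a) in h. unfold v0 in h. gsin h. auto. }
    destruct (behrstock_point v0 v' t v0v') as [b | b].
    + specialize (b v' t (Hadj_refl _) (clean_refl _ _)).
      assert (h : near_pt v gone (a ** t) (19 * polyD)).
      { apply (near_pt_mul_inv (a^-1)). gs. change (a^-1 ** v) with v0.
        apply near_pt_mono with (10 * polyD + 3 * polyD + 6 * polyD); [lia|].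
        eapply near_pt_trans; [eapply near_pt_trans; eauto|]. apply near_pt_sym; auto. }
      pose proof (spin_far v gone (a ** t) n _ _ hn n1 h near). unfold polyD in *; lia.
    + specialize (b v0 t (Hadj_refl _) (clean_refl _ _)).
      apply IH. apply near_pt_mono with (10 * polyD + 3 * polyD + 6 * polyD); [lia|].
      eapply near_pt_trans; [eapply near_pt_trans|].
      * apply (orbit_shallow r allred v' (a^-1)); auto.
      * apply near_pt_clean with (y := v0). unfold v0.
        assert (c : clean (a ** v') gone v).
        { apply (clean_ball r); [lia|]. intro h; apply Wv', (windmill_mul_inv r a); auto. }
        apply (clean_mul (a^-1)) in c. gsin c. auto.
      * apply near_pt_sym; auto.
Qed.

Definition normal_form (k : V) := exists a, rotgroup r a /\ (k = a \/ exists v t, reduced_word v t /\ k = a ** t).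

(** As in a free product: a rotation about a frontier coset becomes a new first syllable, or merges
    with the old one when the centers agree. A merged syllable that is trivial is dropped, and its
    factor from the smaller group joins the prefix. *)
Lemma normal_form_gen v n x : rotation v n -> dist gone v < S r -> normal_form x -> normal_form (n ** x).
Proof.
  intros hn dv (a & Ka & hx).
  destruct (classic (windmill r v)) as [Wv | Wv].
  { exists (n ** a); split; [apply gen_mul; auto; eapply rotgroup_rotation; eauto|].
    destruct hx as [-> | (v' & t & w & ->)]; [left; auto | right; exists v', t; split; auto; grp]. }
  assert (sv : frontier v).
  { split; auto. destruct (Nat.lt_ge_cases (dist gone v) r); [|lia].
    exfalso; apply Wv, (windmill_ball r v v); auto. apply Hadj_refl. }
  destruct (classic (n = gone)) as [-> | n1].
  { exists a; split; auto. rewrite gmul1l; auto. }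
  destruct hx as [-> | (v' & t & w & ->)].
  { exists gone; split; [apply gen_one|]. right. exists v, (n ** a); split; [apply reduced_word_last; auto | grp]. }
  destruct (classic (Hadj v (a ** v'))) as [vv | vv].
  2:{ exists gone; split; [apply gen_one|]. right. exists v, (n ** (a ** t)); split; [|grp].
      eapply reduced_word_next; eauto. }
  inversion w as [? m b sv' hm m1 Kb | ? m b v2 t2 sv' hm m1 Kb w2 nv]; subst.
  - set (m' := n ** (a ** m ** a^-1)).
    assert (hm' : rotation v m').
    { apply rotation_mul; auto. apply rotation_coset with (a ** v'); [apply Hadj_sym; auto | apply rotation_conj; auto]. }
    assert (Kab : rotgroup r (a ** b)) by (apply gen_mul; auto).
    destruct (classic (m' = gone)) as [e | m1'].
    + exists (a ** b); split; auto. left.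
      replace (n ** (a ** (m ** b))) with (m' ** (a ** b)) by (unfold m'; grp). rewrite e; grp.
    + exists gone; split; [apply gen_one|]. right. exists v, (m' ** (a ** b)); split.
      * apply reduced_word_last; auto.
      * unfold m'; grp.
  - set (m' := n ** (a ** m ** a^-1)).
    assert (hm' : rotation v m').
    { apply rotation_mul; auto. apply rotation_coset with (a ** v'); [apply Hadj_sym; auto | apply rotation_conj; auto]. }
    assert (Kab : rotgroup r (a ** b)) by (apply gen_mul; auto).
    destruct (classic (m' = gone)) as [e | m1'].
    + exists (a ** b); split; auto. right. exists v2, t2; split; auto.
      replace (n ** (a ** (m ** (b ** t2)))) with (m' ** (a ** (b ** t2))) by (unfold m'; grp).
      rewrite e; grp.
    + exists gone; split; [apply gen_one|]. right. exists v, (m' ** (a ** b ** t2)); split.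
      * eapply reduced_word_next; eauto. intro h; apply nv.
        apply (Hadj_mul_inv a). eapply Hadj_trans; [apply Hadj_sym; exact vv|].
        gsin h. auto.
      * unfold m'; grp.
Qed.

Lemma normal_form_all k : rotgroup (S r) k -> normal_form k.
Proof.
  intro Kk. enough (h : forall x, normal_form x -> normal_form (k ** x) /\ normal_form (k^-1 ** x)).
  { replace k with (k ** gone) by grp. apply h. exists gone; split; [apply gen_one | auto]. }
  induction Kk as [| n hn | x y _ IHx _ IHy | x _ IHx]; intros z hz.
  - gs; auto.
  - destruct hn as (v & hn & l). split; eapply normal_form_gen; eauto. apply rotation_inv; auto.
  - gs. split; [apply IHx, IHy | apply IHy, IHx]; auto.
  - gs. destruct (IHx z hz); auto.
Qed.

(** Undoing the first syllable is the reducing rotation. Its center sees 1 and the word more than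
    [Lam + 10 * polyD] apart, and the prefix [b] uses up only the [10 * polyD]. *)
Lemma reduced_word_reducible v t : reduced_word v t -> forall a, rotgroup r a -> reducible (S r) (a ** t).
Proof.
  assert (key : forall v n b t, reduced_word v (n ** t) -> rotation v n -> rotgroup r b ->
    reducible (S r) (b ** t) -> reducible (S r) (b ** (n ** t))).
  { intros v0 n b t0 w hn Kb h.
    assert (sv : frontier v0) by (destruct w; auto). destruct sv as [dv Wv].
    apply reducible_spin with (v := b ** v0) (n := b ** n^-1 ** b^-1).
    - exists (b^-1); split; [apply (rotgroup_mono r); [lia | apply gen_inv; auto]|].
      exists v0; split; [gs; apply Hadj_refl | lia].
    - apply rotation_conj, rotation_inv; auto.
    - intro near. apply (reduced_word_far _ _ w).
      apply (near_pt_mul (b^-1)) in near. gsin near.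
      apply near_pt_mono with (10 * polyD + Lam); [lia|].
      eapply near_pt_trans; [|exact near]. apply (orbit_shallow r); auto. apply gen_inv; auto.
    - replace (b ** n^-1 ** b^-1 ** (b ** (n ** t0))) with (b ** t0) by grp. auto. }
  induction 1 as [v n a sv hn n1 Ka | v n a v' t sv hn n1 Ka w IH nv]; intros b Kb.
  - apply key with (v := v); auto. apply reduced_word_last; auto.
    apply (reducible_mono r); [lia|]. apply allred, gen_mul; auto.
  - apply key with (v := v); auto. eapply reduced_word_next; eauto.
    rewrite gmulA. apply IH, gen_mul; auto.
Qed.

Lemma reducible_step k : rotgroup (S r) k -> reducible (S r) k.
Proof.
  intro Kk. destruct (normal_form_all k Kk) as (a & Ka & [-> | (v & t & w & ->)]).
  - apply (reducible_mono r); [lia | auto].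
  - eapply reduced_word_reducible; eauto.
Qed.

End Step.

Lemma rotgroup_reducible r k : rotgroup r k -> reducible r k.
Proof.
  revert k; induction r; intros k Kk.
  - rewrite (rotgroup_zero k Kk). apply reducible_one.
  - apply reducible_step; auto.
Qed.

Lemma ncl_reducible k : ncl V N k -> exists r, reducible r k.
Proof.
  intro h. enough (e : exists r, rotgroup r k) by (destruct e as [r Kk]; exists r; apply rotgroup_reducible; auto).
  induction h as [| n g hn | x y _ [r Kx] _ [s Ky] | x _ [r Kx]].
  - exists 0; apply gen_one.
  - exists (S (dist gone g)). apply gen_elt. exists g; split; [|lia]. unfold rotation. gs; auto.
  - exists (Nat.max r s). apply gen_mul; eapply rotgroup_mono; try eassumption; lia.
  - exists r; apply gen_inv; auto.
Qed.

(* A relation that every [v] either does not see or that survives moving its end by the rotations about [v]. *)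
Definition good (c : nat) (R : V -> V -> Prop) :=
  (forall x y k, ncl V N k -> R x y -> R (k ** x) (k ** y)) /\
  (forall x y v, R x y -> near_pt v x y c \/ forall n, rotation v n -> R x (n ** y)).

(** * Chains of good relations *)

Inductive chain : list (V -> V -> Prop) -> V -> V -> Prop :=
| chain_nil : forall x, chain nil x x
| chain_cons : forall R l x y z, R x y -> chain l y z -> chain (R :: l) x z.

Lemma chain_one R x y : R x y -> chain [R] x y.
Proof. intro h. eapply chain_cons; [exact h | constructor]. Qed.

Lemma chain_cons_inv R l x z : chain (R :: l) x z -> exists y, R x y /\ chain l y z.
Proof. intro h. inversion h; subst. eauto. Qed.

Lemma chain_nil_inv x y : chain nil x y -> x = y.
Proof. intro h. inversion h; auto. Qed.

Lemma chain_one_inv R x y : chain [R] x y -> R x y.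
Proof. intro h. apply chain_cons_inv in h as (z & r & h). apply chain_nil_inv in h; subst; auto. Qed.

Lemma chain_app l l' x y z : chain l x y -> chain l' y z -> chain (l ++ l') x z.
Proof. induction 1; simpl; auto. intro c. eapply chain_cons; eauto. Qed.

Lemma chain_app_inv l l' x z : chain (l ++ l') x z -> exists y, chain l x y /\ chain l' y z.
Proof.
  revert x; induction l as [|R l IH]; simpl; intros x c.
  - exists x; split; [constructor | auto].
  - apply chain_cons_inv in c as (u & r & c'). destruct (IH u c') as (y & c1 & c2).
    exists y; split; auto. eapply chain_cons; eauto.
Qed.

Lemma chain_mul c l x y k : Forall (good c) l -> ncl V N k -> chain l x y -> chain l (k ** x) (k ** y).
Proof.
  intros g hk ch. induction ch; [constructor|]. inversion g as [|? ? [inv _] gl]; subst.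
  apply chain_cons with (k ** y); auto.
Qed.

(** Either no link is visible from [v], and the allowances add up, or the whole tail can be rotated
    from the first visible link on. *)
Lemma chain_spin c l v x y : Forall (good c) l -> chain l x y ->
  near_pt v x y (length l * c + 2 * polyD) \/ forall n, rotation v n -> chain l x (n ** y).
Proof.
  intros g ch. induction ch as [x | R l x y z r ch IH].
  - left. apply near_pt_refl.
  - inversion g as [|? ? gR gl]; subst. destruct gR as [inv spin].
    destruct (spin x y v r) as [n | s].
    + destruct (IH gl) as [n' | s'].
      * left. apply near_pt_mono with (c + (length l * c + 2 * polyD)); [simpl; lia|].
        eapply near_pt_trans; eauto.
      * right. intros n0 h. apply chain_cons with y; auto.
    + right. intros n h. apply chain_cons with (n ** y); auto.
      eapply chain_mul; eauto. eapply rotation_ncl; eauto.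
Qed.

(** The induction follows the derivation that reduces the displacement [k]. The coset that reduces
    [k] sees the ends too far apart for all links to be invisible, so the tail can be rotated about
    it; this replaces [k] by the simpler [n ** k] and keeps the chain a chain for the same
    relations. *)
Lemma chain_close c l x y : Forall (good c) l -> length l * c + 2 * polyD <= Lam ->
  chain l x y -> ncl V N (x^-1 ** y) -> chain l x x.
Proof.
  intros g len ch hk. destruct (ncl_reducible _ hk) as [r rk].
  remember (x^-1 ** y) as k eqn:ek. revert y ek ch hk.
  induction rk as [| k v n _ hn far _ IH]; intros y ek ch hk.
  - replace y with x in ch; auto. replace y with (x ** (x^-1 ** y)) by grp. rewrite <- ek. grp.
  - destruct (chain_spin c l (x ** v) x y g ch) as [near | s].
    + exfalso; apply far. apply (near_pt_mul (x^-1)) in near. gsin near.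
      rewrite <- ek in near. eapply near_pt_mono; eauto.
    + apply (IH (x ** n ** x^-1 ** y)).
      * rewrite ek. grp.
      * apply s, rotation_conj; auto.
      * apply ncl_mul; auto. eapply rotation_ncl; eauto.
Qed.

(** One relation per factor: a short factor is prescribed exactly, a letter of [H] only up to right
    multiplication by [N], which is the freedom that rotations about its coset require. The last
    clause measures the total ambiguity. *)
Lemma coset_word_chain c m s g : 3 * polyD <= c -> coset_word H (fun t => forall v, near_pt v gone t c) m s g ->
  exists l, length l = s /\ Forall (good c) l /\ (forall x, chain l x (x ** g)) /\
    forall x y, chain l x y -> conj_prod N m (x^-1 ** y ** g^-1).
Proof.
  intros lc. induction 1 as [t ht | h hh | m s g m' s' g' _ (l & e & gl & ch & un) _ (l' & e' & gl' & ch' & un')].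
  - exists [fun x y => x^-1 ** y = t]. repeat split.
    + constructor; [|constructor]. split.
      * intros x y k _ <-. grp.
      * intros x y v <-. left. apply (near_pt_mul_inv (x^-1)). rewrite gmulVl. auto.
    + intro x. apply chain_one. grp.
    + intros x y w. apply chain_one_inv in w. rewrite <- w. gs. apply conj_prod_zero.
  - exists [fun x y => exists n, N n /\ x^-1 ** y = h ** n]. repeat split.
    + constructor; [|constructor]. split.
      * intros x y k _ (n & hn & e). exists n; split; auto. rewrite <- e. grp.
      * intros x y v (n & hn & e).
        assert (xy : Hadj x y).
        { unfold Hadj. rewrite e. destruct Hsub as (_ & mH & _). apply mH; auto.
          destruct Nnorm as (_ & i & _); auto. }
        destruct (classic (Hadj v x)) as [vx | vx].
        -- right. intros k hk. destruct Nnorm as ((_ & mN & _) & _ & cN).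
           assert (hx : N (x^-1 ** k ** x)) by exact (rotation_coset _ _ _ vx hk).
           assert (hi : H (h^-1)) by (apply Hsub; auto).
           exists (h^-1 ** (x^-1 ** k ** x) ** h^-1^-1 ** n). split; auto.
           replace (x^-1 ** (k ** y)) with (x^-1 ** k ** x ** (x^-1 ** y)) by grp.
           rewrite e. grp.
        -- left. apply near_pt_mono with (3 * polyD); auto. apply near_pt_clean, clean_Hadj; auto.
    + intro x. apply chain_one. exists gone; split; [apply Nnorm | grp].
    + intros x y w. apply chain_one_inv in w. destruct w as (n & hn & e).
      rewrite e. apply conj_prod_one; auto.
  - exists (l ++ l'). repeat split.
    + rewrite length_app; lia.
    + apply Forall_app; auto.
    + intro x. apply chain_app with (x ** g); auto. rewrite gmulA. auto.
    + intros x y w. destruct (chain_app_inv _ _ _ _ w) as (z & w1 & w2).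
      replace (x^-1 ** y ** (g ** g')^-1)
        with ((x^-1 ** z ** g^-1) ** (g ** (z^-1 ** y ** g'^-1) ** g^-1)) by grp.
      apply conj_prod_mul; auto. apply conj_prod_conj; auto.
Qed.

(** The chain from 1 to [g] can be closed up at 1. Comparing its new end 1 with the old end [g]
    exhibits the inverse of [g] as the accumulated ambiguity of the letters of [H]. *)
Lemma coset_word_conj_prod c m s g : 3 * polyD <= c -> s * c + 2 * polyD <= Lam ->
  coset_word H (fun t => forall v, near_pt v gone t c) m s g -> ncl V N g -> conj_prod N m g.
Proof.
  intros lc ls w hg. destruct (coset_word_chain c m s g lc w) as (l & <- & gl & ch & un).
  assert (k : chain l gone gone).
  { apply chain_close with c g; auto.
    - specialize (ch gone). rewrite gmul1l in ch. auto.
    - gs. auto. }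
  rewrite <- (ginv_inv V g). apply conj_prod_inv; [apply Nnorm|]. apply un in k. gsin k. auto.
Qed.

End Spinning.
(** * Exact projections and paths of cosets *)

Section Projections.

(** The constant of [behrstock_point]. *)
Definition theta := 6 * polyD.

Definition near (v a b : V) (r : nat) := forall x y, Hadj a x -> Hadj b y -> near_pt v x y r.

Lemma near_sym v a b r : near v a b r -> near v b a r.
Proof. intros h x y ax bY. apply near_pt_sym; auto. Qed.

Lemma near_mono v a b r s : r <= s -> near v a b r -> near v a b s.
Proof. intros l h x y ax bY. eapply near_pt_mono; eauto. Qed.

Lemma near_trans v a b c r s : near v a b r -> near v b c s -> near v a c (r + s).
Proof. intros h k x y ax cY. apply near_pt_trans with b; [apply h | apply k]; auto; apply Hadj_refl. Qed.

Lemma near_coset v v' a a' b b' r :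
  Hadj v v' -> Hadj a a' -> Hadj b b' -> near v a b r -> near v' a' b' r.
Proof.
  intros hv ha hb h x y ax bY. apply near_pt_coset with v; auto.
  apply h; eapply Hadj_trans; eauto.
Qed.

Lemma near_mul g v a b r : near v a b r -> near (g ** v) (g ** a) (g ** b) r.
Proof.
  intros h x y ax bY. apply (Hadj_mul (g^-1)) in ax, bY. gsin ax. gsin bY.
  apply (near_pt_mul_inv (g^-1)). gs. auto.
Qed.

Lemma near_same v a b : ~ Hadj v a -> Hadj a b -> near v a b theta.
Proof.
  intros va ab x y ax bY. unfold theta. apply near_pt_mono with (3 * polyD); [lia|].
  apply near_pt_clean, clean_Hadj.
  - eapply Hadj_trans; [apply Hadj_sym; exact ax|]. eapply Hadj_trans; [exact ab | exact bY].
  - intro h; apply va. eapply Hadj_trans; [exact h | apply Hadj_sym; auto].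
Qed.

Lemma near_of_clean v a b p q :
  ~ Hadj v a -> ~ Hadj v b -> Hadj a p -> Hadj b q -> clean v p q -> near v a b theta.
Proof.
  intros va vb ap bq c x y ax bY. unfold theta. apply near_pt_mono with (5 * polyD); [lia|].
  apply (near_pt_walk v 3).
  apply walk_cons with p.
  { apply clean_Hadj.
    - eapply Hadj_trans; [apply Hadj_sym; exact ax | auto].
    - intro h; apply va. eapply Hadj_trans; [exact h | apply Hadj_sym; auto]. }
  apply walk_cons with q; auto. apply walk_one.
  apply clean_Hadj.
  - eapply Hadj_trans; [apply Hadj_sym; exact bq | auto].
  - intro h; apply vb. eapply Hadj_trans; [exact h | apply Hadj_sym; auto].
Qed.

Lemma behrstock v a b : ~ Hadj v a -> ~ Hadj v b -> ~ Hadj b a ->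
  near v a b theta \/ near b a v theta.
Proof.
  intros va vb ba. destruct (behrstock_point v b a vb) as [h | h]; [left | right];
    intros x y ax bY; apply h; auto; apply clean_Hadj; auto.
Qed.

Lemma coset_dist_ex (x z : V) : exists n, exists p q, Hadj x p /\ Hadj z q /\ dist p q = n.
Proof. exists (dist x z), x, z. repeat split; apply Hadj_refl. Qed.

Definition coset_dist (x z : V) : nat :=
  epsilon (inhabits 0) (fun n => (exists p q, Hadj x p /\ Hadj z q /\ dist p q = n) /\
    forall m, (exists p q, Hadj x p /\ Hadj z q /\ dist p q = m) -> n <= m).

Lemma coset_dist_spec x z : (exists p q, Hadj x p /\ Hadj z q /\ dist p q = coset_dist x z) /\
    forall m, (exists p q, Hadj x p /\ Hadj z q /\ dist p q = m) -> coset_dist x z <= m.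
Proof. unfold coset_dist. apply epsilon_spec. apply least_nat, coset_dist_ex. Qed.

Lemma coset_dist_le x z p q : Hadj x p -> Hadj z q -> coset_dist x z <= dist p q.
Proof. intros h k. apply coset_dist_spec. eauto. Qed.

Lemma coset_dist_coset x z z' : Hadj z z' -> coset_dist x z = coset_dist x z'.
Proof.
  assert (k : forall z z', Hadj z z' -> coset_dist x z' <= coset_dist x z).
  { intros u u' h. destruct (coset_dist_spec x u) as [(p & q & h1 & h2 & <-) _].
    apply coset_dist_le; auto. eapply Hadj_trans; [apply Hadj_sym; exact h | auto]. }
  intro h. apply Nat.le_antisymm; apply k; auto. apply Hadj_sym; auto.
Qed.

(** A geodesic realising the distance of the two cosets has to use an edge of the coset of [v], so
    it meets [v] earlier. *)
Lemma coset_dist_lt v x z : ~ Hadj v x -> ~ Hadj v z -> ~ near v x z theta -> coset_dist x v < coset_dist x z.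
Proof.
  intros vx vz h. destruct (coset_dist_spec x z) as [(p & q & h1 & h2 & e) _].
  destruct (clean_or_split v p q) as [c | (c & d & vc & _ & e' & _)].
  - exfalso; apply h. eapply near_of_clean; eauto.
  - pose proof (coset_dist_le x v p c h1 vc). lia.
Qed.

(** * Cosets that look alike from a given coset *)

Definition separates (x y z : V) :=
  ~ Hadj x y /\ ~ Hadj x z /\ ~ Hadj y z /\ ~ near y x z (5 * theta).
Definition comparable (x y z : V) :=
  ~ Hadj x y /\ ~ Hadj x z /\ (Hadj y z \/ separates x y z \/ separates x z y).
(* The cosets [y] and [z] look the same from [x]: they are joined by a chain in which of any two
   consecutive cosets one strictly separates the other from [x]. *)
Definition same_side (x y z : V) := ~ Hadj x y /\ exists n, walk (comparable x) n y z.

Lemma nHadj_sym x y : ~ Hadj x y -> ~ Hadj y x.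
Proof. intros h k; apply h, Hadj_sym; auto. Qed.

Lemma comparable_sym x y z : comparable x y z -> comparable x z y.
Proof. intros (h1 & h2 & [h|h]); repeat split; auto; try tauto. left; apply Hadj_sym; auto. Qed.

(** Along a chain that never comes closer to [x] than [m], the coset [m] keeps separating. A closest
    coset [m'] of the remaining chain sees [x] and [m] together but [u1] and [u] apart from them; by
    Behrstock's inequality [m] sees [u1], [m'] and [u] together. The first step has [5 * theta] by
    the definition of [separates], of which [2 * theta] are lost. *)
Lemma chain_min_separates j : forall x m u, ~ Hadj x m ->
  walk (above (coset_dist x) (comparable x) (coset_dist x m)) j m u -> Hadj m u \/ ~ near m x u (3 * theta).
Proof.
  induction j as [j IH] using (well_founded_induction lt_wf). intros x m u xm w.
  inversion w as [|j' ? u1 ? ((_ & xu1 & c) & l1 & l2) w']; subst; [left; apply Hadj_refl|].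
  destruct (classic (Hadj m u1)) as [mu1 | mu1].
  { rewrite (coset_dist_coset x m u1) in w' by auto.
    destruct (IH j' ltac:(lia) x u1 u xu1 w') as [h | h].
    - left; eapply Hadj_trans; eauto.
    - right; intro k; apply h. apply near_coset with (v := m) (a := x) (b := u); auto using Hadj_refl. }
  assert (far : ~ near m x u1 (5 * theta)).
  { destruct c as [c | [c | c]]; [tauto | apply c|].
    destruct c as (h1 & h2 & h3 & h4). exfalso.
    assert (coset_dist x u1 < coset_dist x m); [|lia].
    apply coset_dist_lt; auto using nHadj_sym. intro k; apply h4. eapply near_mono; [|exact k]. lia. }
  destruct (walk_min (coset_dist x) _ _ _ _ w') as (m' & i & k & ik & w1 & w2).
  assert (mm' : coset_dist x m <= coset_dist x m').
  { assert (walk (above (coset_dist x) (comparable x) (coset_dist x m)) i u1 m').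
    { eapply walk_mono; [|exact w1]. intros ? ? [? _]; auto. }
    eapply (walk_end (fun z => coset_dist x m <= coset_dist x z)); [|eassumption|auto]. intros ? ? (_ & _ & ?); auto. }
  assert (xm' : ~ Hadj x m').
  { apply (walk_end (fun z => ~ Hadj x z)) with (2 := w1); auto. intros ? ? (((_ & h & _) & _) & _); auto. }
  assert (up : forall n a b, walk (above (coset_dist x) (above (coset_dist x) (comparable x) (coset_dist x m)) (coset_dist x m')) n a b ->
            walk (above (coset_dist x) (comparable x) (coset_dist x m')) n a b).
  { intros n a b. apply walk_mono. intros ? ? ((p & _) & q). exact (conj p q). }
  assert (k1 := IH i ltac:(lia) x m' u1 xm').
  assert (k2 := IH k ltac:(lia) x m' u xm' (up _ _ _ w2)).
  assert (w3 : walk (above (coset_dist x) (comparable x) (coset_dist x m')) i m' u1).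
  { apply walk_rev; [|apply up; auto]. apply above_sym, comparable_sym. }
  specialize (k1 w3).
  destruct (classic (Hadj m m')) as [hm | hm].
  { destruct k2 as [h | h].
    - left; eapply Hadj_trans; eauto.
    - right; intro z; apply h. apply near_coset with (v := m) (a := x) (b := u); auto using Hadj_refl. }
  destruct (classic (Hadj m u)) as [mu | mu]; [left; auto | right].
  (* Otherwise [m] sees [x] and [m'] together; then either [m] also sees [u1] near [x], or [m']
     separates [x] from [m] and is closer to [x]. The former contradicts [far], the latter the
     choice of [m]. *)
  assert (star : near m' x m theta).
  { destruct (behrstock m' x m) as [h | h]; auto using nHadj_sym. exfalso.
    destruct k1 as [k1 | k1].
    - apply far. apply near_mono with theta; [lia|].
      apply near_coset with (v := m) (a := x) (b := m'); auto using Hadj_refl.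
    - destruct (classic (Hadj m' u1)) as [z | z].
      { apply far. apply near_mono with theta; [lia|].
        apply near_coset with (v := m) (a := x) (b := m'); auto using Hadj_refl. }
      destruct (behrstock m u1 m') as [b | b]; auto.
      + apply far. apply near_mono with (theta + theta); [lia|].
        eapply near_trans; [exact h | apply near_sym; exact b].
      + assert (coset_dist x m' < coset_dist x m); [|lia].
        apply coset_dist_lt; auto using nHadj_sym. intro t; apply k1.
        apply near_mono with (theta + theta); [lia|].
        eapply near_trans; [exact t | apply near_sym; exact b]. }
  assert (gen : forall z, Hadj m' z \/ ~ near m' x z (3 * theta) -> ~ Hadj m z -> near m m' z theta).
  { intros z hz mz. destruct (classic (Hadj m' z)) as [e | e].
    - apply near_same; auto.
    - destruct hz as [hz | hz]; [tauto|].
      destruct (behrstock m' z m) as [b | b]; auto using nHadj_sym.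
      + exfalso; apply hz. apply near_mono with (theta + theta); [lia|].
        eapply near_trans; [exact star | apply near_sym; exact b].
      + apply near_sym; auto. }
  intro t. apply far. apply near_mono with (3 * theta + (theta + theta)); [lia|].
  eapply near_trans; [exact t|]. eapply near_trans; [|apply gen; [exact k1 | auto]].
  apply near_sym, gen; auto.
Qed.

Lemma same_side_not x y z : same_side x y z -> ~ Hadj x z.
Proof.
  intros (h & n & w). apply (walk_end (fun z => ~ Hadj x z)) with (2 := w); auto.
  intros ? ? (_ & k & _); auto.
Qed.

(** A member of the chain closest to [x] separates [x] from all others, so [x] sees each of them
    within [theta] of it. *)
Lemma same_side_near x y z : same_side x y z -> near x y z (2 * theta).
Proof.
  intros e. pose proof (same_side_not _ _ _ e) as xz. destruct e as (xy & n & w).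
  destruct (walk_min (coset_dist x) _ _ _ _ w) as (m & i & j & _ & w1 & w2).
  assert (xm : ~ Hadj x m).
  { apply (walk_end (fun z => ~ Hadj x z)) with (2 := w1); auto. intros ? ? ((_ & h & _) & _); auto. }
  assert (w3 : walk (above (coset_dist x) (comparable x) (coset_dist x m)) i m y).
  { apply walk_rev; auto. apply above_sym, comparable_sym. }
  assert (key : forall u j, ~ Hadj x u -> walk (above (coset_dist x) (comparable x) (coset_dist x m)) j m u -> near x m u theta).
  { intros u j' xu wu. destruct (classic (Hadj m u)) as [h | h].
    - apply near_same; auto.
    - destruct (chain_min_separates j' x m u xm wu) as [? | far]; [tauto|].
      destruct (behrstock m u x) as [b | b]; auto using nHadj_sym.
      + exfalso; apply far. apply near_mono with theta; [lia|]. apply near_sym; auto.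
      + apply near_sym; auto. }
  replace (2 * theta) with (theta + theta) by lia. eapply near_trans; [apply near_sym|]; eapply key; eauto.
Qed.

Lemma same_side_refl x y : ~ Hadj x y -> same_side x y y.
Proof. intro h; split; auto. exists 0; constructor. Qed.

Lemma same_side_sym x y z : same_side x y z -> same_side x z y.
Proof.
  intro e. split; [eapply same_side_not; eauto|]. destruct e as (_ & n & w). exists n.
  apply walk_rev; auto. apply comparable_sym.
Qed.

Lemma same_side_trans x y z t : same_side x y z -> same_side x z t -> same_side x y t.
Proof. intros (h & n & w) (_ & m & w'). split; auto. exists (n + m). eapply walk_app; eauto. Qed.

Lemma same_side_coset x y z : ~ Hadj x y -> Hadj y z -> same_side x y z.
Proof.
  intros h k; split; auto. exists 1. apply walk_one. repeat split; auto.
  intro t; apply h. eapply Hadj_trans; [exact t | apply Hadj_sym; auto].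
Qed.

Lemma same_side_separates x y z : separates x y z -> same_side x y z.
Proof. intros (h1 & h2 & h3 & h4). split; auto. exists 1. apply walk_one. repeat split; auto. right; left; repeat split; auto. Qed.

Lemma separates_base x x' y z : Hadj x x' -> separates x y z -> separates x' y z.
Proof.
  intros h (h1 & h2 & h3 & h4). repeat split; auto.
  - intro k; apply h1; eapply Hadj_trans; eauto.
  - intro k; apply h2; eapply Hadj_trans; eauto.
  - intro k; apply h4. eapply near_coset; [| | | exact k]; auto using Hadj_refl, Hadj_sym.
Qed.

Lemma same_side_base x x' y z : Hadj x x' -> same_side x y z -> same_side x' y z.
Proof.
  intros h (h1 & n & w). split.
  - intro k; apply h1; eapply Hadj_trans; eauto.
  - exists n. eapply walk_mono; [|exact w]. intros u v (k1 & k2 & k3). repeat split.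
    + intro k; apply k1; eapply Hadj_trans; eauto.
    + intro k; apply k2; eapply Hadj_trans; eauto.
    + destruct k3 as [k | [k | k]]; [left; auto | right; left | right; right]; eapply separates_base; eauto.
Qed.

Lemma nHadj_mul g x y : ~ Hadj x y -> ~ Hadj (g ** x) (g ** y).
Proof. intros h k; apply h; eapply Hadj_mul_inv; eauto. Qed.

Lemma separates_mul g x y z : separates x y z -> separates (g ** x) (g ** y) (g ** z).
Proof.
  intros (h1 & h2 & h3 & h4). repeat split; auto using nHadj_mul.
  intro k; apply h4. apply (near_mul (g^-1)) in k. gsin k. auto.
Qed.

Lemma same_side_mul g x y z : same_side x y z -> same_side (g ** x) (g ** y) (g ** z).
Proof.
  intros (h & n & w). split; auto using nHadj_mul. exists n.
  apply (walk_map (fun t => g ** t) (comparable x)); auto.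
  intros u v (k1 & k2 & k3). repeat split; auto using nHadj_mul.
  destruct k3 as [k | [k | k]]; auto using Hadj_mul, separates_mul.
Qed.

(* [near] for the projections made exact: the projection of [a] is replaced by the union over its class. *)
Definition near' (v a b : V) (r : nat) := forall a' b', same_side v a a' -> same_side v b b' -> near v a' b' r.

Lemma near'_near v a b r : ~ Hadj v a -> ~ Hadj v b -> near' v a b r -> near v a b r.
Proof. intros h k n. apply n; apply same_side_refl; auto. Qed.

Lemma near_near' v a b r : near v a b r -> near' v a b (r + 4 * theta).
Proof.
  intros h a' b' ea eb. apply near_mono with (2 * theta + (r + 2 * theta)); [lia|].
  eapply near_trans; [apply near_sym, same_side_near; exact ea|].
  eapply near_trans; [exact h | apply same_side_near; auto].
Qed.

Lemma near'_sym v a b r : near' v a b r -> near' v b a r.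
Proof. intros h a' b' ea eb. apply near_sym; auto. Qed.

Lemma near'_mono v a b r s : r <= s -> near' v a b r -> near' v a b s.
Proof. intros l h a' b' ea eb. eapply near_mono; eauto. Qed.

Lemma near'_trans v a b c r s : ~ Hadj v b -> near' v a b r -> near' v b c s -> near' v a c (r + s).
Proof. intros vb h k a' c' ea ec. apply near_trans with b; [apply h | apply k]; auto; apply same_side_refl; auto. Qed.

Lemma near'_same_side v a a' b b' r : same_side v a a' -> same_side v b b' -> near' v a b r -> near' v a' b' r.
Proof. intros ea eb h x y ex ey. apply h; eapply same_side_trans; eauto. Qed.

Lemma near'_base v v' a b r : Hadj v v' -> near' v a b r -> near' v' a b r.
Proof.
  intros h n x y ex ey. apply near_coset with (v := v) (a := x) (b := y); auto using Hadj_refl.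
  apply n; eapply same_side_base; eauto using Hadj_sym.
Qed.

Lemma near'_mul g v a b r : near' v a b r -> near' (g ** v) (g ** a) (g ** b) r.
Proof.
  intros n x y ex ey. apply (same_side_mul (g^-1)) in ex, ey. gsin ex. gsin ey.
  specialize (n _ _ ex ey). apply (near_mul g) in n. gsin n. auto.
Qed.

(* [c] lies on the path of cosets from [a] to [b]. *)
Definition btw (a c b : V) := ~ Hadj c a /\ ~ Hadj c b /\ ~ near' c a b (20 * theta).

(** * The order on the cosets between two cosets *)

Lemma btw_sym a c b : btw a c b -> btw b c a.
Proof. intros (h1 & h2 & h3); repeat split; auto. intro; apply h3, near'_sym; auto. Qed.

Lemma btw_mul g a c b : btw a c b -> btw (g ** a) (g ** c) (g ** b).
Proof.
  intros (h1 & h2 & h3); repeat split; auto using nHadj_mul.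
  intro k; apply h3. apply (near'_mul (g^-1)) in k. gsin k. auto.
Qed.

Lemma near'_coset v a a' b b' r : ~ Hadj v a -> ~ Hadj v b -> Hadj a a' -> Hadj b b' ->
  near' v a b r -> near' v a' b' r.
Proof. intros. eapply near'_same_side; [| | eassumption]; apply same_side_coset; auto. Qed.

Lemma btw_coset a a' c c' b b' : Hadj a a' -> Hadj c c' -> Hadj b b' -> btw a c b -> btw a' c' b'.
Proof.
  intros ha hc hb (h1 & h2 & h3).
  assert (n1 : ~ Hadj c' a').
  { intro k; apply h1. eapply Hadj_trans; [exact hc|]. eapply Hadj_trans; [exact k | apply Hadj_sym; auto]. }
  assert (n2 : ~ Hadj c' b').
  { intro k; apply h2. eapply Hadj_trans; [exact hc|]. eapply Hadj_trans; [exact k | apply Hadj_sym; auto]. }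
  repeat split; auto. intro k; apply h3.
  apply near'_base with c'; [apply Hadj_sym; auto|].
  eapply near'_coset; [| | | | exact k]; auto using Hadj_sym.
Qed.

Lemma near'_self v a b : ~ Hadj v a -> Hadj a b -> near' v a b (5 * theta).
Proof. intros h k. replace (5 * theta) with (theta + 4 * theta) by lia. apply near_near', near_same; auto. Qed.

Lemma btw_ends a c b : btw a c b -> ~ Hadj a b.
Proof.
  intros (h1 & h2 & h3) k; apply h3. apply near'_mono with (5 * theta); [lia | apply near'_self; auto].
Qed.

(** The 9 consists of the 5 in [separates] and the 4 lost between [near] and its exact version in
    [near_near']. *)
Lemma far_same_side a c b r : 9 * theta <= r -> ~ Hadj c a -> ~ Hadj c b -> ~ near' c a b r -> same_side a c b.
Proof.
  intros l h1 h2 h3. apply same_side_separates. repeat split; auto using nHadj_sym.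
  - intro k; apply h3. apply near'_mono with (5 * theta); [lia | apply near'_self; auto].
  - intro k; apply h3. apply near'_mono with (5 * theta + 4 * theta); [lia | apply near_near'; auto].
Qed.

Lemma btw_same_side a c b : btw a c b -> same_side a c b.
Proof. intros (h1 & h2 & h3). apply (far_same_side a c b (20 * theta)); auto. lia. Qed.

(** Behrstock's inequality decides: if [d] sees [a] and [c] together, then [c] comes first. *)
Lemma btw_order a b c d : btw a c b -> btw a d b -> ~ Hadj c d ->
  (btw a c d /\ btw c d b) \/ (btw a d c /\ btw d c b).
Proof.
  assert (key : forall a b c d, btw a c b -> btw a d b -> ~ Hadj c d -> near d a c theta ->
    btw a c d /\ btw c d b).
  { clear a b c d. intros a b c d hc hd cd n.
    pose proof hc as (c1 & c2 & c3). pose proof hd as (d1 & d2 & d3).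
    assert (e : same_side c d b).
    { apply same_side_separates. repeat split; auto. intro k; apply d3.
      apply near'_mono with (theta + 5 * theta + 4 * theta); [lia|]. apply near_near'.
      eapply near_trans; [exact n | exact k]. }
    assert (h : btw a c d).
    { repeat split; auto. intro k; apply c3. eapply near'_same_side; [| exact e | exact k].
      apply same_side_refl; auto. }
    split; auto. pose proof (btw_same_side _ _ _ (btw_sym _ _ _ h)) as e2.
    repeat split; auto using nHadj_sym. intro k; apply d3.
    eapply near'_same_side; [exact e2 | | exact k]. apply same_side_refl; auto. }
  intros hc hd cd. pose proof hc as (c1 & c2 & c3). pose proof hd as (d1 & d2 & d3).
  destruct (behrstock d a c) as [n | n]; auto using nHadj_sym.
Qed.

(** Here exactness pays: from [c], the cosets [w] and [b] are in one class, so replacing one by the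
    other leaves the threshold [20 * theta] intact. *)
Lemma btw_inner a b c w : btw a c b -> btw c w b -> btw a w b /\ btw a c w.
Proof.
  intros hc hw. pose proof hc as (c1 & c2 & c3). pose proof hw as (w1 & w2 & w3).
  assert (e : same_side c w b) by (apply btw_same_side; auto).
  assert (n : ~ near' c a w (20 * theta)).
  { intro k; apply c3. eapply near'_same_side; [| exact e | exact k]. apply same_side_refl; auto. }
  assert (h : btw a c w) by (repeat split; auto using nHadj_sym).
  split; auto.
  pose proof (btw_same_side _ _ _ (btw_sym _ _ _ h)) as e2.
  pose proof (btw_ends _ _ _ h) as aw.
  repeat split; auto using nHadj_sym. intro k; apply w3.
  eapply near'_same_side; [apply same_side_sym; exact e2 | | exact k]. apply same_side_refl; auto.
Qed.

(** A bound on the number of cosets in between. It is the measure for the later inductions, as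
    splitting at such a coset lowers it on both sides. *)
Definition cover (n : nat) (a b : V) :=
  exists l : list V, length l <= n /\ forall c, btw a c b -> exists x, In x l /\ Hadj c x.

(** A coset between [a] and [b] must own an edge of any fixed geodesic from [a] to [b]. *)
Lemma cover_exists a b : exists n, cover n a b.
Proof.
  assert (vert : forall n x y, walk adj n x y -> exists l : list V,
    forall v, walk (adj_off v) n x y \/ exists c, In c l /\ Hadj v c).
  { induction 1 as [x | n x y z r w (l & h)].
    - exists nil. intro v; left; constructor.
    - exists (x :: l). intro v. destruct (h v) as [h' | (c & i & j)].
      + destruct (classic (adj_off v x y)) as [k | k].
        * left; econstructor; eauto.
        * right; exists x; split; [left; auto|]. apply NNPP; intro t; apply k.
          destruct r; [left; auto | right; auto].
      + right; exists c; split; [right; auto | auto]. }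
  destruct (vert _ _ _ (dist_walk a b)) as (l & h).
  exists (length l), l; split; auto. intros c (c1 & c2 & c3).
  destruct (h c) as [k | (x & i & j)]; [|eauto].
  exfalso; apply c3. apply near'_mono with (theta + 4 * theta); [lia|].
  apply near_near', (near_of_clean c a b a b); auto using Hadj_refl.
Qed.

Lemma remove_one (l : list V) x : In x l ->
  exists l', length l = S (length l') /\ forall y, In y l -> y = x \/ In y l'.
Proof.
  intro i. apply in_split in i. destruct i as (l1 & l2 & ->). exists (l1 ++ l2). split.
  - rewrite !length_app; simpl; lia.
  - intros y h. apply in_app_or in h as [h | [h | h]]; auto; right; apply in_or_app; auto.
Qed.

Lemma cover_split n a c b : btw a c b -> cover n a b ->
  exists m, n = S m /\ cover m a c /\ cover m c b.
Proof.
  intros h (l & len & cov). destruct (cov c h) as (x & i & cx).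
  destruct (remove_one l x i) as (l' & e & sub).
  destruct n as [|m]; [lia|]. exists m; split; auto.
  assert (key : forall d, btw a d b -> ~ Hadj c d -> exists y, In y l' /\ Hadj d y).
  { intros d hd cd. destruct (cov d hd) as (y & iy & dy). exists y; split; auto.
    destruct (sub y iy) as [-> |]; auto. exfalso; apply cd.
    eapply Hadj_trans; [exact cx | apply Hadj_sym; auto]. }
  split; exists l'; split; try lia; intros d hd; apply key.
  - apply btw_sym. apply (btw_inner b a c d); apply btw_sym; auto.
  - destruct hd as (_ & k & _). apply nHadj_sym; auto.
  - apply (btw_inner a b c d); auto.
  - destruct hd as (k & _). apply nHadj_sym; auto.
Qed.

Lemma cover_coset n a a' b b' : Hadj a a' -> Hadj b b' -> cover n a b -> cover n a' b'.
Proof.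
  intros ha hb (l & len & cov). exists l; split; auto. intros c hc. apply cov.
  eapply btw_coset; [| | | exact hc]; auto using Hadj_refl, Hadj_sym.
Qed.

Lemma cover_sym n a b : cover n a b -> cover n b a.
Proof. intros (l & len & cov). exists l; split; auto. intros c hc. apply cov, btw_sym; auto. Qed.

(* Of three cosets in a row, the middle one sees [d] far from [a] or from [b]; then the first or the
   last one also lies on the side from [d] to [a] or to [b]. *)
Lemma triangle_at_most_two a b d :
  (forall c, btw a c b -> ~ btw a c d) -> (forall c, btw a c b -> ~ btw d c b) ->
  forall c1 c2 c3, btw a c1 b -> btw a c2 b -> btw a c3 b ->
  ~ Hadj c1 c2 -> ~ Hadj c2 c3 -> ~ Hadj c1 c3 -> False.
Proof.
  intros na nb.
  assert (nd : forall c c', btw a c b -> btw a c' b -> ~ Hadj c c' -> ~ Hadj c d).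
  { intros c c' h h' n e. destruct (btw_order a b c c' h h' n) as [[h1 h2] | [h1 h2]].
    - apply (nb c' h'). eapply btw_coset; [| | | exact h2]; auto using Hadj_refl.
    - apply (na c' h'). eapply btw_coset; [| | | exact h1]; auto using Hadj_refl. }
  assert (key : forall c1 c2 c3, btw a c1 b -> btw a c2 b -> btw a c3 b ->
    ~ Hadj c1 c2 -> ~ Hadj c2 c3 -> btw a c1 c2 -> btw c2 c3 b -> False).
  { intros c1 c2 c3 h1 h2 h3 n12 n23 h12 h23.
    assert (e1 : ~ Hadj c1 d) by (apply (nd c1 c2); auto).
    assert (e2 : ~ Hadj c2 d) by (apply (nd c2 c3); auto).
    assert (e3 : ~ Hadj c3 d) by (apply (nd c3 c2); auto using nHadj_sym).
    destruct (btw_order a b c1 c2 h1 h2 n12) as [[_ h12b] | [x _]].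
    2:{ exfalso. destruct (btw_same_side _ _ _ h12) as [z _].
        destruct x as (x1 & x2 & x3). apply x3.
        apply near'_mono with (5 * theta); [lia|].
        eapply near'_same_side; [| |apply (near'_self c2 c1 c1); auto using Hadj_refl].
        - apply (btw_same_side c2 c1 a). apply btw_sym; auto.
        - apply same_side_refl; auto. }
    destruct (btw_order a b c2 c3 h2 h3 n23) as [[h23a _] | [_ x]].
    2:{ exfalso. destruct x as (x1 & x2 & x3). apply x3.
        apply near'_mono with (5 * theta); [lia|].
        eapply near'_same_side; [| |apply (near'_self c2 c3 c3); auto using Hadj_refl].
        - apply same_side_refl; auto.
        - apply (btw_same_side c2 c3 b); auto. }
    pose proof h2 as (z1 & z2 & z3).
    (* The threshold [20 * theta] is halved: [c2] cannot see [d] within [10 * theta] of both ends,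
       and [10 * theta] still exceeds what [far_same_side] asks for. *)
    destruct (classic (near' c2 a d (10 * theta))) as [k | k].
    - destruct (classic (near' c2 d b (10 * theta))) as [k' | k'].
      + apply z3. apply near'_mono with (10 * theta + 10 * theta); [lia|]. apply near'_trans with d; auto.
      + apply (nb c3 h3).
        assert (e : same_side c3 c2 d).
        { apply (far_same_side c3 c2 d (10 * theta)); auto; [lia|].
          intro t; apply k'. apply near'_sym.
          eapply near'_same_side; [| | exact t]; [|apply same_side_refl; auto].
          apply (btw_same_side c2 c3 b); auto. }
        pose proof h23 as (y1 & y2 & y3). repeat split; auto. intro t; apply y3.
        eapply near'_same_side; [apply same_side_sym; exact e | | exact t]. apply same_side_refl; auto.
    - apply (na c1 h1).
      assert (e : same_side c1 c2 d).
      { apply (far_same_side c1 c2 d (10 * theta)); auto using nHadj_sym; [lia|].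
        intro t; apply k.
        eapply near'_same_side; [| | exact t]; [|apply same_side_refl; auto].
        apply (btw_same_side c2 c1 a). apply btw_sym; auto. }
      pose proof h12 as (y1 & y2 & y3). repeat split; auto. intro t; apply y3.
      eapply near'_same_side; [| apply same_side_sym; exact e | exact t]. apply same_side_refl; auto. }
  intros c1 c2 c3 h1 h2 h3 n12 n23 n13.
  destruct (btw_order a b c1 c2 h1 h2 n12) as [[o1 o2] | [o1 o2]];
  destruct (btw_order a b c2 c3 h2 h3 n23) as [[p1 p2] | [p1 p2]];
  destruct (btw_order a b c1 c3 h1 h3 n13) as [[q1 q2] | [q1 q2]].
  - apply (key c1 c2 c3); auto.
  - apply (key c1 c2 c3); auto.
  - apply (key c1 c3 c2); auto using nHadj_sym.
  - apply (key c3 c1 c2); auto using nHadj_sym.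
  - apply (key c2 c1 c3); auto using nHadj_sym.
  - apply (key c2 c3 c1); auto using nHadj_sym.
  - apply (key c3 c2 c1); auto using nHadj_sym.
  - apply (key c3 c2 c1); auto using nHadj_sym.
Qed.

(** * Adjacent cosets *)

Definition short_adj (r : nat) (x y : V) := Xadj x y \/ (Hadj x y /\ rdist_le x r x y).

Definition adjacent (a b : V) := ~ Hadj a b /\ forall c, ~ btw a c b.

Lemma geodesic_edge n x y c d i j : n = dist x y -> walk adj i x c -> adj c d -> walk adj j d y ->
  i + 1 + j = n -> dist x y = dist x c + 1 + dist d y.
Proof.
  intros e w1 a w2 s. apply dist_le in w1, w2.
  assert (dist c d <= 1) by (apply dist_le, walk_one; auto).
  pose proof (dist_tri x c y). pose proof (dist_tri c d y). lia.
Qed.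

(** On a shortest geodesic between the two cosets every edge labelled in [H] lies in a third coset
    [c], as it could be shortened otherwise. Since [c] is not between them, its entry and exit are
    within [20 * theta]. *)
Lemma adjacent_geodesic a b : adjacent a b ->
  exists u v, Hadj a u /\ Hadj b v /\ walk (short_adj (20 * theta)) (dist u v) u v.
Proof.
  intros [ab none]. destruct (coset_dist_spec a b) as [(u & v & au & bv & e) _].
  exists u, v; repeat split; auto. apply (walk_edges adj); [apply dist_walk|].
  intros c d i j w1 cd w2 s.
  pose proof (geodesic_edge _ _ _ _ _ _ _ eq_refl w1 cd w2 s) as g.
  destruct cd as [cd | cd]; [left; auto | right; split; auto].
  assert (ca : ~ Hadj c a).
  { intro k. assert (coset_dist a b <= dist d v); [|lia]. apply coset_dist_le; auto.
    eapply Hadj_trans; [apply Hadj_sym; exact k | auto]. }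
  assert (cb : ~ Hadj c b).
  { intro k. assert (coset_dist a b <= dist u c); [|lia]. apply coset_dist_le; auto. apply Hadj_sym; auto. }
  assert (n : near' c a b (20 * theta)).
  { apply NNPP; intro k. apply (none c). repeat split; auto. }
  apply near'_near in n; auto. specialize (n u v au bv).
  apply n; split; auto using Hadj_refl.
  - eapply clean_on_geodesic; [apply Hadj_refl | exact cd | exact g].
  - apply (clean_on_geodesic c v u d c); auto using Hadj_refl.
    rewrite (dist_sym v u), (dist_sym v d), (dist_sym c u). lia.
Qed.

Lemma adjacent_coset a a' b b' : Hadj a a' -> Hadj b b' -> adjacent a b -> adjacent a' b'.
Proof.
  intros ha hb [ab none]. split.
  - intro k; apply ab. eapply Hadj_trans; [exact ha|]. eapply Hadj_trans; [exact k | apply Hadj_sym; auto].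
  - intros c hc. apply (none c). eapply btw_coset; [| | | exact hc]; auto using Hadj_refl, Hadj_sym.
Qed.

Lemma adjacent_sym a b : adjacent a b -> adjacent b a.
Proof. intros [ab none]; split; auto using nHadj_sym. intros c hc; apply (none c), btw_sym; auto. Qed.

Lemma adjacent_mul g a b : adjacent a b -> adjacent (g ** a) (g ** b).
Proof.
  intros [ab none]; split; auto using nHadj_mul.
  intros c hc; apply (none (g^-1 ** c)). apply (btw_mul (g^-1)) in hc. gsin hc. auto.
Qed.

Definition first (a b c : V) := (Hadj c b \/ btw a c b) /\ adjacent a c.

Lemma first_trans a b c f : btw a c b -> first a c f -> first a b f.
Proof.
  intros h [[k | k] l]; split; auto; right.
  - eapply btw_coset; [| | | exact h]; auto using Hadj_refl, Hadj_sym.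
  - apply btw_sym, (btw_inner b a c f); apply btw_sym; auto.
Qed.

Lemma first_exists a b : ~ Hadj a b -> exists c, first a b c.
Proof.
  intro ab. destruct (cover_exists a b) as [n cv]. revert b ab cv.
  induction n as [n IH] using (well_founded_induction lt_wf); intros b ab cv.
  destruct (classic (exists c, btw a c b)) as [[c h] | h].
  - destruct (cover_split n a c b h cv) as (m & e & cv' & _).
    destruct (IH m ltac:(lia) c) as [f hf]; auto.
    + destruct h as (h & _). apply nHadj_sym; auto.
    + exists f. eapply first_trans; eauto.
  - exists b. split; [left; apply Hadj_refl | split; auto]. intros c k; apply h; eauto.
Qed.

Lemma first_unique a b c c' : first a b c -> first a b c' -> Hadj c c'.
Proof.
  intros [[h | h] [_ k]] [[h' | h'] [_ k']].
  - eapply Hadj_trans; [exact h | apply Hadj_sym; auto].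
  - exfalso; apply (k c'). eapply btw_coset; [| | | exact h']; auto using Hadj_refl, Hadj_sym.
  - exfalso; apply (k' c). eapply btw_coset; [| | | exact h]; auto using Hadj_refl, Hadj_sym.
  - apply NNPP; intro n. destruct (btw_order a b c c' h h' n) as [[o _] | [o _]].
    + apply (k' c o).
    + apply (k c' o).
Qed.

Lemma first_mul g a b c : first a b c -> first (g ** a) (g ** b) (g ** c).
Proof.
  intros [[h | h] k]; split; auto using adjacent_mul; [left; apply Hadj_mul | right; apply btw_mul]; auto.
Qed.

Lemma first_coset a a' b b' c : Hadj a a' -> Hadj b b' -> first a b c -> first a' b' c.
Proof.
  intros ha hb [[h | h] k]; split; try (eapply adjacent_coset; [| | exact k]; auto using Hadj_refl).
  - left; eapply Hadj_trans; eauto.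
  - right. eapply btw_coset; [| | | exact h]; auto using Hadj_refl.
Qed.

(** * Equivariant lifts of paths of cosets *)

Section Lifting.
(** In the application [V] is the quotient, [L] is [G], and [S] consists of the elements that look
    short from every coset. *)
Variables (L : Group) (pi : L -> V) (HL S : L -> Prop).
Hypothesis pi_mul : forall x y, pi (x ** y) = pi x ** pi y.
Hypothesis pi_inv : forall x, pi (x^-1) = (pi x)^-1.
Hypothesis pi_one : pi gone = gone.
Hypothesis HLsub : is_subgroup HL.
Hypothesis HL_lift : forall h, H h -> exists l, HL l /\ pi l = h.
Hypothesis S_inv : forall t, S t -> S (t^-1).
Hypothesis S_lift : forall a b, adjacent a b ->
  exists u v t, Hadj a u /\ Hadj b v /\ pi t = u^-1 ** v /\ S t.
Hypothesis malnormal : forall t h, ~ H t -> H h -> H (t ** h ** t^-1) -> h = gone.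
Hypothesis no_involution : forall g : V, g ** g = gone -> g = gone.

Lemma self_inverse (g : V) : g = g^-1 -> g = gone.
Proof. intro e. apply no_involution. rewrite e at 1. apply gmulVl. Qed.

Definition hlift (h : V) : L := epsilon (inhabits gone) (fun l => HL l /\ pi l = h).
(** The predicate is the same for [h] and its inverse, hence so is the chosen element; [pair_rep]
    uses the same device for unordered pairs up to translation. *)
Definition hrep (h : V) : V := epsilon (inhabits gone) (fun k => k = h \/ k = h^-1).
(* A section of [H] that commutes with inversion, as there are no involutions. *)
Definition hsec (h : V) : L :=
  if excluded_middle_informative (h = gone) then gone
  else if excluded_middle_informative (h = hrep h) then hlift h else (hlift (h^-1))^-1.

Lemma hlift_spec h : H h -> HL (hlift h) /\ pi (hlift h) = h.
Proof. intro hh. unfold hlift. apply epsilon_spec. apply HL_lift; auto. Qed.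

Lemma hrep_spec h : hrep h = h \/ hrep h = h^-1.
Proof. unfold hrep. apply epsilon_spec. exists h; auto. Qed.

Lemma hrep_inv h : hrep (h^-1) = hrep h.
Proof.
  unfold hrep. f_equal. apply functional_extensionality; intro k.
  apply propositional_extensionality. rewrite ginv_inv. tauto.
Qed.

Lemma hsec_one : hsec gone = gone.
Proof. unfold hsec. destruct (excluded_middle_informative _); tauto. Qed.

Lemma hsec_spec h : H h -> HL (hsec h) /\ pi (hsec h) = h.
Proof.
  intro hh. assert (hi : H (h^-1)) by (apply Hsub; auto).
  unfold hsec. destruct (excluded_middle_informative _) as [-> | _].
  { split; auto. apply HLsub. }
  destruct (excluded_middle_informative _) as [e | _].
  - apply hlift_spec; auto.
  - destruct (hlift_spec _ hi) as [k e]. split.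
    + apply HLsub; auto.
    + rewrite pi_inv, e. apply ginv_inv.
Qed.

Lemma hsec_inv h : hsec (h^-1) = (hsec h)^-1.
Proof.
  destruct (classic (h = gone)) as [-> | n].
  { rewrite ginv_one, hsec_one, ginv_one. auto. }
  assert (n' : h^-1 <> gone).
  { intro e; apply n. rewrite <- (ginv_inv V h), e. apply ginv_one. }
  assert (n2 : h <> h^-1) by (intro e; apply n, self_inverse; auto).
  unfold hsec. rewrite hrep_inv, ginv_inv.
  destruct (excluded_middle_informative (h = gone)); [tauto|].
  destruct (excluded_middle_informative (h^-1 = gone)); [tauto|].
  destruct (excluded_middle_informative (h = hrep h)) as [e | e];
  destruct (excluded_middle_informative (h^-1 = hrep h)) as [e' | e']; auto.
  - congruence.
  - symmetry; apply ginv_inv.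
  - destruct (hrep_spec h); congruence.
Qed.

(** The stabilizers of the two cosets are conjugates of [H] by elements in different cosets, so
    malnormality makes their intersection trivial. *)
Lemma stabilizer a b k : ~ Hadj a b -> Hadj (k ** a) a -> Hadj (k ** b) b -> k = gone.
Proof.
  intros ab ha hb.
  assert (e : a^-1 ** k^-1 ** a = gone).
  { apply (malnormal (b^-1 ** a)).
    - intro h; apply ab. apply Hadj_sym. auto.
    - unfold Hadj in ha. gsin ha. gs. auto.
    - unfold Hadj in hb. gsin hb. gs. auto. }
  replace k with ((a ** (a^-1 ** k^-1 ** a) ** a^-1)^-1) by grp. rewrite e. grp.
Qed.

(** The square of a swap fixes both cosets, hence is trivial, so a swap would be an involution. *)
Lemma no_swap a b k : ~ Hadj a b -> Hadj (k ** a) b -> Hadj (k ** b) a -> False.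
Proof.
  intros ab h1 h2. assert (e : k = gone).
  { apply no_involution, (stabilizer a b); auto.
    - eapply Hadj_trans; [|exact h2]. rewrite <- gmulA. apply Hadj_mul; auto.
    - eapply Hadj_trans; [|exact h1]. rewrite <- gmulA. apply Hadj_mul; auto. }
  subst. rewrite gmul1l in h1. auto.
Qed.

(** * Equivariant links between adjacent cosets *)

Definition moves (g a b a' b' : V) := Hadj (g ** a) a' /\ Hadj (g ** b) b'.
Definition samepair (a b a' b' : V) := exists g, moves g a b a' b' \/ moves g a b b' a'.
Definition pair_rep (a b : V) : V * V :=
  epsilon (inhabits (gone, gone)) (fun p => samepair a b (fst p) (snd p)).

Definition edge_data (p : V * V) : V * V * L :=
  epsilon (inhabits (gone, gone, gone)) (fun d =>
    Hadj (fst p) (fst (fst d)) /\ Hadj (snd p) (snd (fst d)) /\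
    pi (snd d) = (fst (fst d))^-1 ** snd (fst d) /\ S (snd d)).

Lemma moves_sym g a b a' b' : moves g a b a' b' -> moves (g^-1) a' b' a b.
Proof.
  intros [h k]; split; apply Hadj_sym.
  - apply (Hadj_mul (g^-1)) in h. gsin h. auto.
  - apply (Hadj_mul (g^-1)) in k. gsin k. auto.
Qed.

Lemma moves_flip g a b a' b' : moves g a b a' b' -> moves g b a b' a'.
Proof. intros [h k]; split; auto. Qed.

Lemma moves_trans g g' a b a' b' a'' b'' :
  moves g a b a' b' -> moves g' a' b' a'' b'' -> moves (g' ** g) a b a'' b''.
Proof.
  intros [h k] [h' k']; split.
  - eapply Hadj_trans; [|exact h']. rewrite <- gmulA. apply Hadj_mul; auto.
  - eapply Hadj_trans; [|exact k']. rewrite <- gmulA. apply Hadj_mul; auto.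
Qed.

Lemma samepair_sym a b a' b' : samepair a b a' b' -> samepair a' b' a b.
Proof.
  intros [g [m | m]]; exists (g^-1); apply moves_sym in m; auto.
  right. apply moves_flip; auto.
Qed.

Lemma samepair_trans a b a' b' a'' b'' :
  samepair a b a' b' -> samepair a' b' a'' b'' -> samepair a b a'' b''.
Proof.
  intros [g m] [g' m']. exists (g' ** g).
  destruct m as [m | m]; destruct m' as [m' | m'].
  - left; eapply moves_trans; eauto.
  - right; eapply moves_trans; eauto.
  - right; eapply moves_trans; [exact m | apply moves_flip; auto].
  - left; eapply moves_trans; [exact m | apply moves_flip; auto].
Qed.

Lemma pair_rep_spec a b : samepair a b (fst (pair_rep a b)) (snd (pair_rep a b)).
Proof.
  unfold pair_rep. apply epsilon_spec with (P := fun p => samepair a b (fst p) (snd p)).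
  exists (a, b), gone. left; split; rewrite gmul1l; apply Hadj_refl.
Qed.

Lemma pair_rep_eq a b a' b' : samepair a b a' b' -> pair_rep a b = pair_rep a' b'.
Proof.
  intro s. unfold pair_rep. f_equal. apply functional_extensionality; intro p.
  apply propositional_extensionality; split; intro k.
  - eapply samepair_trans; [apply samepair_sym; exact s | auto].
  - eapply samepair_trans; eauto.
Qed.

Lemma adjacent_samepair a b a' b' : samepair a b a' b' -> adjacent a b -> adjacent a' b'.
Proof.
  intros [g [[h k] | [h k]]] ad; [|apply adjacent_sym];
    (eapply adjacent_coset; [exact h | exact k | apply adjacent_mul; auto]).
Qed.

Lemma edge_data_spec a b : adjacent a b ->
  let d := edge_data (pair_rep a b) in
  Hadj (fst (pair_rep a b)) (fst (fst d)) /\ Hadj (snd (pair_rep a b)) (snd (fst d)) /\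
  pi (snd d) = (fst (fst d))^-1 ** snd (fst d) /\ S (snd d).
Proof.
  intro ad. unfold edge_data. apply epsilon_spec with (P := fun d =>
    Hadj (fst (pair_rep a b)) (fst (fst d)) /\ Hadj (snd (pair_rep a b)) (snd (fst d)) /\
    pi (snd d) = (fst (fst d))^-1 ** snd (fst d) /\ S (snd d)).
  destruct (S_lift (fst (pair_rep a b)) (snd (pair_rep a b))) as (u & v & t & h).
  - eapply adjacent_samepair; [apply pair_rep_spec | auto].
  - exists (u, v, t); simpl; tauto.
Qed.

(* An equivariant choice, compatible with reversal, of endpoints [u], [v] and of a lift [t] of
   [u^-1 v] for every pair of adjacent cosets: the action on unordered pairs is free. *)
Definition link (a b u v : V) (t : L) :=
  adjacent a b /\ exists g,
  let p := pair_rep a b in let d := edge_data p in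
  (moves g (fst p) (snd p) a b /\ u = g ** fst (fst d) /\ v = g ** snd (fst d) /\ t = snd d) \/
  (moves g (fst p) (snd p) b a /\ u = g ** snd (fst d) /\ v = g ** fst (fst d) /\ t = (snd d)^-1).

Lemma link_exists a b : adjacent a b -> exists u v t, link a b u v t.
Proof.
  intro ad. destruct (samepair_sym _ _ _ _ (pair_rep_spec a b)) as [g [m | m]].
  - do 3 eexists. split; auto. exists g. left. repeat split; try apply m.
  - do 3 eexists. split; auto. exists g. right. repeat split; try apply m.
Qed.

Lemma link_spec a b u v t : link a b u v t ->
  Hadj a u /\ Hadj b v /\ pi t = u^-1 ** v /\ S t.
Proof.
  intros [ad [g h]]. destruct (edge_data_spec a b ad) as (k1 & k2 & k3 & k4).
  destruct h as [([m1 m2] & -> & -> & ->) | ([m1 m2] & -> & -> & ->)].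
  - repeat split; auto.
    + eapply Hadj_trans; [apply Hadj_sym; exact m1 | apply Hadj_mul; auto].
    + eapply Hadj_trans; [apply Hadj_sym; exact m2 | apply Hadj_mul; auto].
    + rewrite k3. grp.
  - repeat split; auto.
    + eapply Hadj_trans; [apply Hadj_sym; exact m2 | apply Hadj_mul; auto].
    + eapply Hadj_trans; [apply Hadj_sym; exact m1 | apply Hadj_mul; auto].
    + rewrite pi_inv, k3. grp.
Qed.

Lemma link_sym a b u v t : link a b u v t -> link b a v u (t^-1).
Proof.
  intros [ad [g h]]. split; [apply adjacent_sym; auto|]. exists g.
  rewrite <- (pair_rep_eq a b b a).
  - destruct h as [(m & -> & -> & ->) | (m & -> & -> & ->)]; [right | left]; repeat split; auto; try apply m.
    apply ginv_inv.
  - exists gone. right; split; rewrite gmul1l; apply Hadj_refl.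
Qed.

Lemma link_mul x a b u v t : link a b u v t -> link (x ** a) (x ** b) (x ** u) (x ** v) t.
Proof.
  intros [ad [g h]]. split; [apply adjacent_mul; auto|]. exists (x ** g).
  rewrite <- (pair_rep_eq a b (x ** a) (x ** b)).
  - assert (k : forall c d c' d', moves g c d c' d' -> moves (x ** g) c d (x ** c') (x ** d')).
    { intros c d c' d' [m1 m2]; split; rewrite <- gmulA; apply Hadj_mul; auto. }
    destruct h as [(m & -> & -> & ->) | (m & -> & -> & ->)]; [left | right]; rewrite !gmulA;
      split; auto.
  - exists x. left; split; apply Hadj_refl.
Qed.

Lemma link_coset a a' b b' u v t : Hadj a a' -> Hadj b b' -> link a b u v t -> link a' b' u v t.
Proof.
  intros ha hb [ad [g h]]. split; [eapply adjacent_coset; eauto|]. exists g.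
  rewrite <- (pair_rep_eq a b a' b').
  - destruct h as [([m1 m2] & h) | ([m1 m2] & h)]; [left | right];
      (split; [split; eapply Hadj_trans; eauto | exact h]).
  - exists gone. left; split; rewrite gmul1l; auto.
Qed.

(** Two elements carrying the representative pair to [a], [b] agree by [stabilizer] if they carry it
    in the same order; opposite orders are excluded by [no_swap]. *)
Lemma link_unique a b u v t u' v' t' :
  link a b u v t -> link a b u' v' t' -> u = u' /\ v = v' /\ t = t'.
Proof.
  intros [ad [g h]] [_ [g' h']].
  set (p := pair_rep a b) in *. cbv zeta in h, h'.
  assert (np : ~ Hadj (fst p) (snd p)).
  { assert (k : adjacent (fst p) (snd p)); [|apply k].
    eapply adjacent_samepair; [apply pair_rep_spec | auto]. }
  assert (same : forall c d, moves g (fst p) (snd p) c d -> moves g' (fst p) (snd p) c d -> g = g').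
  { intros c d m m'. apply moves_sym in m'. pose proof (moves_trans _ _ _ _ _ _ _ _ m m') as [k1 k2].
    rewrite <- (gmul1l V g), <- (gmulVr V g'), <- gmulA.
    rewrite (stabilizer _ _ _ np k1 k2). apply gmul1r. }
  assert (swap : forall c d, moves g (fst p) (snd p) c d -> moves g' (fst p) (snd p) d c -> False).
  { intros c d m m'. apply moves_sym, moves_flip in m'.
    pose proof (moves_trans _ _ _ _ _ _ _ _ m m') as [k1 k2]. eapply no_swap; eauto. }
  destruct h as [(m & -> & -> & ->) | (m & -> & -> & ->)];
  destruct h' as [(m' & -> & -> & ->) | (m' & -> & -> & ->)].
  - rewrite (same _ _ m m'). auto.
  - exfalso; eapply swap; eauto.
  - exfalso; eapply swap; eauto.
  - rewrite (same _ _ m m'). auto.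
Qed.

(** * Lifts along paths of cosets *)

(** It depends on [b] only through the first coset after [a], so prolonging the path at the far end
    does not change it. *)
Definition exit_point (a b p : V) := exists c v t, first a b c /\ link a c p v t.

Lemma exit_point_exists a b : ~ Hadj a b -> exists p, exit_point a b p.
Proof.
  intro ab. destruct (first_exists a b ab) as [c f].
  destruct (link_exists a c) as (u & v & t & l); [apply f|]. exists u, c, v, t; auto.
Qed.

Lemma exit_point_unique a b p p' : exit_point a b p -> exit_point a b p' -> p = p'.
Proof.
  intros (c & v & t & f & l) (c' & v' & t' & f' & l').
  pose proof (first_unique _ _ _ _ f f') as e.
  apply (link_coset a a c c') in l; auto using Hadj_refl.
  apply (link_unique _ _ _ _ _ _ _ _ l l').
Qed.

Lemma exit_point_trans a b c p : btw a c b -> exit_point a c p -> exit_point a b p.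
Proof. intros h (d & v & t & f & l). exists d, v, t; split; auto. eapply first_trans; eauto. Qed.

Lemma exit_point_Hadj a b p : exit_point a b p -> Hadj a p.
Proof. intros (c & v & t & _ & l). apply link_spec in l. apply l. Qed.

Lemma exit_point_mul x a b p : exit_point a b p -> exit_point (x ** a) (x ** b) (x ** p).
Proof.
  intros (c & v & t & f & l). exists (x ** c), (x ** v), t; split; [apply first_mul | apply link_mul]; auto.
Qed.

Lemma exit_point_coset a a' b b' p : Hadj a a' -> Hadj b b' -> exit_point a b p -> exit_point a' b' p.
Proof.
  intros ha hb (c & v & t & f & l). exists c, v, t; split.
  - eapply first_coset; eauto.
  - eapply link_coset; [exact ha | apply Hadj_refl | auto].
Qed.

Lemma exit_point_link a b u v t : link a b u v t -> exit_point a b u.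
Proof.
  intro l. exists b, v, t; split; auto. split; [left; apply Hadj_refl | apply l].
Qed.

(* The part of the lift between the exit points at both ends; [n] counts the interior cosets. *)
Inductive path_lift : nat -> V -> V -> L -> Prop :=
| gr_link : forall a b u v t, link a b u v t -> path_lift 0 a b t
| gr_join : forall n m a c b p q g h, btw a c b -> path_lift n a c g -> path_lift m c b h ->
    exit_point c a p -> exit_point c b q -> path_lift (1 + (n + m)) a b (g ** hsec (p^-1 ** q) ** h).

Lemma path_lift_exists a b : ~ Hadj a b -> exists n g, path_lift n a b g.
Proof.
  intro ab. destruct (cover_exists a b) as [n cv]. revert a b ab cv.
  induction n as [n IH] using (well_founded_induction lt_wf); intros a b ab cv.
  destruct (classic (exists c, btw a c b)) as [[c h] | h].
  - destruct (cover_split n a c b h cv) as (m & e & cv1 & cv2).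
    pose proof h as (ca & cb & _).
    destruct (IH m ltac:(lia) a c) as (n1 & g1 & h1); auto using nHadj_sym.
    destruct (IH m ltac:(lia) c b) as (n2 & g2 & h2); auto.
    destruct (exit_point_exists c a ca) as [p hp]. destruct (exit_point_exists c b cb) as [q hq].
    do 2 eexists. eapply gr_join; eauto.
  - destruct (link_exists a b) as (u & v & t & l).
    + split; auto. intros c k; apply h; eauto.
    + exists 0, t. eapply gr_link; eauto.
Qed.

Lemma path_lift_coset n a a' b b' g : Hadj a a' -> Hadj b b' -> path_lift n a b g -> path_lift n a' b' g.
Proof.
  intros ha hb k. revert a' b' ha hb.
  induction k as [a b u v t l | n m a c b p q g h hc k1 IH1 k2 IH2 hp hq]; intros a' b' ha hb.
  - eapply gr_link. eapply link_coset; eauto.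
  - apply (gr_join n m a' c b').
    + eapply btw_coset; [| | | exact hc]; auto using Hadj_refl.
    + apply IH1; auto using Hadj_refl.
    + apply IH2; auto using Hadj_refl.
    + eapply exit_point_coset; [| | exact hp]; auto using Hadj_refl.
    + eapply exit_point_coset; [| | exact hq]; auto using Hadj_refl.
Qed.

Lemma path_lift_sym n a b g : path_lift n a b g -> path_lift n b a (g^-1).
Proof.
  induction 1 as [a b u v t l | n m a c b p q g h hc k1 IH1 k2 IH2 hp hq].
  - eapply gr_link. apply link_sym; eauto.
  - rewrite (Nat.add_comm n m).
    replace ((g ** hsec (p^-1 ** q) ** h)^-1) with (h^-1 ** hsec (q^-1 ** p) ** g^-1).
    + eapply gr_join; eauto. apply btw_sym; auto.
    + replace (q^-1 ** p) with ((p^-1 ** q)^-1) by grp. rewrite hsec_inv. grp.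
Qed.

Lemma path_lift_mul x n a b g : path_lift n a b g -> path_lift n (x ** a) (x ** b) g.
Proof.
  induction 1 as [a b u v t l | n m a c b p q g h hc k1 IH1 k2 IH2 hp hq].
  - eapply gr_link. apply link_mul; eauto.
  - replace (p^-1 ** q) with ((x ** p)^-1 ** (x ** q)) by grp.
    apply (gr_join n m (x ** a) (x ** c)); auto using btw_mul, exit_point_mul.
Qed.

(** Two subdivisions at [c] and [c'] have a common refinement, because the cosets in between are
    linearly ordered: a lift from [c] to [c'] is inserted and the shorter pieces are compared by
    induction. *)
Lemma path_lift_unique k : forall n n' a b g g', cover k a b -> path_lift n a b g -> path_lift n' a b g' -> g = g'.
Proof.
  induction k as [k IH] using (well_founded_induction lt_wf).
  assert (key : forall n m n' m' a b c c' p q p' q' g h g' h', cover k a b ->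
    btw a c b -> path_lift n a c g -> path_lift m c b h -> exit_point c a p -> exit_point c b q ->
    btw a c' b -> path_lift n' a c' g' -> path_lift m' c' b h' -> exit_point c' a p' -> exit_point c' b q' ->
    btw a c c' -> btw c c' b ->
    g ** hsec (p^-1 ** q) ** h = g' ** hsec (p'^-1 ** q') ** h').
  { intros n m n' m' a b c c' p q p' q' g h g' h' cv hc k1 k2 hp hq hc' k1' k2' hp' hq' o1 o2.
    destruct (cover_split k a c b hc cv) as (j & e & _ & cv2).
    destruct (cover_split k a c' b hc' cv) as (j' & e' & cv1 & _).
    destruct (path_lift_exists c c') as (i & f & kf). { destruct o2 as (o & _). auto using nHadj_sym. }
    assert (e1 : h = f ** hsec (p'^-1 ** q') ** h').
    { eapply (IH j ltac:(lia)); [exact cv2 | exact k2 |].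
      eapply gr_join; [exact o2 | exact kf | exact k2' | | exact hq'].
      destruct (exit_point_exists c' c) as [p'' hp'']. { destruct o2 as (o & _). auto. }
      replace p' with p''; auto. eapply exit_point_unique; [|exact hp'].
      eapply exit_point_trans; [|exact hp'']. apply btw_sym; auto. }
    assert (e2 : g' = g ** hsec (p^-1 ** q) ** f).
    { eapply (IH j' ltac:(lia)); [exact cv1 | exact k1' |].
      eapply gr_join; [exact o1 | exact k1 | exact kf | exact hp |].
      destruct (exit_point_exists c c') as [q'' hq'']. { destruct o1 as (_ & o & _). auto. }
      replace q with q''; auto. eapply exit_point_unique; [|exact hq].
      eapply exit_point_trans; [exact o2 | exact hq'']. }
    rewrite e1, e2. grp. }
  intros n n' a b g g' cv k1 k2.
  destruct k1 as [a b u v t l | n m a c b p q g h hc k1 k1' hp hq].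
  - inversion k2 as [? ? u' v' ? l' | ? ? ? c ? ? ? ? ? hc]; subst.
    + eapply link_unique; eauto.
    + exfalso. destruct l as [[_ no] _]. apply (no c); auto.
  - inversion k2 as [? ? u' v' ? l' | n2 m2 ? c' ? p' q' g2 h2 hc' k3 k3' hp' hq']; subst.
    + exfalso. destruct l' as [[_ no] _]. apply (no c); auto.
    + destruct (classic (Hadj c c')) as [cc | cc].
      * destruct (cover_split k a c b hc cv) as (j & e & cv1 & cv2).
        assert (cc' : Hadj c' c) by (apply Hadj_sym; auto).
        replace g2 with g.
        2:{ apply (IH j ltac:(lia) n n2 a c); auto.
            apply (path_lift_coset n2 a a c' c); auto using Hadj_refl. }
        replace h2 with h.
        2:{ apply (IH j ltac:(lia) m m2 c b); auto.
            apply (path_lift_coset m2 c' c b b); auto using Hadj_refl. }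
        replace p' with p.
        2:{ apply (exit_point_unique c' a); auto. apply (exit_point_coset c c' a a); auto using Hadj_refl. }
        replace q' with q; auto.
        apply (exit_point_unique c' b); auto. apply (exit_point_coset c c' b b); auto using Hadj_refl.
      * destruct (btw_order a b c c' hc hc' cc) as [[o1 o2] | [o1 o2]].
        -- apply (key n m n2 m2 a b c c'); auto.
        -- symmetry. apply (key n2 m2 n m a b c' c); auto.
Qed.

Lemma path_lift_proj n a b g : path_lift n a b g -> forall p q, exit_point a b p -> exit_point b a q -> pi g = p^-1 ** q.
Proof.
  induction 1 as [a b u v t l | n m a c b p q g h hc k1 IH1 k2 IH2 hp hq]; intros x y hx hy.
  - replace x with u; [replace y with v|].
    + apply link_spec in l. apply l.
    + eapply exit_point_unique; [|exact hy]. eapply exit_point_link. apply link_sym; eauto.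
    + eapply exit_point_unique; [|exact hx]. eapply exit_point_link; eauto.
  - pose proof hc as (ca & cb & _).
    destruct (exit_point_exists a c) as [x' hx']; [auto using nHadj_sym|].
    destruct (exit_point_exists b c) as [y' hy']; [auto using nHadj_sym|].
    assert (x' = x) by (eapply exit_point_unique; [eapply exit_point_trans; eauto | auto]). subst x'.
    assert (y' = y) by (eapply exit_point_unique; [eapply exit_point_trans; [apply btw_sym|]; eauto | auto]). subst y'.
    rewrite !pi_mul, (IH1 x p), (IH2 q y); auto.
    destruct (hsec_spec (p^-1 ** q)) as [_ ->]; [|grp].
    apply Hadj_trans with c; [apply Hadj_sym|]; eapply exit_point_Hadj; eauto.
Qed.

Lemma path_lift_word n a b g : path_lift n a b g -> coset_word HL S n (2 * n + 1) g.
Proof.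
  induction 1 as [a b u v t l | n m a c b p q g h hc k1 IH1 k2 IH2 hp hq].
  - apply pw_short. apply link_spec in l. apply l.
  - replace (1 + (n + m)) with (n + 1 + m) by lia.
    replace (2 * (n + 1 + m) + 1) with (2 * n + 1 + 1 + (2 * m + 1)) by lia.
    apply pw_mul; auto. apply pw_mul; auto. apply pw_H.
    apply hsec_spec. apply Hadj_trans with c; [apply Hadj_sym|]; eapply exit_point_Hadj; eauto.
Qed.

(** This turns the counter [n] into a list of distinct cosets, to which [triangle_at_most_two]
    applies. *)
Lemma path_lift_distinct n a b g : path_lift n a b g ->
  exists l, length l = n /\ (forall c, In c l -> btw a c b) /\ ForallOrdPairs (fun x y => ~ Hadj x y) l.
Proof.
  assert (fop : forall (l1 l2 : list V), ForallOrdPairs (fun x y => ~ Hadj x y) l1 ->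
    ForallOrdPairs (fun x y => ~ Hadj x y) l2 -> (forall x y, In x l1 -> In y l2 -> ~ Hadj x y) ->
    ForallOrdPairs (fun x y => ~ Hadj x y) (l1 ++ l2)).
  { induction l1 as [|z l1 IH]; simpl; intros l2 h1 h2 h; auto.
    inversion h1; subst. constructor.
    - apply Forall_app; split; auto. apply Forall_forall; intros; apply h; auto.
    - apply IH; auto. }
  induction 1 as [a b u v t l | n m a c b p q g h hc k1 (l1 & e1 & b1 & d1) k2 (l2 & e2 & b2 & d2) hp hq].
  - exists nil. split; [auto|]. split; [|constructor]. intros c i; destruct i.
  - exists (l1 ++ c :: l2). split; [|split].
    + rewrite length_app; simpl; lia.
    + intros x i. apply in_app_or in i as [i | [<- | i]]; auto.
      * apply btw_sym, (btw_inner b a c x); apply btw_sym; auto.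
      * apply (btw_inner a b c x); auto.
    + apply fop; auto.
      * constructor; auto. apply Forall_forall; intros x i.
        destruct (b2 x i) as (k & _). auto using nHadj_sym.
      * intros x y i [<- | j].
        -- destruct (b1 x i) as (_ & k & _). auto.
        -- pose proof (b1 x i) as hx. pose proof (b2 y j) as hy. intro xy.
           assert (hy' : btw a c y) by (apply (btw_inner a b c y); auto).
           assert (hx' : btw a c x).
           { eapply btw_coset; [| | | exact hy']; auto using Hadj_refl, Hadj_sym. }
           destruct hx as (x1 & x2 & x3). apply x3. apply near'_mono with (5 * theta); [lia|].
           eapply near'_same_side; [|apply same_side_refl; auto|apply (near'_self x c c); auto using Hadj_refl].
           apply btw_same_side, btw_sym; auto.
Qed.

(* The lift of [x^-1 y] read along the path of cosets from [x] to [y]. *)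
Definition point_lift (x y : V) (g : L) :=
  (Hadj x y /\ g = hsec (x^-1 ** y)) \/
  (~ Hadj x y /\ exists p q n h, exit_point x y p /\ exit_point y x q /\ path_lift n x y h /\
     g = hsec (x^-1 ** p) ** h ** hsec (q^-1 ** y)).

Lemma point_lift_exists x y : exists g, point_lift x y g.
Proof.
  destruct (classic (Hadj x y)) as [h | h].
  - eexists; left; eauto.
  - destruct (exit_point_exists x y h) as [p hp]. destruct (exit_point_exists y x) as [q hq]; auto using nHadj_sym.
    destruct (path_lift_exists x y h) as (n & g & k). eexists; right; split; auto. exists p, q, n, g; auto.
Qed.

Lemma point_lift_unique x y g g' : point_lift x y g -> point_lift x y g' -> g = g'.
Proof.
  intros [[h ->] | (h & p & q & n & k & hp & hq & hk & ->)]
    [[h' ->] | (h' & p' & q' & n' & k' & hp' & hq' & hk' & ->)]; auto; try tauto.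
  rewrite (exit_point_unique _ _ _ _ hp hp'), (exit_point_unique _ _ _ _ hq hq').
  destruct (cover_exists x y) as [j cv]. rewrite (path_lift_unique j _ _ _ _ _ _ cv hk hk'). auto.
Qed.

Lemma point_lift_sym x y g : point_lift x y g -> point_lift y x (g^-1).
Proof.
  intros [[h ->] | (h & p & q & n & k & hp & hq & hk & ->)].
  - left; split; [apply Hadj_sym; auto|]. rewrite <- hsec_inv. f_equal. grp.
  - right; split; [auto using nHadj_sym|]. exists q, p, n, (k^-1). repeat split; auto.
    + apply path_lift_sym; auto.
    + replace (y^-1 ** q) with ((q^-1 ** y)^-1) by grp.
      replace (p^-1 ** x) with ((x^-1 ** p)^-1) by grp. rewrite !hsec_inv. grp.
Qed.

Lemma point_lift_mul z x y g : point_lift x y g -> point_lift (z ** x) (z ** y) g.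
Proof.
  intros [[h ->] | (h & p & q & n & k & hp & hq & hk & ->)].
  - left; split; [apply Hadj_mul; auto | f_equal; grp].
  - right; split; [auto using nHadj_mul|]. exists (z ** p), (z ** q), n, k.
    repeat split; auto using exit_point_mul, path_lift_mul. f_equal; [f_equal|]; f_equal; grp.
Qed.

Lemma hsec_pi_from x y p : exit_point x y p -> pi (hsec (x^-1 ** p)) = x^-1 ** p.
Proof. intro h. apply hsec_spec. eapply exit_point_Hadj; eauto. Qed.

Lemma hsec_pi_to x y p : exit_point x y p -> pi (hsec (p^-1 ** x)) = p^-1 ** x.
Proof. intro h. apply hsec_spec. apply Hadj_sym. eapply exit_point_Hadj; eauto. Qed.

Lemma point_lift_pi x y g : point_lift x y g -> pi g = x^-1 ** y.
Proof.
  intros [[h ->] | (h & p & q & n & k & hp & hq & hk & ->)].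
  - apply hsec_spec; auto.
  - rewrite !pi_mul, (hsec_pi_from x y), (hsec_pi_to y x), (path_lift_proj _ _ _ _ hk p q); auto. grp.
Qed.

(** The cut is made at the exit point [z] itself, so the first part ends with [hsec gone], which is
    trivial, and the second part begins with the full letter of [c]. *)
Lemma point_lift_split x c y z g g1 g2 : btw x c y -> exit_point c x z ->
  point_lift x y g -> point_lift x z g1 -> point_lift z y g2 -> g = g1 ** g2.
Proof.
  intros hc hz F F1 F2. pose proof hc as (cx & cy & _). pose proof (exit_point_Hadj _ _ _ hz) as cz.
  pose proof (Hadj_sym _ _ cz) as zc.
  assert (xz : ~ Hadj x z).
  { intro k; apply cx. eapply Hadj_trans; [exact cz | apply Hadj_sym; auto]. }
  assert (zy : ~ Hadj z y) by (intro k; apply cy; eapply Hadj_trans; eauto).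
  destruct (path_lift_exists x c) as (n1 & h1 & k1); [auto using nHadj_sym|].
  destruct (path_lift_exists c y) as (n2 & h2 & k2); [auto|].
  destruct (exit_point_exists x c) as [p hp]; [auto using nHadj_sym|].
  destruct (exit_point_exists y c) as [q hq]; [auto using nHadj_sym|].
  destruct (exit_point_exists c y cy) as [w hw].
  assert (e : g = hsec (x^-1 ** p) ** (h1 ** hsec (z^-1 ** w) ** h2) ** hsec (q^-1 ** y)).
  { apply (point_lift_unique x y); auto. right; split; [eapply btw_ends; eauto|].
    exists p, q, (1 + (n1 + n2)), (h1 ** hsec (z^-1 ** w) ** h2). repeat split; auto.
    - eapply exit_point_trans; eauto.
    - eapply exit_point_trans; [apply btw_sym|]; eauto.
    - eapply gr_join; eauto. }
  assert (e1 : g1 = hsec (x^-1 ** p) ** h1 ** hsec (z^-1 ** z)).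
  { apply (point_lift_unique x z); auto. right; split; auto. exists p, z, n1, h1. repeat split; auto.
    - eapply exit_point_coset; [| | exact hp]; auto using Hadj_refl.
    - eapply exit_point_coset; [| | exact hz]; auto using Hadj_refl.
    - eapply path_lift_coset; [| | exact k1]; auto using Hadj_refl. }
  assert (e2 : g2 = hsec (z^-1 ** w) ** h2 ** hsec (q^-1 ** y)).
  { apply (point_lift_unique z y); auto. right; split; auto. exists w, q, n2, h2. repeat split; auto.
    - eapply exit_point_coset; [| | exact hw]; auto using Hadj_refl.
    - eapply exit_point_coset; [| | exact hq]; auto using Hadj_refl.
    - eapply path_lift_coset; [| | exact k2]; auto using Hadj_refl. }
  rewrite e, e1, e2, gmulVl, hsec_one. grp.
Qed.

Lemma hsec_from a b p : exit_point a b p -> HL (hsec (a^-1 ** p)).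
Proof. intro h. apply hsec_spec. eapply exit_point_Hadj; eauto. Qed.

Lemma hsec_to a b p : exit_point a b p -> HL (hsec (p^-1 ** a)).
Proof. intro h. apply hsec_spec. apply Hadj_sym. eapply exit_point_Hadj; eauto. Qed.

(** * Triangles *)

(** Three corners and two cosets on each side give 9 letters of [H]; each side has at most three
    links, giving 9 more factors. Conjugation by [k] permits moving the base corner. *)
Definition nonagon (g : L) :=
  exists k m s h, g = k ** h ** k^-1 /\ m <= 9 /\ s <= 18 /\ coset_word HL S m s h.

Lemma nonagon_conj k g : nonagon g -> nonagon (k ** g ** k^-1).
Proof.
  intros (j & m & s & h & -> & r). exists (k ** j), m, s, h; split; auto. grp.
Qed.

Lemma nonagon_rot g1 g2 g3 : nonagon (g2 ** g3 ** g1) -> nonagon (g1 ** g2 ** g3).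
Proof.
  intro h. replace (g1 ** g2 ** g3) with (g1 ** (g2 ** g3 ** g1) ** g1^-1) by grp.
  apply nonagon_conj; auto.
Qed.

Lemma HL_mul h k : HL h -> HL k -> HL (h ** k).
Proof. apply HLsub. Qed.

(* At the corner [x], the sides towards [y] and [t] have no common coset. *)
Definition apart (x y t : V) := forall c, btw x c y -> ~ btw x c t.

Lemma path_lift_apart n x y t g : apart x y t -> apart y t x -> path_lift n x y g -> n <= 2.
Proof.
  intros h1 h2 k. destruct (path_lift_distinct _ _ _ _ k) as (l & <- & b & d).
  destruct l as [|c1 [|c2 [|c3 l]]]; simpl; try lia. exfalso.
  inversion d as [|? ? f1 d1]; subst. inversion d1 as [|? ? f2 d2]; subst.
  inversion f1 as [|? ? n12 f1']; subst. inversion f1' as [|? ? n13 _]; subst.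
  inversion f2 as [|? ? n23 _]; subst.
  apply (triangle_at_most_two x y t) with c1 c2 c3; auto; try (apply b; simpl; auto).
  intros c hc hc'. apply (h2 c); apply btw_sym; auto.
Qed.

(** When two corners share a coset, the other two sides join the same pair of cosets. Being apart at
    [t], they then have no interior coset at all. *)
Lemma triangle_degenerate x y t g1 g2 g3 : Hadj x y -> apart t x y ->
  point_lift x y g1 -> point_lift y t g2 -> point_lift t x g3 -> nonagon (g1 ** g2 ** g3).
Proof.
  intros xy ap F1 F2 F3.
  destruct F1 as [[_ ->] | [? _]]; [|tauto].
  assert (s1 : HL (hsec (x^-1 ** y))) by (apply hsec_spec; auto).
  destruct F2 as [[yt ->] | (yt & p2 & q2 & n2 & h2 & hp2 & hq2 & k2 & ->)].
  - assert (tx : Hadj t x).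
    { apply Hadj_sym. eapply Hadj_trans; eauto. }
    destruct F3 as [[_ ->] | [? _]]; [|tauto].
    exists gone. do 3 eexists. split; [gs; reflexivity|]. split; [|split; [|apply pw_H]]; try lia.
    apply HL_mul; auto. apply HL_mul; apply hsec_spec; auto.
  - destruct F3 as [[tx ->] | (tx & p3 & q3 & n3 & h3 & hp3 & hq3 & k3 & ->)].
    { exfalso; apply yt, Hadj_sym. eapply Hadj_trans; eauto. }
    assert (no : forall c, ~ btw y c t).
    { intros c hc. apply (ap c); [|apply btw_sym; auto].
      apply btw_sym. eapply btw_coset; [| | | exact hc]; auto using Hadj_refl, Hadj_sym. }
    assert (n2 = 0).
    { destruct (path_lift_distinct _ _ _ _ k2) as (l & <- & b & _). destruct l as [|c l]; auto.
      exfalso. apply (no c), b; left; auto. }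
    assert (n3 = 0).
    { destruct (path_lift_distinct _ _ _ _ k3) as (l & <- & b & _). destruct l as [|c l]; auto.
      exfalso. apply (no c). apply btw_sym. eapply btw_coset; [| | | apply b; left; eauto]; auto using Hadj_refl. }
    subst.
    exists gone, (1 + 0 + 1 + 0 + 1), (1 + 1 + 1 + 1 + 1).
    exists (hsec (x^-1 ** y) ** hsec (y^-1 ** p2) ** h2 ** (hsec (q2^-1 ** t) ** hsec (t^-1 ** p3)) **
      h3 ** hsec (q3^-1 ** x)).
    split; [grp|]. split; [lia|]. split; [lia|].
    apply pw_mul; [|apply pw_H, (hsec_to _ _ _ hq3)].
    apply pw_mul; [|exact (path_lift_word _ _ _ _ k3)].
    apply pw_mul; [|apply pw_H, HL_mul; [exact (hsec_to _ _ _ hq2) | exact (hsec_from _ _ _ hp3)]].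
    apply pw_mul; [|exact (path_lift_word _ _ _ _ k2)].
    apply pw_H, HL_mul; [exact s1 | exact (hsec_from _ _ _ hp2)].
Qed.

Lemma triangle_apart x y t g1 g2 g3 : apart x y t -> apart y t x -> apart t x y ->
  point_lift x y g1 -> point_lift y t g2 -> point_lift t x g3 -> nonagon (g1 ** g2 ** g3).
Proof.
  intros a1 a2 a3 F1 F2 F3.
  destruct (classic (Hadj x y)) as [xy | xy]; [eapply triangle_degenerate; eauto|].
  destruct (classic (Hadj y t)) as [yt | yt].
  { apply nonagon_rot. eapply triangle_degenerate; eauto. }
  destruct (classic (Hadj t x)) as [tx | tx].
  { apply nonagon_rot, nonagon_rot. eapply triangle_degenerate; eauto. }
  destruct F1 as [[? _] | (_ & p1 & q1 & n1 & h1 & hp1 & hq1 & k1 & ->)]; [tauto|].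
  destruct F2 as [[? _] | (_ & p2 & q2 & n2 & h2 & hp2 & hq2 & k2 & ->)]; [tauto|].
  destruct F3 as [[? _] | (_ & p3 & q3 & n3 & h3 & hp3 & hq3 & k3 & ->)]; [tauto|].
  pose proof (path_lift_apart _ _ _ _ _ a1 a2 k1). pose proof (path_lift_apart _ _ _ _ _ a2 a3 k2).
  pose proof (path_lift_apart _ _ _ _ _ a3 a1 k3).
  exists (hsec (x^-1 ** p1)), (n1 + 1 + n2 + 1 + n3 + 1),
    ((2 * n1 + 1) + 1 + (2 * n2 + 1) + 1 + (2 * n3 + 1) + 1).
  exists (h1 ** (hsec (q1^-1 ** y) ** hsec (y^-1 ** p2)) ** h2 ** (hsec (q2^-1 ** t) ** hsec (t^-1 ** p3)) **
      h3 ** (hsec (q3^-1 ** x) ** hsec (x^-1 ** p1))).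
  split; [grp|]. split; [lia|]. split; [lia|].
  apply pw_mul; [|apply pw_H, HL_mul; [exact (hsec_to _ _ _ hq3) | exact (hsec_from _ _ _ hp1)]].
  apply pw_mul; [|exact (path_lift_word _ _ _ _ k3)].
  apply pw_mul; [|apply pw_H, HL_mul; [exact (hsec_to _ _ _ hq2) | exact (hsec_from _ _ _ hp3)]].
  apply pw_mul; [|exact (path_lift_word _ _ _ _ k2)].
  apply pw_mul; [|apply pw_H, HL_mul; [exact (hsec_to _ _ _ hq1) | exact (hsec_from _ _ _ hp2)]].
  exact (path_lift_word _ _ _ _ k1).
Qed.

(* A coset common to the two sides at a corner can be made the new corner: both sides have the
   same beginning, which cancels. *)
Lemma triangle_nonagon n : forall x y t g1 g2 g3 n1 n2 n3,
  cover n1 x y -> cover n2 y t -> cover n3 t x -> n1 + n2 + n3 <= n ->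
  point_lift x y g1 -> point_lift y t g2 -> point_lift t x g3 -> nonagon (g1 ** g2 ** g3).
Proof.
  induction n as [n IH] using (well_founded_induction lt_wf).
  assert (corner : forall x y t g1 g2 g3 n1 n2 n3,
    cover n1 x y -> cover n2 y t -> cover n3 t x -> n1 + n2 + n3 <= n ->
    point_lift x y g1 -> point_lift y t g2 -> point_lift t x g3 -> ~ apart x y t -> nonagon (g1 ** g2 ** g3)).
  { intros x y t g1 g2 g3 n1 n2 n3 c1 c2 c3 l F1 F2 F3 na.
    assert (k : exists c, btw x c y /\ btw x c t).
    { apply NNPP; intro k; apply na. intros c h h'; apply k; eauto. }
    destruct k as (c & hy & ht). pose proof hy as (cx & _).
    destruct (exit_point_exists c x cx) as [z hz]. pose proof (exit_point_Hadj _ _ _ hz) as cz.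
    destruct (cover_split _ _ _ _ hy c1) as (m1 & e1 & _ & d1).
    destruct (cover_split _ _ _ _ ht (cover_sym _ _ _ c3)) as (m3 & e3 & _ & d3).
    destruct (point_lift_exists x z) as [h0 f0]. destruct (point_lift_exists z y) as [h1 f1].
    destruct (point_lift_exists z t) as [h3 f3].
    rewrite (point_lift_split x c y z g1 h0 h1); auto.
    assert (e : g3^-1 = h0 ** h3).
    { apply (point_lift_split x c t z); auto. apply point_lift_sym; auto. }
    (* The common beginning [h0] of the two sides survives only as a conjugating element, and the
       remaining triangle has corner [z]. *)
    replace (h0 ** h1 ** g2 ** g3) with (h0 ** (h1 ** g2 ** h3^-1) ** h0^-1).
    - apply nonagon_conj. apply (IH (m1 + n2 + m3) ltac:(lia) z y t h1 g2 (h3^-1) m1 n2 m3); auto.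
      + eapply cover_coset; [exact cz | apply Hadj_refl | auto].
      + apply cover_sym. eapply cover_coset; [exact cz | apply Hadj_refl | auto].
      + apply point_lift_sym; auto.
    - replace g3 with ((h0 ** h3)^-1) by (rewrite <- e; apply ginv_inv). grp. }
  intros x y t g1 g2 g3 n1 n2 n3 c1 c2 c3 l F1 F2 F3.
  destruct (classic (apart x y t)) as [a1 | a1]; [|eapply corner; [exact c1 | exact c2 | exact c3 | ..]; eauto].
  destruct (classic (apart y t x)) as [a2 | a2].
  2:{ apply nonagon_rot. eapply corner; [exact c2 | exact c3 | exact c1 | ..]; eauto. lia. }
  destruct (classic (apart t x y)) as [a3 | a3].
  2:{ apply nonagon_rot, nonagon_rot. eapply corner; [exact c3 | exact c1 | exact c2 | ..]; eauto. lia. }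
  apply (triangle_apart x y t); auto.
Qed.

(** By equivariance [F q] is also the lift of the side from [p] to [p ** q], so the expression is
    read around the triangle 1, [p], [p ** q]. *)
Lemma equivariant_lift : exists F : V -> L, (forall q, pi (F q) = q) /\
  forall p q, nonagon (F p ** F q ** (F (p ** q))^-1).
Proof.
  exists (fun q => epsilon (inhabits gone) (point_lift gone q)).
  assert (spec : forall q, point_lift gone q (epsilon (inhabits gone) (point_lift gone q))).
  { intro q. apply epsilon_spec, point_lift_exists. }
  split.
  - intro q. rewrite (point_lift_pi _ _ _ (spec q)). grp.
  - intros p q. destruct (cover_exists gone p) as [n1 c1].
    destruct (cover_exists p (p ** q)) as [n2 c2]. destruct (cover_exists (p ** q) gone) as [n3 c3].
    apply (triangle_nonagon (n1 + n2 + n3) gone p (p ** q) _ _ _ n1 n2 n3); auto.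
    + pose proof (point_lift_mul p _ _ _ (spec q)) as h. rewrite gmul1r in h. auto.
    + apply point_lift_sym; auto.
Qed.

End Lifting.
End Projections.
End Hyperbolic.
End Geometry.
(** * The quotient group *)

Section Quotient.
Variables (G : Group) (N : G -> Prop).

Lemma ncl_conj_closed g x : ncl G N x -> ncl G N (g ** x ** g^-1).
Proof.
  induction 1 as [| n c hn | x y _ IHx _ IHy | x _ IHx].
  - gs. apply ncl_one.
  - replace (g ** (c ** n ** c^-1) ** g^-1) with ((g ** c) ** n ** (g ** c)^-1) by grp.
    apply ncl_conj; auto.
  - replace (g ** (x ** y) ** g^-1) with ((g ** x ** g^-1) ** (g ** y ** g^-1)) by grp.
    apply ncl_mul; auto.
  - replace (g ** x^-1 ** g^-1) with ((g ** x ** g^-1)^-1) by grp. apply ncl_inv; auto.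
Qed.

Lemma qeq_refl x : qeq N x x.
Proof. unfold qeq. rewrite gmulVl. apply ncl_one. Qed.

Lemma qeq_sym x y : qeq N x y -> qeq N y x.
Proof. unfold qeq. intro h. apply ncl_inv in h. gsin h. auto. Qed.

Lemma qeq_trans x y z : qeq N x y -> qeq N y z -> qeq N x z.
Proof.
  unfold qeq. intros h k. replace (x^-1 ** z) with ((x^-1 ** y) ** (y^-1 ** z)) by grp.
  apply ncl_mul; auto.
Qed.

Lemma qeq_mul x x' y y' : qeq N x x' -> qeq N y y' -> qeq N (x ** y) (x' ** y').
Proof.
  unfold qeq. intros h k.
  replace ((x ** y)^-1 ** (x' ** y')) with ((y^-1 ** (x^-1 ** x') ** y^-1^-1) ** (y^-1 ** y')) by grp.
  apply ncl_mul; auto. apply ncl_conj_closed; auto.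
Qed.

Definition rep (x : G) : G := epsilon (inhabits gone) (fun y => qeq N x y).

Lemma rep_qeq x : qeq N x (rep x).
Proof. unfold rep. apply epsilon_spec. exists x. apply qeq_refl. Qed.

Lemma rep_eq x y : qeq N x y -> rep x = rep y.
Proof.
  intro h. unfold rep. f_equal. apply functional_extensionality; intro z.
  apply propositional_extensionality; split; intro k.
  - eapply qeq_trans; [apply qeq_sym; exact h | auto].
  - eapply qeq_trans; eauto.
Qed.

Lemma rep_rep x : rep (rep x) = rep x.
Proof. apply rep_eq, qeq_sym, rep_qeq. Qed.

(** Classes are encoded by their chosen representatives, so that equality in the quotient is Leibniz
    equality. *)
Definition qtype := {x : G | rep x = x}.
Definition qpi (x : G) : qtype := exist _ (rep x) (rep_rep x).

Lemma qpi_eq x y : qpi x = qpi y <-> qeq N x y.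
Proof.
  split.
  - intro e. apply (f_equal (@proj1_sig _ _)) in e; simpl in e.
    eapply qeq_trans; [apply rep_qeq|]. rewrite e. apply qeq_sym, rep_qeq.
  - intro h. apply eq_sig_hprop; simpl; [intros; apply proof_irrelevance | apply rep_eq; auto].
Qed.

Lemma qpi_val (a : qtype) : qpi (proj1_sig a) = a.
Proof.
  apply eq_sig_hprop; simpl; [intros; apply proof_irrelevance | apply proj2_sig].
Qed.

Lemma qpi_rep x : qpi (proj1_sig (qpi x)) = qpi x.
Proof. apply qpi_val. Qed.

Lemma qpi_mul_l x y : qpi (proj1_sig (qpi x) ** y) = qpi (x ** y).
Proof. apply qpi_eq, qeq_mul; [apply qpi_eq, qpi_rep | apply qeq_refl]. Qed.

Lemma qpi_mul_r x y : qpi (x ** proj1_sig (qpi y)) = qpi (x ** y).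
Proof. apply qpi_eq, qeq_mul; [apply qeq_refl | apply qpi_eq, qpi_rep]. Qed.

Definition quotient : Group.
Proof.
  refine {| carrier := qtype;
            gmul := fun a b => qpi (proj1_sig a ** proj1_sig b);
            gone := qpi gone;
            ginv := fun a => qpi ((proj1_sig a)^-1) |}.
  - intros x y z. cbv beta. rewrite qpi_mul_l, qpi_mul_r. f_equal. apply gmulA.
  - intros x. cbv beta. rewrite qpi_mul_l, gmul1l. apply qpi_val.
  - intros x. cbv beta. rewrite qpi_mul_r, gmul1r. apply qpi_val.
  - intros x. cbv beta. rewrite qpi_mul_l, gmulVl. auto.
  - intros x. cbv beta. rewrite qpi_mul_r, gmulVr. auto.
Defined.

Lemma quotient_exists : exists (Q : Group) (pi : G -> Q),
  (forall x y, pi (x ** y) = pi x ** pi y) /\ (forall q, exists x, pi x = q) /\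
  (forall x y, pi x = pi y <-> qeq N x y).
Proof.
  exists quotient, qpi. repeat split.
  - intros x y. change (qpi (x ** y) = qpi (proj1_sig (qpi x) ** proj1_sig (qpi y))).
    rewrite qpi_mul_l, qpi_mul_r. auto.
  - intro q. exists (proj1_sig q). apply qpi_val.
  - apply qpi_eq.
  - apply qpi_eq.
Qed.

End Quotient.

(** * Geometry of the quotient by lifting *)

Section Filling.
Variables (G Q : Group) (pi : G -> Q) (H X N : G -> Prop) (del Lam : nat).
Hypothesis pi_mul : forall x y, pi (x ** y) = pi x ** pi y.
Hypothesis pi_surj : forall q, exists x, pi x = q.
Hypothesis pi_eq : forall x y, pi x = pi y <-> qeq N x y.
Hypothesis Hsub : is_subgroup H.
Hypothesis Hgen : generates (fun g => X g \/ H g).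
Hypothesis hyp : forall x y z t,
  dist G H X x z + dist G H X y t <=
  Nat.max (dist G H X x y + dist G H X z t) (dist G H X x t + dist G H X y z) + del.
Hypothesis Nnorm : is_normal_subgroup_of N H.
Hypothesis HLam : 25 * polyD del <= Lam.
Hypothesis deep : forall n, N n -> n <> gone -> ~ rdist_le G H X gone (Lam + 29 * polyD del) gone n.

Definition image (S : G -> Prop) (q : Q) := exists g, S g /\ pi g = q.
Notation HQ := (image H).
Notation XQ := (image X).

Lemma pi_one : pi gone = gone.
Proof. apply (gmul_cancel_l Q (pi gone)). rewrite <- pi_mul, gmul1r, gmul1r. auto. Qed.

Lemma pi_inv x : pi (x^-1) = (pi x)^-1.
Proof. apply ginv_unique. rewrite <- pi_mul, gmulVr. apply pi_one. Qed.

Lemma pi_ncl k : ncl G N k <-> pi k = gone.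
Proof.
  rewrite <- pi_one. split; intro h.
  - symmetry. apply pi_eq. unfold qeq. gs. auto.
  - symmetry in h. apply pi_eq in h. unfold qeq in h. gsin h. auto.
Qed.

Lemma HQ_sub : is_subgroup HQ.
Proof.
  destruct Hsub as (h1 & hm & hi). repeat split.
  - exists gone; split; auto. apply pi_one.
  - intros x y (g & hg & <-) (g' & hg' & <-). exists (g ** g'); split; auto.
  - intros x (g & hg & <-). exists (g^-1); split; auto. apply pi_inv.
Qed.

Lemma HQ_gen : generates (fun q => XQ q \/ HQ q).
Proof.
  intro q. destruct (pi_surj q) as [g <-]. induction (Hgen g) as [| s hs | x y _ IHx _ IHy | x _ IHx].
  - rewrite pi_one. apply gen_one.
  - apply gen_elt. destruct hs; [left | right]; exists s; auto.
  - rewrite pi_mul. apply gen_mul; auto.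
  - rewrite pi_inv. apply gen_inv; auto.
Qed.

Lemma Hadj_pi x y : Hadj G H x y -> Hadj Q HQ (pi x) (pi y).
Proof. intro h. exists (x^-1 ** y); split; auto. rewrite pi_mul, pi_inv. auto. Qed.

Lemma Xadj_pi x y : Xadj G X x y -> Xadj Q XQ (pi x) (pi y).
Proof.
  intros [h|h]; [left; exists (x^-1 ** y) | right; exists (y^-1 ** x)]; split; auto;
    rewrite pi_mul, pi_inv; auto.
Qed.

Lemma adj_pi x y : adj G H X x y -> adj Q HQ XQ (pi x) (pi y).
Proof. intros [h|h]; [left; apply Xadj_pi | right; apply Hadj_pi]; auto. Qed.

Lemma Hadj_lift x q : Hadj Q HQ (pi x) q -> exists y, pi y = q /\ Hadj G H x y.
Proof.
  intros (h & hh & e). exists (x ** h); split.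
  - rewrite pi_mul, e. grp.
  - unfold Hadj. gs. auto.
Qed.

Lemma Xadj_lift x q : Xadj Q XQ (pi x) q -> exists y, pi y = q /\ Xadj G X x y.
Proof.
  intros [(a & ha & e) | (a & ha & e)].
  - exists (x ** a); split; [rewrite pi_mul, e; grp | left; gs; auto].
  - exists (x ** a^-1); split; [rewrite pi_mul, pi_inv, e; grp | right; gs; auto].
Qed.

Lemma walk_lift (R : G -> G -> Prop) (R' : Q -> Q -> Prop) n x q :
  (forall x q, R' (pi x) q -> exists y, pi y = q /\ R x y) ->
  walk R' n (pi x) q -> exists y, pi y = q /\ walk R n x y.
Proof.
  intro lift. revert x. induction n as [|n IH]; intros x w.
  - apply walk_0 in w; subst. exists x; split; auto. constructor.
  - inversion w as [|? ? q1 ? r w']; subst. destruct (lift _ _ r) as (y & <- & ry).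
    destruct (IH y w') as (z & e & wz). exists z; split; auto. econstructor; eauto.
Qed.

Lemma dist_pi x y : dist Q HQ XQ (pi x) (pi y) <= dist G H X x y.
Proof.
  apply dist_le; [apply HQ_sub | apply HQ_gen|].
  apply (walk_map pi (adj G H X)); [apply adj_pi | apply dist_walk; auto].
Qed.

Lemma dist_lift x q : exists y, pi y = q /\ dist G H X x y = dist Q HQ XQ (pi x) q.
Proof.
  destruct (walk_lift (adj G H X) (adj Q HQ XQ) (dist Q HQ XQ (pi x) q) x q) as (y & <- & w).
  - intros z p [h|h].
    + destruct (Xadj_lift z p h) as (y & e & k). exists y; split; auto. left; auto.
    + destruct (Hadj_lift z p h) as (y & e & k). exists y; split; auto. right; auto.
  - apply dist_walk; [apply HQ_sub | apply HQ_gen].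
  - exists y; split; auto. apply Nat.le_antisymm; [apply dist_le; auto | apply dist_pi].
Qed.

Lemma pi_ncl_mul k x : ncl G N k -> pi (k ** x) = pi x.
Proof. intro h. rewrite pi_mul. apply pi_ncl in h. rewrite h. apply gmul1l. Qed.

Lemma pi_rotation_mul v n x : rotation G N v n -> pi (n ** x) = pi x.
Proof. intro h. apply pi_ncl_mul. eapply rotation_ncl; eauto. Qed.

Definition geo (p q : Q) (x y : G) := pi x = p /\ pi y = q /\ dist G H X x y = dist Q HQ XQ p q.

(** If the geodesic crosses the coset of [v], rotating its tail replaces the crossing by another
    single edge at most, so the length does not grow; it cannot drop below the distance in [Q]. *)
Lemma geo_good p q : good G H X N (3 * polyD del) (geo p q).
Proof.
  split.
  - intros x y k hk (<- & <- & e). unfold geo. rewrite !pi_ncl_mul, dist_mul; auto.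
  - intros x y v (<- & <- & e).
    destruct (clean_or_split G H X Hsub Hgen v x y) as [c | (c & d & vc & vd & e' & _)].
    + left. apply near_pt_clean; auto.
    + right. intros n hn. unfold geo. rewrite (pi_rotation_mul v) by auto.
      repeat split. apply Nat.le_antisymm.
      * rewrite <- e, e'.
        assert (dist G H X c (n ** d) <= 1).
        { apply dist_Hadj; auto. eapply Hadj_trans; [auto | apply Hadj_sym; [auto | exact vc]|].
          eapply rotation_Hadj; eauto. }
        pose proof (dist_tri G H X Hsub Hgen x c (n ** y)).
        pose proof (dist_tri G H X Hsub Hgen c (n ** d) (n ** y)).
        rewrite (dist_mul G H X Hsub Hgen n d y) in *. lia.
      * rewrite <- (pi_rotation_mul v n y) by auto. apply dist_pi.
Qed.

(* A geodesic quadrilateral of the quotient lifts to a closed geodesic quadrilateral, and the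
   projection does not increase distances; so the four-point condition holds with the same constant. *)
Lemma hyp_quotient p1 p2 p3 p4 :
  12 * polyD del + 2 * polyD del <= Lam ->
  dist Q HQ XQ p1 p3 + dist Q HQ XQ p2 p4 <=
  Nat.max (dist Q HQ XQ p1 p2 + dist Q HQ XQ p3 p4) (dist Q HQ XQ p1 p4 + dist Q HQ XQ p2 p3) + del.
Proof.
  intro l. destruct (pi_surj p1) as [x1 e1].
  assert (lift : forall x p q, pi x = p -> exists y, geo p q x y).
  { intros x p q <-. destruct (dist_lift x q) as (y & e & d). exists y; repeat split; auto. }
  destruct (lift x1 p1 p2 e1) as [x2 g1]. destruct (lift x2 p2 p3 (proj1 (proj2 g1))) as [x3 g2].
  destruct (lift x3 p3 p4 (proj1 (proj2 g2))) as [x4 g3].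
  destruct (lift x4 p4 p1 (proj1 (proj2 g3))) as [x5 g4].
  assert (c : chain G [geo p1 p2; geo p2 p3; geo p3 p4; geo p4 p1] x1 x5).
  { repeat (eapply chain_cons; [eassumption|]). constructor. }
  apply (chain_close G H X Hsub Hgen del hyp N Lam Nnorm HLam deep (3 * polyD del)) in c.
  - apply chain_cons_inv in c as (y2 & h1 & c). apply chain_cons_inv in c as (y3 & h2 & c).
    apply chain_cons_inv in c as (y4 & h3 & c). apply chain_cons_inv in c as (y5 & h4 & c).
    apply chain_nil_inv in c. subst y5.
    subst p1. destruct h1 as (_ & <- & d1), h2 as (_ & <- & d2), h3 as (_ & <- & d3), h4 as (_ & _ & d4).
    pose proof (hyp x1 y2 y3 y4). pose proof (dist_pi x1 y3). pose proof (dist_pi y2 y4).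
    rewrite (dist_sym G H X Hsub Hgen x1 y4) in *.
    rewrite (dist_sym Q HQ XQ HQ_sub HQ_gen (pi x1) (pi y4)) in *. lia.
  - repeat (apply Forall_cons; [apply geo_good|]). apply Forall_nil.
  - simpl. lia.
  - apply pi_eq. destruct g4 as (_ & -> & _). auto.
Qed.

Section Letters.
Variable r : nat.
Hypothesis rLam : (r + 1) * (3 * polyD del) + 2 * polyD del <= Lam.

(* Lifts of one edge of [Cay(Q)] that is not an edge of the subgraph [Cay(HQ, HQ)]. *)
Definition away (p q : Q) (x y : G) :=
  pi x = p /\ pi y = q /\ (Xadj G X x y \/ (Hadj G H x y /\ ~ HQ p)).
Definition back (p q : Q) (x y : G) := pi x = p /\ pi y = q /\ Hadj G H x y.

Lemma edge_good (P Q' : Prop) p q (R : G -> G -> Prop) :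
  (forall x y, R x y <-> pi x = p /\ pi y = q /\ ((P /\ Xadj G X x y) \/ (Hadj G H x y /\ Q'))) ->
  good G H X N (3 * polyD del) R.
Proof.
  intro Rdef. split.
  - intros x y k hk h. apply Rdef in h. apply Rdef. rewrite !pi_ncl_mul by auto.
    destruct h as (h1 & h2 & [[h3 h4] | [h3 h4]]); repeat split; auto.
    + left; split; auto. apply Xadj_mul; auto.
    + right; split; auto. apply Hadj_mul; auto.
  - intros x y v h. apply Rdef in h. destruct h as (h1 & h2 & [[h3 h4] | [h3 h4]]).
    + left. apply near_pt_clean; auto. apply clean_Xadj; auto.
    + destruct (classic (Hadj G H v x)) as [vx | vx].
      * right. intros n hn. apply Rdef. rewrite (pi_rotation_mul v) by auto. repeat split; auto.
        right; split; auto.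
        eapply Hadj_trans; [auto | apply Hadj_sym; [auto | exact vx]|].
        eapply rotation_Hadj; eauto. eapply Hadj_trans; eauto.
      * left. apply near_pt_clean; auto. apply clean_Hadj; auto.
Qed.

(** The third clause lifts the walk; the fourth says that every chain of the same relations, in
    particular a rotated one, still avoids the edges of [H]. *)
Lemma walk_away n p q : walk (adj_off Q HQ XQ gone) n p q ->
  exists l, length l = n /\ Forall (good G H X N (3 * polyD del)) l /\
    (forall x, pi x = p -> exists y, pi y = q /\ chain G l x y) /\
    (forall x y, chain G l x y -> pi x = p -> pi y = q /\ walk (adj_off G H X gone) n x y).
Proof.
  induction 1 as [p | n p p' q a w (l & e & gl & ex & un)].
  - exists nil. repeat split; auto.
    + intros x <-. exists x; split; auto. constructor.
    + inversion H0; subst; auto.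
    + inversion H0; subst; constructor.
  - exists (away p p' :: l). repeat split.
    + simpl; auto.
    + constructor; auto. apply (edge_good True (~ HQ p) p p').
      intros x y. unfold away. tauto.
    + intros x e'. subst p.
      assert (k : exists y, away (pi x) p' x y).
      { destruct a as [a | [a b]].
        - destruct (Xadj_lift x p' a) as (y & e1 & k). exists y; repeat split; auto.
        - destruct (Hadj_lift x p' a) as (y & e1 & k). exists y; repeat split; auto.
          right; split; auto. intro t; apply b. unfold Hadj. gs. auto. }
      destruct k as [y k]. destruct (ex y) as (z & ez & cz); [apply k|].
      exists z; split; auto. eapply chain_cons; eauto.
    + inversion H0 as [|? ? ? z ? k c]; subst. eapply un; eauto. apply k.
    + inversion H0 as [|? ? ? z ? k c]; subst. eapply walk_cons; [|eapply un; eauto; apply k].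
      destruct k as (k1 & k2 & [k3 | [k3 k4]]); [left; auto | right; split; auto].
      intro t; apply k4. unfold Hadj in t. gsin t. exists x; auto.
Qed.

(** A short detour from 1 to [h] and the edge back form a loop in [Q] with at most [r + 1] sides. In
    the closed lift the point before the edge back lies in [H] and is joined to 1 by a detour of the
    same length. *)
Lemma letter_lift h : HQ h -> rdist_le Q HQ XQ gone r gone h ->
  exists g, H g /\ pi g = h /\ rdist_le G H X gone r gone g.
Proof.
  intros hh (n & ln & w). destruct (walk_away n gone h w) as (l & e & gl & ex & un).
  destruct (ex gone pi_one) as (y & ey & cy).
  assert (b : exists z, back h gone y z).
  { destruct (Hadj_lift y gone) as (z & ez & hz).
    - subst h. unfold Hadj. gs. destruct HQ_sub as (_ & _ & i). apply i; auto.
    - exists z; repeat split; auto. }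
  destruct b as [z bz].
  assert (c : chain G (l ++ [back h gone]) gone z).
  { eapply chain_app; eauto. apply chain_one; auto. }
  apply (chain_close G H X Hsub Hgen del hyp N Lam Nnorm HLam deep (3 * polyD del)) in c.
  - destruct (chain_app_inv _ _ _ _ _ c) as (g & c1 & c2).
    apply chain_one_inv in c2. destruct c2 as (e1 & e2 & e3).
    exists g; repeat split; auto.
    + apply Hadj_sym in e3; auto. unfold Hadj in e3. gsin e3. auto.
    + exists n; split; auto. apply (un gone g c1 pi_one).
  - apply Forall_app; split; auto. constructor; [|constructor].
    apply (edge_good False True h gone). intros u v. unfold back. tauto.
  - rewrite length_app; simpl. nia.
  - gs. apply pi_ncl. apply bz.
Qed.

(** Lifting letter by letter preserves the length, so the lift is again a geodesic. A coset it
    crosses is crossed by a letter of relative length at most [r], and passing to arbitrary entry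
    points costs [2 * polyD del] at each end. *)
Lemma short_lift u v : walk (short_adj Q HQ XQ r) (dist Q HQ XQ u v) u v ->
  exists t, pi t = u^-1 ** v /\ forall w, near_pt G H X w gone t (r + 4 * polyD del).
Proof.
  intro w.
  assert (w1 : walk (short_adj Q HQ XQ r) (dist Q HQ XQ gone (u^-1 ** v)) (pi gone) (u^-1 ** v)).
  { rewrite pi_one. replace (gone : Q) with (u^-1 ** u) by grp. rewrite dist_mul by (apply HQ_sub || apply HQ_gen).
    apply (walk_map (fun z => u^-1 ** z) (short_adj Q HQ XQ r)); auto.
    intros x y [a | [a b]]; [left; apply Xadj_mul; auto | right; split].
    { apply Hadj_mul; auto. } apply rdist_le_mul; auto. }
  assert (step : forall x q, short_adj Q HQ XQ r (pi x) q -> exists y, pi y = q /\ short_adj G H X r x y).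
  { intros x q [a | [a b]].
    - destruct (Xadj_lift x q a) as (y & e & k). exists y; split; auto. left; auto.
    - destruct (letter_lift ((pi x)^-1 ** q)) as (g & hg & e & d); [exact a| |].
      + apply (rdist_le_mul Q HQ XQ ((pi x)^-1)) in b. gsin b. auto.
      + exists (x ** g); split; [rewrite pi_mul, e; grp | right; split].
        * unfold Hadj. gs. auto.
        * apply (rdist_le_mul G H X x) in d. gsin d. auto. }
  destruct (walk_lift _ _ _ _ _ step w1) as (t & e & wt).
  exists t; split; auto.
  assert (dt : dist Q HQ XQ gone (u^-1 ** v) = dist G H X gone t).
  { apply Nat.le_antisymm.
    - rewrite <- e. rewrite <- pi_one. apply dist_pi.
    - apply dist_le; auto. eapply walk_mono; [|exact wt].
      intros a b [k | [k _]]; [left | right]; auto. }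
  rewrite dt in wt. intro c.
  destruct (geodesic_split G H X Hsub Hgen (short_adj G H X r) c gone t) as [k | (x & y & _ & s & _ & na & cx & cy & e')]; auto.
  - intros a b [k | [k _]]; [left | right]; auto.
  - apply near_pt_mono with (3 * polyD del); [lia|]. apply near_pt_clean; auto.
    eapply walk_mono; [|exact k]. intros a b [_ h]; exact h.
  - destruct s as [s | [s d]]; [exfalso; apply na; left; auto|].
    intros p q ep eq. apply rdist_le_mono with (2 * polyD del + (r + 2 * polyD del)); [lia|].
    eapply rdist_le_trans.
    { apply (near_pt_refl G H X Hsub Hgen del hyp c gone); [exact ep|]. split; [exact cx|].
      eapply clean_on_geodesic; eauto. }
    eapply rdist_le_trans.
    { eapply rdist_le_coset; [auto | apply Hadj_sym; [auto | exact cx] | exact d]. }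
    apply (near_pt_refl G H X Hsub Hgen del hyp c t); [|exact eq]. split; [exact cy|].
    apply (clean_on_geodesic G H X Hsub Hgen c t gone y x); auto.
    rewrite (dist_sym G H X Hsub Hgen t gone), (dist_sym G H X Hsub Hgen t y), (dist_sym G H X Hsub Hgen x gone). lia.
Qed.

End Letters.
End Filling.
(** * Conclusion *)

Section Paths.
Variables (G : Group) (H X : G -> Prop).
Hypothesis Hsub : is_subgroup H.
Hypothesis Hgen : generates (fun g => X g \/ H g).

Lemma path_walk (w : list (step G X H)) x : walk (adj G H X) (length w) x (path_end G x w).
Proof.
  revert x; induction w as [|[a b] w IH]; simpl; intro x; [constructor|].
  eapply walk_cons; [|apply IH]. unfold step_val; simpl.
  destruct a as [[a ha]|[a ha]]; destruct b; simpl.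
  - left; left. gs; auto.
  - left; right. gs; auto.
  - right. unfold Hadj. gs; auto.
  - right. unfold Hadj. gs. apply Hsub; auto.
Qed.

Lemma Xadj_step x y : Xadj G X x y -> exists s : step G X H,
  x ** step_val G s = y /\ exists a, fst s = inl a.
Proof.
  intros [h | h].
  - exists (inl (exist _ _ h), true). unfold step_val; simpl. split; [gs; auto | eauto].
  - exists (inl (exist _ _ h), false). unfold step_val; simpl. split; [gs; auto | eauto].
Qed.

Lemma Hadj_step x y : Hadj G H x y -> exists s : step G X H,
  x ** step_val G s = y /\ exists a, fst s = inr a.
Proof. intro h. exists (inr (exist H (x^-1 ** y) h), true). unfold step_val; simpl. split; [gs; auto | eauto]. Qed.

Lemma walk_path n x y : walk (adj G H X) n x y ->
  exists w : list (step G X H), length w = n /\ path_end G x w = y.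
Proof.
  induction 1 as [x | n x y z a _ (w & e1 & e2)].
  - exists nil; auto.
  - assert (k : exists s : step G X H, x ** step_val G s = y).
    { destruct a as [a | a]; [destruct (Xadj_step _ _ a) as (s & e & _) | destruct (Hadj_step _ _ a) as (s & e & _)]; eauto. }
    destruct k as (s & e). exists (s :: w); simpl. rewrite e; auto.
Qed.

Lemma walk_avoiding_path n x y : walk (adj_off G H X gone) n x y ->
  exists w : list (step G X H), length w = n /\ path_end G x w = y /\ avoids_HH G x w.
Proof.
  induction 1 as [x | n x y z a _ (w & e1 & e2 & e3)].
  - exists nil; simpl; auto.
  - destruct a as [a | [a b]].
    + destruct (Xadj_step _ _ a) as (s & e & l & f). exists (s :: w); simpl. rewrite e, f; auto.
    + destruct (Hadj_step _ _ a) as (s & e & l & f). exists (s :: w); simpl. rewrite e, f.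
      repeat split; auto. intro k; apply b. unfold Hadj. gs. auto.
Qed.

Lemma cay_dist_dist x y : cay_dist G X H x y (dist G H X x y).
Proof.
  split.
  - apply walk_path, dist_walk; auto.
  - intros w e. apply dist_le; auto. rewrite <- e. apply path_walk.
Qed.

Lemma four_point : cay_hyperbolic X H -> exists del : nat, forall x y z t,
  dist G H X x z + dist G H X y t <=
  Nat.max (dist G H X x y + dist G H X z t) (dist G H X x t + dist G H X y z) + del.
Proof.
  (* Gromov products are halves of sums of distances, so clearing denominators turns [delta] into
     [2 * delta]. *)
  intros (delta & _ & h). destruct (INR_unbounded (2 * delta)) as [del hd].
  exists del. intros x y z t.
  pose proof (h x z y t _ _ _ _ _ _ (cay_dist_dist x z) (cay_dist_dist x y) (cay_dist_dist z y)
    (cay_dist_dist x t) (cay_dist_dist z t) (cay_dist_dist y t)) as k.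
  rewrite (dist_sym G H X Hsub Hgen z y) in k.
  apply INR_le. rewrite plus_INR, plus_INR.
  pose proof (le_INR _ _ (Nat.le_max_l (dist G H X x y + dist G H X z t) (dist G H X x t + dist G H X y z))) as l.
  pose proof (le_INR _ _ (Nat.le_max_r (dist G H X x y + dist G H X z t) (dist G H X x t + dist G H X y z))) as l'.
  rewrite plus_INR in l, l'. unfold Rmin in k; destruct (Rle_dec _ _) in k; lra.
Qed.

End Paths.

(** * Choice of constants and the section *)

Section Main.
Variables (G : Group) (H X N : G -> Prop) (del : nat).
Hypothesis Hsub : is_subgroup H.
Hypothesis Hgen : generates (fun g => X g \/ H g).
Hypothesis hyp : forall x y z t,
  dist G H X x z + dist G H X y t <=
  Nat.max (dist G H X x y + dist G H X z t) (dist G H X x t + dist G H X y z) + del.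
Hypothesis Nnorm : is_normal_subgroup_of N H.

Definition letter_bound := 20 * theta del.
Definition short_bound := letter_bound + 4 * polyD del.
(** The summands serve the loops of [letter_lift], the word of at most 18 factors left over from a
    triangle, and the shortening argument. *)
Definition deep_bound :=
  (letter_bound + 1) * (3 * polyD del) + 18 * short_bound + 25 * polyD del.

Hypothesis deep : forall n, N n -> n <> gone -> ~ rdist_le G H X gone (deep_bound + 29 * polyD del) gone n.
Hypothesis no_involution : forall g : G, qeq N (g ** g) gone -> qeq N g gone.
Hypothesis malnormal : forall t : G, ~ (exists h, H h /\ qeq N t h) ->
  forall h1 h2, H h1 -> H h2 -> qeq N (t ** h1 ** t^-1) h2 -> qeq N h2 gone.

Lemma nonagon_section : exists s : G -> G,
  (forall g, qeq N (s g) g) /\ (forall g g', qeq N g g' -> s g = s g') /\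
  forall f g : G, exists c m : nat -> G, (forall i, i < 9 -> N (m i)) /\
    s f ** s g ** (s (f ** g))^-1 = prod_conj c m 9.
Proof.
  destruct (quotient_exists G N) as (Q & pi & pi_mul & pi_surj & pi_eq).
  set (HQ := image G Q pi H). set (XQ := image G Q pi X).
  assert (b1 : 25 * polyD del <= deep_bound) by (unfold deep_bound; lia).
  assert (b2 : 12 * polyD del + 2 * polyD del <= deep_bound) by (unfold deep_bound; lia).
  assert (b3 : (letter_bound + 1) * (3 * polyD del) + 2 * polyD del <= deep_bound) by (unfold deep_bound; lia).
  assert (b4 : 18 * short_bound + 2 * polyD del <= deep_bound) by (unfold deep_bound; lia).
  pose proof (pi_one G Q pi pi_mul) as p1. pose proof (pi_inv G Q pi pi_mul) as pV.
  pose proof (HQ_sub G Q pi H pi_mul Hsub) as sQ.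
  pose proof (HQ_gen G Q pi H X pi_mul pi_surj Hgen) as gQ.
  pose proof (pi_ncl G Q pi N pi_mul pi_eq) as pn.
  assert (hQ : forall x y z t,
    dist Q HQ XQ x z + dist Q HQ XQ y t <=
    Nat.max (dist Q HQ XQ x y + dist Q HQ XQ z t) (dist Q HQ XQ x t + dist Q HQ XQ y z) + del).
  { intros x y z t. apply (hyp_quotient G Q pi H X N del deep_bound); auto. }
  assert (pg : forall g h, pi g = h -> qeq N g gone -> h = gone).
  { intros g h <- k. rewrite <- p1. apply pi_eq; auto. }
  destruct (equivariant_lift Q HQ XQ sQ gQ del hQ G pi H
    (fun t => forall w, near_pt G H X w gone t short_bound)) as (F & Fpi & Fc); auto.
  - intros t ht w. apply (near_pt_mul_inv G H X Hsub Hgen t). gs. apply near_pt_sym; auto.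
  - intros a b ab. destruct (adjacent_geodesic Q HQ XQ sQ gQ del a b ab) as (u & v & au & bv & w).
    destruct (short_lift G Q pi H X N del deep_bound pi_mul pi_surj pi_eq Hsub Hgen hyp Nnorm b1 deep
      letter_bound b3 u v w) as (t & e & k).
    exists u, v, t; auto.
  - intros t h nt (h1 & hh1 & <-) (h2 & hh2 & e). destruct (pi_surj t) as [t' <-].
    rewrite <- pV, <- !pi_mul in e.
    assert (k : pi h2 = gone).
    { apply (pg h2); auto. apply (malnormal t') with h1; auto.
      - intros (h & hh & k). apply nt. exists h; split; auto. symmetry; apply pi_eq; auto.
      - apply pi_eq; auto. }
    rewrite e, !pi_mul, pV in k.
    replace (pi h1) with ((pi t')^-1 ** (pi t' ** pi h1 ** (pi t')^-1) ** pi t') by grp.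
    rewrite k. grp.
  - intros g e. destruct (pi_surj g) as [x <-]. apply (pg x); auto. apply no_involution.
    apply pi_eq. rewrite pi_mul, p1. auto.
  - exists (fun g => F (pi g)). split; [|split].
    + intro g. apply pi_eq, Fpi.
    + intros g g' k. apply pi_eq in k. rewrite k; auto.
    + intros f g. rewrite pi_mul.
      destruct (Fc (pi f) (pi g)) as (k & m & s & h & e & lm & ls & w).
      apply (conj_prod_prod_conj G N). rewrite e. apply conj_prod_conj. apply (conj_prod_mono G N (proj1 Nnorm) m); auto.
      apply (coset_word_conj_prod G H X Hsub Hgen del hyp N deep_bound Nnorm b1 deep short_bound m s); auto.
      * unfold short_bound. lia.
      * nia.
      * apply pn. replace h with (k^-1 ** (k ** h ** k^-1) ** k) by grp. rewrite <- e.
        rewrite !pi_mul, !pV, !Fpi. grp.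
Qed.

End Main.

Open Scope R_scope.

Theorem theorem4p1 (G : Group) (H X : G -> Prop) :
  is_subgroup H ->
  generates (fun g => X g \/ H g) ->
  cay_hyperbolic X H ->
  exists D : R, D > 0 /\
  forall N : G -> Prop,
    is_normal_subgroup_of N H ->
    (* (i) G/<<N>> has no element of order 2 *)
    (forall g : G, qeq N (gmul g g) gone -> qeq N g gone) ->
    (* (ii) the image of H in G/<<N>> is malnormal *)
    (forall t : G, ~ (exists h, H h /\ qeq N t h) ->
       forall h1 h2, H h1 -> H h2 ->
         qeq N (gmul (gmul t h1) (ginv t)) h2 -> qeq N h2 gone) ->
    (* (iii) \hat d(1,n) > 63 D for n in N \ {1} *)
    (forall n : G, N n -> n <> gone -> rel_dist_gt X H gone n (63 * D)) ->
    exists s : G -> G,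
      (* s induces a set-theoretic section of G -> G/<<N>> *)
      (forall g, qeq N (s g) g) /\
      (forall g g', qeq N g g' -> s g = s g') /\
      forall f g : G, exists c m : nat -> G,
        (forall i, (i < 9)%nat -> N (m i)) /\
        gmul (gmul (s f) (s g)) (ginv (s (gmul f g))) = prod_conj c m 9.
Proof.
  intros Hsub Hgen hyp. destruct (four_point G H X Hsub Hgen hyp) as [del h].
  set (b := (deep_bound del + 29 * polyD del)%nat).
  (* The successor makes the constant positive; a path longer than [63 * INR (S b)] is then longer
     than [b], the depth required by [nonagon_section]. *)
  exists (INR (S b)). split; [apply lt_0_INR; lia|].
  intros N Nnorm noinv maln far.
  apply (nonagon_section G H X N del); auto.
  intros n hn n1 (k & lk & w).
  destruct (walk_avoiding_path G H X k gone n w) as (p & <- & e & av).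
  pose proof (far n hn n1 p e av) as l.
  apply le_INR in lk. fold b in lk. rewrite S_INR in l. pose proof (pos_INR b). lra.
Qed.
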